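(* Let $\Omega\subset\mathbb{R}^n$ be a bounded Lipschitz domain, let $H\subset\Omega$ be a closed hypersurface bounding a region $\Omega_0\subset\subset\Omega$, let $\mu<-2$ and $E\in\mathbb{R}$. Let $q$ be a real potential on $\Omega$, with $-q$ bounded from below, which near $H$ has the form $$q(x)=-\operatorname{dist}(x,H)^{\mu}c_0(x),$$ where $c_0$ is a smooth function satisfying $c_0(x)>C_0>0$ in some neighborhood of $H$. Then the Cauchy data $$\mathcal{CD}_{q+E}=\Bigl\{\bigl(u|_{\partial\Omega},\tfrac{\partial u}{\partial n}|_{\partial\Omega}\bigr):u\in H^1(\Omega),\ u\text{ is a minimizer of }G_{q+E}\Bigr\}$$ does not depend on $q$ in $\Omega_0$ (i.e. two such potentials which coincide on $\Omega\setminus\Omega_0$ have the same Cauchy data). In particular, if the solution $u$ of the minimization problem $G_{q+E}(u)=\inf G_{q+E}(v)$ (with boundary value $f$) is unique, then $u$ vanishes identically in $\Omega_0$.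
   Context: $\operatorname{dist}$ is the Euclidean distance and $n$ also denotes the unit outer normal to $\Omega$. For $f$ a boundary value on $\partial\Omega$ ($f\in H^{1/2}(\partial\Omega)$), $G_{q+E}:\{v\in H^1(\Omega):v|_{\partial\Omega}=f\}\to\mathbb{R}\cup\{\infty\}$ is the functional $$G_{q+E}(v)=\int_\Omega\bigl(|\nabla v(x)|^2-(q(x)+E)|v(x)|^2\bigr)\,dx,$$ with $G_{q+E}(v)=\infty$ when $q|v|^2\notin L^1(\Omega)$. A function $u\in H^1(\Omega)$ with $u|_{\partial\Omega}=f$ is called a minimizer (and, by definition, a solution of the boundary value problem $(\Delta+q+E)u=0$ in $\Omega$, $u|_{\partial\Omega}=f$) if $G_{q+E}(u)=\inf G_{q+E}(v)$, the infimum being over all $v\in H^1(\Omega)$ with $v|_{\partial\Omega}=f$. In the definition of $\mathcal{CD}_{q+E}$, $u$ ranges over minimizers for all boundary values $f$.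
   Formalization: The first claim additionally assumes that G_{q+E}, on H^1 functions vanishing outside Ω_0, is bounded below for both potentials or for neither; without this it fails, since the infimum can be −∞ for one potential while the other has a minimizer. *)

(* Defs.v *)
From HB Require Import structures.
From mathcomp Require Import all_boot all_order all_algebra.
From mathcomp Require Import complex.
From mathcomp Require Import all_classical all_reals all_analysis.

Set Implicit Arguments.
Unset Strict Implicit.
Unset Printing Implicit Defensive.

Import Order.TTheory GRing.Theory Num.Theory.
Import numFieldNormedType.Exports.

Local Open Scope classical_set_scope.
Local Open Scope ring_scope.

(** ** Lebesgue measure on R^n *)

Definition rV_display : measure_display -> measure_display.
Proof. exact. Qed.

(* The sigma-algebra on row vectors generated by the coordinate maps; for
   R : realType it is the Borel sigma-algebra of R^n. *)
Section measurable_rV.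
Context {d : measure_display} {T : measurableType d} (n : nat).

Let coord (i : 'I_n) (x : 'rV[T]_n) : T := x 0 i.

Let rV_set0 : g_sigma_preimage coord set0.
Proof. exact: sigma_algebra0. Qed.

Let rV_setC A : g_sigma_preimage coord A -> g_sigma_preimage coord (~` A).
Proof. exact: sigma_algebraC. Qed.

Let rV_bigcup (F : (set 'rV[T]_n)^nat) :
  (forall i, g_sigma_preimage coord (F i)) ->
  g_sigma_preimage coord (\bigcup_i (F i)).
Proof. exact: sigma_algebra_bigcup. Qed.

HB.instance Definition _ := @isMeasurable.Build (rV_display d)
  'rV[T]_n (g_sigma_preimage coord) rV_set0 rV_setC rV_bigcup.

End measurable_rV.



Section measurable_rV_theory.
Context {d d1 : measure_display}.
Context {T : measurableType d} {T1 : measurableType d1}.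

Lemma measurable_coord n (i : 'I_n) :
  measurable_fun [set: 'rV[T]_n] (fun x => x 0 i).
Proof.
move=> _ Y mY; rewrite setTI; apply: sub_sigma_algebra => /=.
rewrite -bigcup_seq/=; exists i => /=; first by rewrite mem_index_enum.
by exists Y => //; rewrite setTI.
Qed.

Lemma measurable_fun_coord n (f : T1 -> 'rV[T]_n) :
  (forall i, measurable_fun [set: T1] (fun x => f x 0 i)) ->
  measurable_fun [set: T1] f.
Proof.
move=> mf.
have sub : g_sigma_preimage (fun (i : 'I_n) (x : 'rV[T]_n) => x 0 i) `<=`
    [set A | measurable (f @^-1` A)].
  apply: smallest_sub.
    split=> /=.
    - by rewrite preimage_set0.
    - by move=> A mA; rewrite setTD preimage_setC; exact: measurableC.
    - move=> F mF; rewrite preimage_bigcup; exact: bigcupT_measurable.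
  rewrite -bigcup_seq/=; apply: bigcup_sub => i _ A [B mB <-].
  by rewrite setTI; have := mf i measurableT B mB; rewrite setTI.
by move=> _ Y mY; rewrite setTI; exact: sub.
Qed.

End measurable_rV_theory.


Section lebesgue_rV.
Context {R : realType}.

Definition cons_rV n (p : measurableTypeR R * 'rV[R]_n) : 'rV[R]_n.+1 :=
  \row_i if unlift ord0 i is Some j then p.2 0 j else p.1.

Definition uncons_rV n (x : 'rV[R]_n.+1) : measurableTypeR R * 'rV[R]_n :=
  (x 0 ord0, \row_j x 0 (lift ord0 j)).

Lemma cons_rVK n : cancel (@cons_rV n) (@uncons_rV n).
Proof.
move=> [t x]; congr pair; first by rewrite mxE unlift_none.
by apply/rowP => j; rewrite !mxE liftK.
Qed.

Lemma measurable_cons_rV n :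
  measurable_fun [set: measurableTypeR R * 'rV[R]_n] (@cons_rV n).
Proof.
apply: measurable_fun_coord => i; rewrite /cons_rV.
under eq_fun do rewrite mxE.
case: (unliftP ord0 i) => [j _|_].
  exact: (measurableT_comp (measurable_coord j) measurable_snd).
by move=> _ Y mY; exact: (@measurable_fst _ _ (measurableTypeR R)).
Qed.

Lemma measurable_uncons_rV n : measurable_fun [set: 'rV[R]_n.+1] (@uncons_rV n).
Proof.
apply/measurable_fun_pairP; split.
  by move=> _ Y mY; exact: (@measurable_coord _ R n.+1 ord0).
apply: measurable_fun_coord => i.
rewrite (_ : (fun _ => _) = fun x : 'rV[R]_n.+1 => x 0 (lift ord0 i)).
  exact: measurable_coord.
by apply/funext => x; rewrite /= mxE.
Qed.

Section step.
Context (n : nat) (m : {sigma_finite_measure set 'rV[R]_n -> \bar R}).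
Local Open Scope ereal_scope.

Definition lebesgue_rV_step : set 'rV[R]_n.+1 -> \bar R :=
  pushforward (lebesgue_measure \x m) (@cons_rV n).

Let pm : {measure set 'rV[R]_n.+1 -> \bar R} :=
  measure_function_pushforward__canonical__measure_function_Measure
    (lebesgue_measure \x m)%E (@measurable_cons_rV n).

Let step0 : lebesgue_rV_step set0 = 0.
Proof. exact: (measure0 pm). Qed.

Let step_ge0 A : 0 <= lebesgue_rV_step A.
Proof. exact: (measure_ge0 pm). Qed.

Let step_sigma_additive : semi_sigma_additive lebesgue_rV_step.
Proof. exact: (@measure_semi_sigma_additive _ _ _ pm). Qed.

HB.instance Definition _ := isMeasure.Build _ _ _ lebesgue_rV_step
  step0 step_ge0 step_sigma_additive.

Let step_sigma_finite : sigma_finite setT lebesgue_rV_step.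
Proof.
have /sigma_finiteP[F [TF ndF Foo]] := sigma_finiteT (@lebesgue_measure R).
have /sigma_finiteP[G [TG ndG Goo]] := sigma_finiteT m.
exists (fun k => @uncons_rV n @^-1` (F k `*` G k)).
  rewrite predeqE => x; split => // _.
  have : [set: measurableTypeR R] (uncons_rV x).1 by [].
  have : [set: 'rV[R]_n] (uncons_rV x).2 by [].
  rewrite TF TG => -[j _ Gj] [i _ Fi]; exists (maxn i j) => //; split.
  - by move: Fi; exact/subsetPset/ndF/leq_maxl.
  - by move: Gj; exact/subsetPset/ndG/leq_maxr.
move=> k; have [mF Fk] := Foo k; have [mG Gk] := Goo k; split.
  rewrite -[X in measurable X]setTI.
  by apply: measurable_uncons_rV => //; exact: measurableX.
rewrite /lebesgue_rV_step /pushforward -comp_preimage.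
rewrite (_ : _ \o _ = id); last by apply/funext => p /=; rewrite cons_rVK.
rewrite preimage_id [ltLHS](product_measure1E lebesgue_measure m mF mG).
by rewrite lte_mul_pinfty// ge0_fin_numE.
Qed.

HB.instance Definition _ := Measure_isSigmaFinite.Build _ _ _
  lebesgue_rV_step step_sigma_finite.

End step.

Fixpoint lebesgue_rV n : {sigma_finite_measure set 'rV[R]_n -> \bar R} :=
  match n with
  | 0 => \d_(0 : 'rV[R]_0)
  | n'.+1 => lebesgue_rV_step (lebesgue_rV n')
  end.

End lebesgue_rV.

(** ** Hausdorff measure

   The normalizing factor is omitted: the measure is only used for null sets,
   measurability and convergence in L^2 of hypersurfaces. *)

Section hausdorff.
Context {R : realType} {n : nat}.
Local Open Scope ereal_scope.

Definition enorm (x : 'rV[R]_n) : R := Num.sqrt (\sum_i x 0 i ^+ 2)%R.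

Definition ediam (A : set 'rV[R]_n) : \bar R :=
  ereal_sup [set (enorm (x - y))%:E | x in A & y in A].

Definition hausdorff_gauge (k : nat) (delta : R) (A : set 'rV[R]_n) : \bar R :=
  if A == set0 then 0
  else if ediam A <= delta%:E then ediam A ^+ k else +oo.

Definition hausdorff_content (k : nat) (delta : R) (A : set 'rV[R]_n) :=
  ereal_inf [set \sum_(i <oo) hausdorff_gauge k delta (B i) |
             B in [set B : (set 'rV[R]_n)^nat | A `<=` \bigcup_i B i]].

Definition hausdorff_measure (k : nat) (A : set 'rV[R]_n) : \bar R :=
  ereal_sup [set hausdorff_content k delta A |
             delta in [set delta | 0 < delta]%R].

Let T := g_sigma_algebraType [set: set 'rV[R]_n].

Let gauge0 k delta : hausdorff_gauge k delta set0 = 0.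
Proof. by rewrite /hausdorff_gauge eqxx. Qed.

Let ediam_ge0 A : A != set0 -> 0 <= ediam A.
Proof.
move=> /set0P[x Ax]; apply: ereal_sup_ubound.
exists x => //; exists x => //.
by rewrite subrr /enorm big1 ?sqrtr0// => i _; rewrite mxE expr0n.
Qed.

Let gauge_ge0 k delta A : 0 <= hausdorff_gauge k delta A.
Proof.
rewrite /hausdorff_gauge; case: ifPn => // A0.
by case: ifP => // _; rewrite expe_ge0// ediam_ge0.
Qed.

Let contentE k delta :
  hausdorff_content k delta =
  mu_ext (hausdorff_gauge k delta : set T -> \bar R).
Proof.
apply/funext => A; rewrite /hausdorff_content /mu_ext; congr ereal_inf.
apply/seteqP; split => [_ [B AB <-]|_ [B [_ AB] <-]]; exists B => //.
by split => // i; exact: sub_sigma_algebra.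
Qed.

Let content_ge0 k delta A : 0 <= hausdorff_content k delta A.
Proof. by rewrite contentE mu_ext_ge0. Qed.

Let content0 k delta : hausdorff_content k delta set0 = 0.
Proof. by rewrite contentE; exact: (@mu_ext0 _ T). Qed.

Let hausdorff0 k : hausdorff_measure k set0 = 0.
Proof.
rewrite /hausdorff_measure (_ : image _ _ = [set 0]) ?ereal_sup1//.
apply/seteqP; split=> [_ [e e0 <-]|_ ->] /=; first exact: content0.
by exists 1%R; [exact: ltr01|exact: content0].
Qed.

Let hausdorff_ge0 k A : 0 <= hausdorff_measure k A.
Proof.
apply: (le_trans (content_ge0 k 1 A)); apply: ereal_sup_ubound.
by exists 1%R => //; exact: ltr01.
Qed.

Let le_hausdorff k : {homo hausdorff_measure k : A B / A `<=` B >-> A <= B}.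
Proof.
move=> A B AB; apply: ge_ereal_sup => _ [e e0 <-].
apply: (@le_trans _ _ (hausdorff_content k e B)).
  by rewrite contentE; exact: (@le_mu_ext _ T).
by apply: ereal_sup_ubound; exists e.
Qed.

Let hausdorff_sigma_subadditive k : sigma_subadditive (hausdorff_measure k).
Proof.
move=> F; apply: ge_ereal_sup => _ [e e0 <-].
apply: (@le_trans _ _ (\sum_(i <oo) hausdorff_content k e (F i))).
  rewrite contentE; apply: (@mu_ext_sigma_subadditive _ T) => //.
apply: lee_nneseries => [i _ _|i _]; first exact: content_ge0.
by apply: ereal_sup_ubound; exists e.
Qed.

HB.instance Definition _ k := isOuterMeasure.Build R 'rV[R]_n
  (hausdorff_measure k) (hausdorff0 k) (hausdorff_ge0 k) (@le_hausdorff k)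
  (@hausdorff_sigma_subadditive k).

End hausdorff.

Section geometry.
Context {R : realType} {n : nat}.
Implicit Types (Omega H U : set 'rV[R]_n) (x y : 'rV[R]_n).

Definition dist_set x (A : set 'rV[R]_n) : R := inf [set enorm (x - y) | y in A].

Definition boundary (A : set 'rV[R]_n) := closure A `\` A°.

Definition domain Omega := [/\ Omega !=set0, open Omega & connected Omega].

(* Near each boundary point, Omega is the part above the graph of a Lipschitz
   function gamma in the direction of a unit vector e; only the values of gamma
   on the hyperplane orthogonal to e matter. *)
Definition lipschitz_boundary Omega := forall x, boundary Omega x ->
  exists r (e : 'rV[R]_n) (gamma : 'rV[R]_n -> R),
    [/\ 0 < r, enorm e = 1, lipschitz gamma &
      forall y, enorm (y - x) < r ->
        let t := \sum_i y 0 i * e 0 i in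
        Omega y <-> gamma (y - t *: e) < t].

Definition partial (i : 'I_n) (f : 'rV[R]_n -> R) : 'rV[R]_n -> R :=
  fun x => 'D_(delta_mx 0 i) f x.

Definition iter_partial (s : seq 'I_n) (f : 'rV[R]_n -> R) := foldr partial f s.

(* C^oo on the open set U *)
Definition smooth_on U (f : 'rV[R]_n -> R) := forall s x, U x ->
  {for x, continuous (iter_partial s f)} /\
  forall i, derivable (iter_partial s f) x (delta_mx 0 i).

(* A closed subset of R^n which is a smooth embedded submanifold of
   codimension 1. *)
Definition closed_hypersurface H := closed H /\
  forall x, H x -> exists U (rho : 'rV[R]_n -> R),
    [/\ open U, U x, smooth_on U rho,
        forall y, U y -> H y <-> rho y = 0
      & exists i, partial i rho x != 0].

Record singular_potential Omega H (mu : R) (q : 'rV[R]_n -> R) : Prop := {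
  potential_measurable : measurable_fun Omega q ;
  potential_bounded : exists C, forall x, Omega x -> C <= - q x ;
  (* the formula is imposed off H, where the distance does not vanish *)
  potential_near : exists U (c0 : 'rV[R]_n -> R) (C0 : R),
    [/\ open U, H `<=` U & U `<=` Omega] /\
    [/\ smooth_on U c0, 0 < C0, forall x, U x -> C0 < c0 x &
      forall x, U x -> ~ H x -> q x = - (dist_set x H `^ mu * c0 x)]
}.

End geometry.

Section complex_functions.
Context {R : realType} {n : nat}.
Local Notation C := R[i].
Local Notation leb := (@lebesgue_rV R n).
Implicit Types (D Omega : set 'rV[R]_n) (u v f : 'rV[R]_n -> C)
  (phi : 'rV[R]_n -> R).

Definition reF u x : R := complex.Re (u x).
Definition imF u x : R := complex.Im (u x).

Definition sqmod (z : C) : R := complex.Re z ^+ 2 + complex.Im z ^+ 2.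

Definition cintegral D u : C :=
  Complex (\int[leb]_(x in D) reF u x) (\int[leb]_(x in D) imF u x).

Definition L1 D u := leb.-integrable D (EFin \o reF u) /\
  leb.-integrable D (EFin \o imF u).

Definition L2 D u := [/\ measurable_fun D (reF u), measurable_fun D (imF u) &
  (\int[leb]_(x in D) (sqmod (u x))%:E < +oo)%E].

(* phi in C^oo_c(R^n), with support contained in D *)
Definition test_function D phi := smooth_on setT phi /\
  let supp := closure [set x | phi x != 0] in compact supp /\ supp `<=` D.

Definition weak_gradient Omega u (w : 'I_n -> 'rV[R]_n -> C) := forall i,
  L2 Omega (w i) /\
  forall phi, test_function Omega phi ->
    cintegral Omega (fun x => u x * (partial i phi x)%:C%C) =
    - cintegral Omega (fun x => w i x * (phi x)%:C%C).

Definition H1 Omega u := L2 Omega u /\ exists w, weak_gradient Omega u w.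

Definition grad Omega u : 'I_n -> 'rV[R]_n -> C :=
  xget (fun _ _ => 0) [set w | weak_gradient Omega u w].

Definition cpartial i u x : C :=
  Complex (partial i (reF u) x) (partial i (imF u) x).

(* squared distance in H^1(Omega) of a smooth function g and of u in H^1 *)
Definition H1_sqdist Omega (g u : 'rV[R]_n -> C) : \bar R :=
  (\int[leb]_(x in Omega) (sqmod (g x - u x))%:E +
   \sum_i \int[leb]_(x in Omega)
     (sqmod (cpartial i g x - grad Omega u i x))%:E)%E.

(* (n-1)-dimensional Hausdorff measure, as a measure on the sigma-algebra of
   its Caratheodory measurable sets *)
Definition surface_outer_measure : {outer_measure set 'rV[R]_n -> \bar R} :=
  hausdorff_measure n.-1.

Local Notation boundary_type := (caratheodory_type surface_outer_measure).

Definition surface_measure : {measure set boundary_type -> \bar R} :=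
  (surface_outer_measure : set boundary_type -> \bar R).

(* f is the trace of u in L^2(boundary Omega): the trace operator is the
   continuous extension of the restriction of smooth functions. The values of f
   off the boundary are irrelevant. *)
Definition is_trace Omega u f :=
  [/\ measurable_fun (boundary Omega : set boundary_type) (reF f),
      measurable_fun (boundary Omega : set boundary_type) (imF f) &
      exists g : ('rV[R]_n -> C)^nat,
      [/\ forall k, test_function setT (reF (g k)) /\
                    test_function setT (imF (g k)),
          H1_sqdist Omega (g k) u @[k --> \oo] --> 0%E &
          (\int[surface_measure]_(x in boundary Omega)
             (sqmod (g k x - f x))%:E)%E @[k --> \oo] --> 0%E]].

(* G_(q+E)(v) for v in H^1(Omega) *)
Definition energy Omega (q : 'rV[R]_n -> R) (E : R) v : \bar R :=
  if `[< leb.-integrable Omega (fun x => (q x * sqmod (v x))%:E) >] then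
    (\int[leb]_(x in Omega)
      (\sum_i sqmod (grad Omega v i x) - (q x + E) * sqmod (v x))%:E)%E
  else +oo%E.

Definition is_minimizer Omega q E f u :=
  [/\ H1 Omega u, is_trace Omega u f &
    energy Omega q E u = ereal_inf
      [set energy Omega q E v |
       v in [set v | H1 Omega v /\ is_trace Omega v f]]].

(* The normal derivative of u in H^1(Omega) is the functional
     phi |-> \int_(boundary Omega) (du/dn) phi
   on C^oo_c(R^n), defined weakly by Green's formula: its value depends only on
   the boundary values of phi, and, for phi supported in a neighbourhood U of
   the boundary in which the distribution Delta u is an integrable function F,
   it is \int_Omega grad u . grad phi + \int_Omega F phi. *)
Definition test_fun := {phi : 'rV[R]_n -> R | test_function setT phi}.

Definition boundary_functional := test_fun -> C.

Definition dirichlet_form Omega u phi : C :=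
  cintegral Omega (fun x => \sum_i grad Omega u i x * (partial i phi x)%:C%C).

Definition is_normal_derivative Omega u (g : boundary_functional) :=
  (forall phi psi : test_fun,
     (forall x, boundary Omega x -> sval phi x = sval psi x) -> g phi = g psi) /\
  exists U F, [/\ open U, boundary Omega `<=` U, L1 (Omega `&` U) F,
    forall phi, test_function (Omega `&` U) phi ->
      - dirichlet_form Omega u phi =
      cintegral (Omega `&` U) (fun x => F x * (phi x)%:C%C) &
    forall phi : test_fun, test_function U (sval phi) ->
      g phi = dirichlet_form Omega u (sval phi) +
              cintegral (Omega `&` U) (fun x => F x * (sval phi x)%:C%C)].

Definition cauchy_data Omega q E :
    set (('rV[R]_n -> C) * boundary_functional) :=
  [set fg | exists2 u, is_minimizer Omega q E fg.1 u &
                       is_normal_derivative Omega u fg.2].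

(* G_(q+E) is bounded from below on the elements of H^1(Omega) which vanish
   outside Omega0. When this fails, inf G_(q+E) = -oo for every boundary value
   for which G_(q+E) is not identically +oo, and G_(q+E) has no minimizer of
   finite energy. Whether it fails does depend on q in Omega0: it fails as soon
   as E exceeds the bottom of the Dirichlet spectrum of - Delta - q in Omega0,
   and subtracting a large constant from q in Omega0 away from H restores it. *)
Definition inner_bounded_below Omega Omega0 q E := exists m : R, forall v,
  H1 Omega v -> {ae leb, forall x, (Omega `\` Omega0) x -> v x = 0} ->
  (m%:E <= energy Omega q E v)%E.

End complex_functions.

(* Main.v *)
(* Let d be the distance to H. Near H one has -q >= c d^mu with mu < -2, so that
   the integrability of q |u|^2 forces u / d to be square integrable there, with
   an integral over the strip {d < r} of order o(1). Hence, for cutoffs zeta_m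
   tending to the indicator of Omega0 with gradient of order m on a strip of width
   of order 1/m, u grad zeta_m tends to 0 in L^2, and passing to the limit in
   grad (zeta_m u) shows that u cut off sharply along H is still in H^1, without
   any contribution of H to the gradient. Thus functions of finite energy can be
   glued freely across H, with the trace of the outer one, and the energy is the
   sum of an outer and of an inner part.

   If u is a minimizer of finite energy, replacing u by t b in Omega0 and letting t
   vary shows that the inner energy, which is quadratic, is nonnegative. Then the
   function equal to u off Omega0 and to 0 in Omega0 is a minimizer too, for every
   potential with nonnegative inner energy that agrees with q off Omega0, and it
   has the Cauchy data of u. If the infimum is infinite, every function with the
   given trace is a minimizer, for both potentials; adding zeta_m to u then
   contradicts uniqueness. *)

Require Import Defs.
From mathcomp Require Import all_boot all_order all_algebra.
From mathcomp Require Import complex ring lra.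
From mathcomp Require Import all_classical all_reals all_analysis.
From mathcomp Require Import measurable_realfun.

Set Implicit Arguments.
Unset Strict Implicit.
Unset Printing Implicit Defensive.

Import Order.TTheory GRing.Theory Num.Theory.
Import numFieldNormedType.Exports.

Local Open Scope classical_set_scope.
Local Open Scope ring_scope.

(** * Smooth functions *)

(** The distance to [H] need not be smooth, so the cutoffs are not functions of it: they are made
    from bumps centred at grid points near the boundary of [Omega0], and the distance enters only
    when their gradient is compared with [q]. Built for any bounded open set, the same cutoffs
    approximate indicators of open sets, which gives the density of test functions in L^2. Density
    is unavoidable because [grad] is a choice among weak gradients and is determined only almost
    everywhere: each comparison of gradients rests on their uniqueness. The other obstacle is the
    trace, defined by approximation with smooth functions. To see that a change of [u] inside
    [Omega0] keeps it, the change has to be approximated in H^1 by test functions supported in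
    [Omega]. Mollification supplies them: it commutes with the derivatives because the change,
    extended by 0, has a weak gradient on the whole space, and the compact closure of [Omega0]
    leaves room in [Omega] for the support of the kernel. *)

Section directional.
Context {R : realType} {V : normedModType R}.
Implicit Types (f : V -> R) (x v : V).

(** Reduces directional derivatives to one real variable, where the chain rule is available. *)
Lemma is_derive_line f x v (d : R) :
  is_derive x v f d <-> is_derive (0 : R) 1 (fun t : R => f (t *: v + x)) d.
Proof.
have E : (fun h : R => h^-1 *: ((f \o shift x) (h *: v) - f x)) =
   (fun h : R => h^-1 *: (((fun t : R => f (t *: v + x)) \o shift 0) (h *: 1) -
     (fun t : R => f (t *: v + x)) 0)).
  by apply/funext => h /=; rewrite addr0 scale0r add0r [_%:A]mulr1.
split=> -[H1 H2]; split.
- exact: (derivable1P f x v).1.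
- by move: H2; rewrite /derive E.
- exact: (derivable1P f x v).2.
- by rewrite /derive E; move: H2.
Qed.

Lemma is_derive_line_at f x v (s d : R) :
  is_derive (s *: v + x) v f d ->
  is_derive s 1 (fun t : R => f (t *: v + x)) d.
Proof.
move=> [H1 H2].
have E : (fun h : R => h^-1 *: ((f \o shift (s *: v + x)) (h *: v) - f (s *: v + x))) =
   (fun h : R => h^-1 *: (((fun t : R => f (t *: v + x)) \o shift s) (h *: 1) -
     (fun t : R => f (t *: v + x)) s)).
  by apply/funext => h /=; rewrite [_%:A]mulr1 scalerDl addrA.
split; first by rewrite /derivable -E.
by rewrite /derive -E.
Qed.

Lemma is_derive_comp f (h : R -> R) x v (d e : R) :
  is_derive x v f d -> is_derive (f x) 1 h e ->
  is_derive x v (h \o f) (e * d).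
Proof.
move=> /is_derive_line df dh; apply/is_derive_line.
have dh' : is_derive ((fun t : R => f (t *: v + x)) 0) 1 h e.
  by rewrite scale0r add0r.
by have := @is_derive1_comp R h (fun t => f (t *: v + x)) 0 _ _ dh' df.
Qed.

End directional.

Section smooth.
Context {R : realType} {n : nat}.
Local Notation V := 'rV[R]_n.
Local Notation dlt i := (delta_mx 0 i : V).
Implicit Types (f g : V -> R) (i : 'I_n).

Record smooth f : Prop := Smooth { smooth_onT : smooth_on setT f }.

(** A coinduction principle: iterated partial derivatives never leave [P]. The closure properties of
    smooth functions are obtained by exhibiting a class that is stable under partial derivatives. *)
Lemma smooth_class (P : (V -> R) -> Prop) :
  (forall f, P f -> continuous f /\
     forall i, (forall x, derivable f x (dlt i)) /\ P (partial i f)) ->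
  forall f, P f -> smooth f.
Proof.
move=> H f Pf; split=> s x _.
have : P (iter_partial s f).
  by elim: s => // i s IH /=; have [_ /(_ i)[]] := H _ IH.
by move=> /H[c d]; split=> [|i]; [exact: c|exact: (d i).1].
Qed.

Lemma smooth_cont f : smooth f -> continuous f.
Proof. by move=> [sf] x; have [] := sf [::] x I. Qed.

Lemma smooth_der f i x : smooth f -> derivable f x (dlt i).
Proof. by move=> [sf]; have [_ ] := sf [::] x I; apply. Qed.

Lemma smooth_is_derive f i x : smooth f -> is_derive x (dlt i) f (partial i f x).
Proof. by move=> sf; apply/derivableP/smooth_der. Qed.

Lemma smooth_partial f i : smooth f -> smooth (partial i f).
Proof.
move=> [sf]; split=> s x _; have := sf (rcons s i) x I.
by rewrite /iter_partial foldr_rcons.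
Qed.

Lemma partialE f i x d : is_derive x (dlt i) f d -> partial i f x = d.
Proof. by case. Qed.

Lemma partial_cst (c : R) i : partial i (fun=> c) = fun=> 0.
Proof. by apply/funext => x; apply: partialE; exact: is_derive_cst. Qed.

Lemma smooth_cst (c : R) : smooth (fun=> c).
Proof.
apply: (@smooth_class (fun f => exists c, f = fun=> c)); last by exists c.
move=> _ [{}c ->]; split; first exact: cst_continuous.
move=> i; split; first by move=> x; exact: derivable_cst.
by exists 0; rewrite partial_cst.
Qed.

Lemma is_derive_coord (i j : 'I_n) (x : V) :
  is_derive x (dlt i) (fun y : V => y 0 j) ((j == i)%:R).
Proof.
apply/is_derive_line.
rewrite (_ : (fun t => _) = (fun t : R => t * (j == i)%:R + x 0 j)).
  by apply: is_derive_eq; rewrite scaler0 addr0 [_%:A]mulr1 add0r.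
by apply/funext => t; rewrite !mxE eqxx.
Qed.

Lemma smooth_coord (j : 'I_n) : smooth (fun y => y 0 j).
Proof.
apply: (@smooth_class (fun f => f = (fun y => y 0 j) \/ exists c, f = fun=> c)); last by left.
move=> f [->|[c ->]].
  split; first by move=> x; exact: coord_continuous.
  move=> i; split=> [x|]; first by have [] := is_derive_coord i j x.
  right; exists (j == i)%:R; apply/funext => x.
  by apply: partialE; exact: is_derive_coord.
split; first exact: cst_continuous.
move=> i; split; first by move=> x; exact: derivable_cst.
by right; exists 0; rewrite partial_cst.
Qed.

Lemma continuous_add f g : continuous f -> continuous g ->
  continuous (fun x => f x + g x).
Proof. by move=> cf cg x; apply: continuousD; [exact: (cf x)|exact: (cg x)]. Qed.

Lemma continuous_mul f g : continuous f -> continuous g ->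
  continuous (fun x => f x * g x).
Proof. by move=> cf cg x; apply: continuousM; [exact: (cf x)|exact: (cg x)]. Qed.

Lemma partialD f g i x : smooth f -> smooth g ->
  partial i (fun x => f x + g x) x = partial i f x + partial i g x.
Proof.
move=> sf sg; apply: partialE.
exact: (is_deriveD (smooth_is_derive i x sf) (smooth_is_derive i x sg)).
Qed.

Lemma smoothD f g : smooth f -> smooth g -> smooth (fun x => f x + g x).
Proof.
move=> sf sg.
apply: (@smooth_class (fun h => exists f g, [/\ smooth f, smooth g & h = fun x => f x + g x])); last by exists f, g.
move=> _ [{sf}f [{sg}g [sf sg ->]]]; split.
  by apply: continuous_add; exact: smooth_cont.
move=> i; split=> [x|]; first by apply: derivableD; exact: smooth_der.
exists (partial i f), (partial i g); split; [exact: smooth_partial..|].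
by apply/funext => x; rewrite partialD.
Qed.

Lemma partialM f g i x : smooth f -> smooth g ->
  partial i (fun x => f x * g x) x = f x * partial i g x + g x * partial i f x.
Proof.
move=> sf sg; apply: partialE.
exact: (is_deriveM (smooth_is_derive i x sf) (smooth_is_derive i x sg)).
Qed.

Lemma smooth_sum (I : Type) (r : seq I) (F : I -> V -> R) :
  (forall k, smooth (F k)) -> smooth (fun x => \sum_(k <- r) F k x).
Proof.
move=> sF; elim: r => [|k r IH].
  by under eq_fun do rewrite big_nil; exact: smooth_cst.
by under eq_fun do rewrite big_cons; exact: smoothD.
Qed.

Lemma partial_sum (I : Type) (r : seq I) (F : I -> V -> R) i x :
  (forall k, smooth (F k)) ->
  partial i (fun x => \sum_(k <- r) F k x) x = \sum_(k <- r) partial i (F k) x.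
Proof.
move=> sF; elim: r => [|k r IH].
  by rewrite big_nil; under eq_fun do rewrite big_nil; rewrite partial_cst.
rewrite big_cons -IH -partialD//; last exact: smooth_sum.
by congr partial; apply/funext => y; rewrite big_cons.
Qed.

(* Products and composites are not closed under partial derivatives, but sums of
   such products are: this is the invariant given to [smooth_class]. *)
Inductive sum_of_products : (V -> R) -> Prop :=
| sop_mul f g : smooth f -> smooth g -> sum_of_products (fun x => f x * g x)
| sop_add f g : sum_of_products f -> sum_of_products g ->
    sum_of_products (fun x => f x + g x).

Lemma smoothM f g : smooth f -> smooth g -> smooth (fun x => f x * g x).
Proof.
move=> sf sg; apply: (@smooth_class sum_of_products); last exact: sop_mul.
move=> F; elim=> [{}f {}g {}sf {}sg|f' g' _ [cf df] _ [cg dg]].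
  split; first by apply: continuous_mul; exact: smooth_cont.
  move=> i; split=> [x|]; first by apply: derivableM; exact: smooth_der.
  rewrite (_ : partial _ _ = fun x => f x * partial i g x + g x * partial i f x).
    by apply: sop_add; apply: sop_mul => //; exact: smooth_partial.
  by apply/funext => x; rewrite partialM.
split; first exact: continuous_add.
move=> i; have [df1 df2] := df i; have [dg1 dg2] := dg i.
split=> [x|]; first exact: derivableD.
rewrite (_ : partial _ _ = fun x => partial i f' x + partial i g' x).
  exact: sop_add.
by apply/funext => x; apply: partialE; apply: is_deriveD; exact/derivableP.
Qed.

Lemma smoothZ (c : R) f : smooth f -> smooth (fun x => c * f x).
Proof. by move=> sf; apply: smoothM => //; exact: smooth_cst. Qed.

Lemma partialZ (c : R) f i x : smooth f ->
  partial i (fun x => c * f x) x = c * partial i f x.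
Proof.
by move=> sf; rewrite partialM ?partial_cst ?mulr0 ?addr0//; exact: smooth_cst.
Qed.

Lemma smoothB f g : smooth f -> smooth g -> smooth (fun x => f x - g x).
Proof.
move=> sf sg; have := smoothD sf (smoothZ (-1) sg).
by under eq_fun do rewrite mulN1r.
Qed.

Lemma partialB f g i x : smooth f -> smooth g ->
  partial i (fun x => f x - g x) x = partial i f x - partial i g x.
Proof.
move=> sf sg; rewrite -[partial i g x]mul1r -mulNr -partialZ//.
rewrite -partialD//; last exact: smoothZ.
by congr partial; apply/funext => y; rewrite mulN1r.
Qed.

Definition smooth1 (h : R -> R) := forall k x, derivable (derive1n k h) x 1.

Lemma smooth1_is_derive (h : R -> R) (k : nat) (x : R) : smooth1 h -> is_derive x 1 (derive1n k h) ((derive1n k.+1 h) x).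
Proof.
by move=> sh; have := derivableP (sh k x); rewrite derive1nS derive1E.
Qed.

Lemma partial_comp (h : R -> R) f i x : smooth1 h -> smooth f ->
  partial i (h \o f) x = (derive1 h) (f x) * partial i f x.
Proof.
move=> sh sf; apply: partialE; apply: is_derive_comp.
  exact: smooth_is_derive.
exact: (smooth1_is_derive 0).
Qed.

Inductive sum_of_composites (h : R -> R) (f : V -> R) : (V -> R) -> Prop :=
| soc_mul k g : smooth g -> sum_of_composites h f (fun x => (derive1n k h) (f x) * g x)
| soc_add g1 g2 : sum_of_composites h f g1 -> sum_of_composites h f g2 ->
    sum_of_composites h f (fun x => g1 x + g2 x).

Lemma smooth_comp (h : R -> R) f : smooth1 h -> smooth f -> smooth (h \o f).
Proof.
move=> sh sf; apply: (@smooth_class (sum_of_composites h f)); last first.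
  rewrite (_ : _ \o _ = fun x => (derive1n 0 h) (f x) * 1).
    by apply: soc_mul; exact: smooth_cst.
  by apply/funext => x; rewrite mulr1.
move=> F; elim=> [k g sg|f' g' _ [cf df] _ [cg dg]].
  have D i x : is_derive x (dlt i) (fun x => (derive1n k h) (f x) * g x)
    ((derive1n k h) (f x) * partial i g x + g x * ((derive1n k.+1 h) (f x) * partial i f x)).
    have D1 := is_derive_comp (smooth_is_derive i x sf) (smooth1_is_derive k (f x) sh).
    exact: (is_deriveM D1 (smooth_is_derive i x sg)).
  split.
    apply: (@continuous_mul ((derive1n k h) \o f)); last exact: smooth_cont.
    move=> x; apply: continuous_comp; first exact: (smooth_cont sf).
    by apply: differentiable_continuous; exact/derivable1_diffP.
  move=> i; split=> [x|]; first by have [] := D i x.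
  rewrite (_ : partial _ _ = fun x => (derive1n k h) (f x) * partial i g x +
      (derive1n k.+1 h) (f x) * (g x * partial i f x)).
    apply: soc_add; apply: soc_mul; first exact: smooth_partial.
    by apply: smoothM => //; exact: smooth_partial.
  by apply/funext => x; rewrite (partialE (D i x)) [in RHS]mulrCA.
split; first exact: continuous_add.
move=> i; have [df1 df2] := df i; have [dg1 dg2] := dg i.
split=> [x|]; first exact: derivableD.
rewrite (_ : partial _ _ = fun x => partial i f' x + partial i g' x).
  exact: soc_add.
by apply/funext => x; apply: partialE; apply: is_deriveD; exact/derivableP.
Qed.

End smooth.

(** * Plateau functions *)

Section plateau.
Context {R : realType}.
Implicit Types (p : {poly R}) (x : R).

(** Comparison with the term of degree [k.+1] of the exponential series; its extra factor [t] is
    dropped because [1 <= t]. *)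
Lemma expn_expRN_bounded k : exists2 C : R, 0 <= C &
  forall t, 1 <= t -> t ^+ k * expR (- t) <= C.
Proof.
exists (k.+1`!)%:R => [|t t1]; first exact: ler0n.
rewrite expRN ler_pdivrMr ?expR_gt0//.
have t0 : 0 <= t by rewrite (le_trans _ t1).
have := expR_ge1Dxn k t0.
have -> : t ^+ k.+1 / (k.+1)`!%:R = t ^+ k.+1 * (k.+1)`!%:R^-1 by [].
move=> H; have f0 : 0 < (k.+1)`!%:R :> R by rewrite ltr0n fact_gt0.
have : t ^+ k.+1 <= (k.+1)`!%:R * expR t.
  rewrite -ler_pdivrMl// mulrC; apply: le_trans H.
  by rewrite lerDr.
by apply: le_trans; rewrite exprS ler_peMl// exprn_ge0.
Qed.

(** The power [t ^+ k] is carried along so that, in the step from [p] to [p * 'X + c], the new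
    factor [t] is absorbed by the hypothesis at [k.+1]. *)
Lemma horner_expRN_bounded p k : exists2 C : R, 0 <= C &
  forall t, 1 <= t -> `|p.[t]| * t ^+ k * expR (- t) <= C.
Proof.
elim/poly_ind: p k => [|p c IH] k.
  by exists 0 => // t _; rewrite horner0 normr0 !mul0r.
have [C1 C10 H1] := IH k.+1; have [C2 C20 H2] := expn_expRN_bounded k.
exists (C1 + `|c| * C2) => [|t t1]; first by rewrite addr_ge0// mulr_ge0.
have t0 : 0 <= t by rewrite (le_trans _ t1).
have e0 := expR_ge0 (- t).
rewrite !hornerE.
apply: (@le_trans _ _ ((`|p.[t]| * t + `|c|) * t ^+ k * expR (- t))).
  rewrite ler_wpM2r// ler_wpM2r ?exprn_ge0//.
  by rewrite (le_trans (ler_normD _ _))// normrM (ger0_norm t0).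
rewrite !mulrDl lerD//; last by rewrite -mulrA ler_wpM2l// H2.
by apply: le_trans (H1 t t1); rewrite exprS !mulrA.
Qed.

(* The derivatives of [exp (-1/x)] are of the form [p (1/x) exp (-1/x)]. *)
Definition flat p x : R := if 0 < x then p.[x^-1] * expR (- x^-1) else 0.

Lemma flat_le0 p x : x <= 0 -> flat p x = 0.
Proof. by rewrite /flat leNgt => /negbTE ->. Qed.

(** Quadratic decay makes the difference quotient at 0 tend to 0, at the only point where the two
    branches of [flat] meet. *)
Lemma flat_quadratic p : exists2 C : R, 0 <= C &
  forall x, x <= 1 -> `|flat p x| <= C * x ^+ 2.
Proof.
have [C C0 H] := horner_expRN_bounded p 2; exists C => // x x1.
rewrite /flat; case: ifPn => x0; last first.
  by rewrite normr0 mulr_ge0// sqr_ge0.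
have xV : 1 <= x^-1 by rewrite invf_ge1.
have := H _ xV; rewrite normrM (ger0_norm (expR_ge0 _)).
by rewrite mulrAC exprVn ler_pdivrMr ?exprn_gt0.
Qed.

(** With [y = 1/x] one has [dy/dx = - y^2], so differentiation acts on the polynomial factor as
    [p |-> y^2 (p - p')] and the family [flat] is closed under it. *)
Lemma flat_is_derive p x : is_derive x 1 (flat p) (flat ('X^2 * (p - p^`())) x).
Proof.
have [x0|x0|->] := ltgtP x 0.
- rewrite flat_le0 1?ltW//; apply: (@near_eq_is_derive _ _ _ (cst 0)).
  near=> y; rewrite flat_le0//; apply: ltW; near: y; exact: lt_nbhsl.
- have xN0 : x != 0 by rewrite gt_eqF.
  have D1 : is_derive x 1 (fun y : R => y^-1) (- x ^- 2).
    have := is_deriveV xN0 (is_derive_id x 1).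
    by rewrite [_ *: _]mulr1.
  have D2 := is_derive1_comp (is_derive_poly p x^-1) D1.
  have D1N : is_derive x 1 (fun y : R => - y^-1) (- - x ^- 2).
    exact: is_deriveN.
  have D3 := @is_derive1_comp R expR (fun y : R => - y^-1) x _ _
    (is_derive_expR (- x^-1)) D1N.
  have D4 : is_derive x 1 (fun y => p.[y^-1] * expR (- y^-1))
      (flat ('X^2 * (p - p^`())) x).
    apply: is_derive_eq (is_deriveM D2 D3) _.
    rewrite /flat x0 !hornerE -![_ *: _]/(_ * _).
        by rewrite /= -!exprVn; set y := x^-1; ring.
  apply: (near_eq_is_derive _ D4); near=> y.
  by rewrite /flat ifT//; near: y; exact: lt_nbhsr.
- rewrite flat_le0//.
  have [C C0 H] := flat_quadratic p.
  suff L : h^-1 *: ((flat p \o shift 0) (h *: (1 : R)) - flat p 0) @[h --> 0^'] --> (0 : R).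
    by apply: DeriveDef; [apply/cvg_ex; exists 0|exact/cvg_lim].
  apply/cvgrPdist_le => e e0; near=> h.
  rewrite /= addr0 (flat_le0 p (lexx 0)) sub0r subr0 normrN [h *: 1]mulr1.
  have hN0 : h != 0 by near: h; exact: nbhs_dnbhs_neq.
  have h1 : `|h| <= 1.
    near: h; apply: dnbhs0_le; exact: ltr01.
  have h2 : `|h| <= e / (C + 1).
    by near: h; apply: dnbhs0_le; rewrite divr_gt0// ltr_pwDr.
  rewrite [_ *: _]/(_ * _) normrM normfV ler_pdivrMl ?normr_gt0//.
  apply: (le_trans (H _ _)); first by rewrite (le_trans (ler_norm _)).
  rewrite -real_normK ?num_real// expr2 mulrCA ler_wpM2l//.
  rewrite (le_trans (ler_wpM2l C0 h2))// mulrCA ler_piMr 1?ltW//.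
  by rewrite ltr_pdivrMr ?mul1r ?ltrDl// ltr_pwDr.
Unshelve. all: by end_near. Qed.

Lemma flat_smooth p : smooth1 (flat p).
Proof.
move=> k; suff [q ->] : exists q, derive1n k (flat p) = flat q.
  by move=> x; have [] := flat_is_derive q x.
elim: k => [|k [q IH]]; first by exists p.
exists ('X^2 * (q - q^`())); apply/funext => x.
by rewrite derive1nS IH derive1E; have [_ ->] := flat_is_derive q x.
Qed.

Lemma flat1E x : 0 < x -> flat 1 x = expR (- x^-1).
Proof. by rewrite /flat => ->; rewrite hornerC mul1r. Qed.

Lemma flat1_ge0 x : 0 <= flat 1 x.
Proof.
by rewrite /flat; case: ifP => // _; rewrite hornerC mul1r expR_ge0.
Qed.

Lemma flat1_gt0 x : 0 < x -> 0 < flat 1 x.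
Proof. by move=> /flat1E ->; exact: expR_gt0. Qed.

Lemma flat1_le x y : x <= y -> flat 1 x <= flat 1 y.
Proof.
have [x0|x0] := leP x 0; first by rewrite (flat_le0 1 x0) => _; exact: flat1_ge0.
move=> xy; have y0 := lt_le_trans x0 xy.
by rewrite !flat1E// ler_expR lerN2 lef_pV2.
Qed.

Lemma smooth_step_exists : exists g : R -> R, smooth1 g /\
  [/\ forall x, x <= 0 -> g x = 0, forall x, 0 < x -> 0 < g x,
      forall x y, x <= y -> g x <= g y, forall x, x <= 0 -> derive1 g x = 0 &
      forall x, `|derive1 g x| <= 2].
Proof.
have D x : derive1 (flat 1) x = flat 'X^2 x.
  rewrite derive1E; have [_ ->] := flat_is_derive 1 x.
  by rewrite -polyC1 derivC subr0 mulr1.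
exists (flat 1); split; first exact: flat_smooth.
split => //; [exact: flat_le0|exact: flat1_gt0|exact: flat1_le| |].
  by move=> x x0; rewrite D flat_le0.
move=> x; rewrite D /flat; case: ifPn => [x0|_]; last by rewrite normr0.
rewrite !hornerE; set t := x^-1; have t0 : 0 <= t by rewrite invr_ge0 ltW.
rewrite ger0_norm ?mulr_ge0 ?exprn_ge0 ?expR_ge0//.
rewrite expRN ler_pdivrMr ?expR_gt0//.
(* The bound 2 on the derivative [t^2 exp(-t)] comes from [1 + t^2/2 <= exp t]. *)
have := expR_ge1Dxn 1 t0.
have -> : (2`!)%:R = 2 :> R by [].
by lra.
Qed.

(* With [g] flat at 0, the function [g (g 1 - g r)] equals [g (g 1)] for [r <= 0]
   and 0 for [1 <= r]. *)
Lemma plateau_exists : exists b db : R -> R, exists B : R,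
  [/\ forall r, 0 <= b r <= 1, forall r, r <= 0 -> b r = 0,
      forall r, 1 <= r -> b r = 1, forall r, `|db r| <= B &
      forall r, db r != 0 -> 0 < r < 1] /\
  forall n (f : 'rV[R]_n -> R), smooth f -> smooth (b \o f) /\
    forall (i : 'I_n) (x : 'rV[R]_n), partial i (b \o f) x = db (f x) * partial i f x.
Proof.
have [g [sg [g0 gp gle dg0 dgb]]] := smooth_step_exists.
pose a := g 1; have a0 : 0 < a by exact: gp.
have ga0 : 0 < g a by exact: gp.
have ge0 x : 0 <= g x.
  by have [x0|x0] := leP x 0; [rewrite g0|exact/ltW/gp].
exists (fun r => 1 - (g a)^-1 * g (a - g r)).
exists (fun r => (g a)^-1 * (derive1 g (a - g r) * derive1 g r)).
(* Each 2 bounds one of the two factors [g'] produced by the chain rule. *)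
exists ((g a)^-1 * (2 * 2)); split; [split|].
- move=> r; apply/andP; split.
    rewrite subr_ge0 ler_pdivrMl// mulr1; apply: gle.
    by rewrite gerDl oppr_le0.
  by rewrite gerDl oppr_le0 mulr_ge0// invr_ge0 ltW.
- by move=> r r0; rewrite (g0 r r0) subr0 mulVf ?gt_eqF// subrr.
- move=> r r1; rewrite (g0 (a - g r)) ?mulr0 ?subr0// subr_le0.
  exact: gle.
- have gi : 0 <= (g a)^-1 by rewrite invr_ge0 ltW.
  move=> r; rewrite normrM ger0_norm// ler_wpM2l//.
  by rewrite normrM ler_pM.
- move=> r; apply: contraR; rewrite negb_and -!leNgt => /orP[r0|r1].
    by rewrite (dg0 r r0) !mulr0.
  by rewrite (dg0 (a - g r)) ?mul0r ?mulr0// subr_le0 gle.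
move=> n f sf.
have s1 : smooth (g \o f) by exact: smooth_comp.
have s2 : smooth (fun x : 'rV[R]_n => a - (g \o f) x).
  by apply: smoothB => //; exact: smooth_cst.
have s3 : smooth (g \o (fun x : 'rV[R]_n => a - (g \o f) x)) by exact: smooth_comp.
have s4 := smoothZ (g a)^-1 s3.
split; first exact: (smoothB (smooth_cst 1) s4).
move=> i x; have := partialB i x (smooth_cst 1) s4.
rewrite partial_cst (partialZ (g a)^-1 i x s3) (partial_comp i x sg s2).
rewrite (partialB i x (smooth_cst a) s1) partial_cst (partial_comp i x sg sf).
by move=> E; rewrite [LHS]E /=; ring.
Qed.

End plateau.

(** * Topology of row vectors in the sup norm *)

Section rV_topology.
Context {R : realType} {n : nat}.
Local Notation V := 'rV[R]_n.

Lemma near_normP (x : V) (P : V -> Prop) : (\forall y \near x, P y) <->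
  exists2 e : R, 0 < e & forall y, `|x - y| < e -> P y.
Proof.
split; first by move=> /nbhs_normP[e /= e0 H]; exists e.
by move=> [e e0 H]; apply/nbhs_normP; exists e.
Qed.

Lemma coord_norm_le (x : V) i : `|x 0 i| <= `|x|.
Proof.
rewrite [leRHS]/Num.Def.normr /= mx_normrE; apply/bigmax_geP; right => /=.
by exists (0, i).
Qed.

Lemma norm_le_coord (x : V) (e : R) : 0 <= e ->
  (forall i, `|x 0 i| <= e) -> `|x| <= e.
Proof.
move=> e0 H; rewrite [leLHS]/Num.Def.normr /= mx_normrE bigmax_le// => -[i j] _ /=.
by rewrite (ord1 i).
Qed.

Lemma bounded_setP (A : set V) : bounded_set A ->
  exists k : nat, forall x, A x -> `|x| <= k%:R.
Proof.
move=> [M [_ H]]; exists (Num.truncn M).+1 => x Ax.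
by apply: H => //; exact: truncnS_gt.
Qed.

Lemma norm_bounded_set (A : set V) (M : R) : (forall x, A x -> `|x| <= M) ->
  bounded_set A.
Proof.
move=> H; exists M; split; first exact: num_real.
by move=> N MN x Ax; rewrite /= (le_trans (H x Ax))// ltW.
Qed.

Lemma closure_norm_le (A : set V) (M : R) : (forall x, A x -> `|x| <= M) ->
  forall x, closure A x -> `|x| <= M.
Proof.
move=> H x cx; rewrite leNgt; apply/negP => xM.
have [|y [Ay]] := cx [set y | `|x - y| < `|x| - M].
  by apply/near_normP; exists (`|x| - M) => //; rewrite subr_gt0.
rewrite /= => xy; have := H _ Ay; have := lerB_dist x y.
by lra.
Qed.

Lemma boundary_closure (A : set V) x : open A -> boundary A x <-> closure A x /\ ~ A x.
Proof. by rewrite /boundary => /interior_id ->. Qed.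

Lemma near_notin (A : set V) x : ~ closure A x -> \forall y \near x, ~ A y.
Proof.
move=> /existsNP[B /not_implyP[Bx AB]].
by apply: filterS Bx => y By Ay; apply: AB; exists y.
Qed.

(** Compactness is used as a near-covering property, which makes the index [k] of the radius
    [1/(k+1)] uniform: at a point with radius [e], one half of [e] serves for the points nearby and
    the other half for the radius. *)
Lemma compact_sub_open (K U : set V) : compact K -> open U -> K `<=` U ->
  exists2 e : R, 0 < e & forall x y, K x -> `|x - y| < e -> U y.
Proof.
move=> cK oU KU.
pose P (k : nat) := [set x : V | forall y, `|x - y| < k.+1%:R^-1 -> U y].
have /compact_near_coveringP cov := cK.
have H : \forall k \near \oo, K `<=` P k.
  apply: cov => x Kx.
  have [e e0 H] : exists2 e : R, 0 < e & forall y, `|x - y| < e -> U y.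
    by apply/near_normP; apply: open_nbhs_nbhs; split => //; exact: KU.
  have e2 : 0 < e / 2 by rewrite divr_gt0.
  exists ([set z | `|x - z| < e / 2], [set k | k.+1%:R^-1 < e / 2]).
    split => /=; first by apply/near_normP; exists (e / 2).
    exact: (near_infty_natSinv_lt (PosNum e2)).
  move=> [z k] /= [zx ke] y zy; apply: H.
  have -> : x - y = (x - z) + (z - y) by rewrite addrA subrK.
  by rewrite [ltRHS](splitr e) (le_lt_trans (ler_normD _ _))// ltrD// (lt_trans zy).
have [k _ /(_ k (leqnn k)) Hk] := H.
by exists k.+1%:R^-1 => // x y Kx; exact: Hk.
Qed.

End rV_topology.

(** * Test functions and cutoffs *)

Section test_functions.
Context {R : realType} {n : nat}.
Local Notation V := 'rV[R]_n.
Local Notation dlt i := (delta_mx 0 i : V).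
Implicit Types (f g phi psi : V -> R) (i : 'I_n) (D K : set V).

Lemma smooth_local f :
  (forall x : V, exists2 g, smooth g & \forall y \near x, f y = g y) -> smooth f.
Proof.
move=> H0; apply: (@smooth_class _ _ (fun f => forall x : V,
  exists2 g, smooth g & \forall y \near x, f y = g y)) => // {H0}f H; split.
  move=> x; have [g sg fg] := H x.
  have cg : continuous_at x g by exact: smooth_cont.
  have fgx : f x = g x := nbhs_singleton fg.
  rewrite /continuous_at fgx; apply: cvg_trans cg.
  have fg' : \forall y \near x, g y = f y by move: fg; apply: filterS => y ->.
  exact: near_eq_cvg fg'.
move=> i; split=> /= x; have [g sg fg] := H x.
  apply: (@near_eq_derivable _ _ _ g); last exact: smooth_der.
  by move: fg; apply: filterS => y ->.
exists (partial i g); first exact: smooth_partial.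
have := near_join fg.
apply: filterS => y fgy; exact: near_eq_derive.
Qed.

Lemma partial_near i f g (x : V) : (\forall y \near x, f y = g y) ->
  partial i f x = partial i g x.
Proof. by move=> fg; exact: near_eq_derive. Qed.

(** With [testP], replaces the closure of the nonvanishing set by any compact set off which the
    function vanishes; closure properties then only have to exhibit such a set. *)
Lemma test_intro D K phi : smooth phi -> compact K -> K `<=` D ->
  (forall x, ~ K x -> phi x = 0) -> test_function D phi.
Proof.
move=> [sphi] cK KD H; split => //=.
have clK : closed K by apply: compact_closed => //; exact: norm_hausdorff.
have suppK : closure [set x | phi x != 0] `<=` K.
  rewrite [X in _ `<=` X](closure_id K).1//.
  by apply: closureS => x /= /eqP px; apply: contrapT => /H.
split; last exact: subset_trans KD.
by apply: subclosed_compact suppK => //; exact: closed_closure.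
Qed.

Lemma test_smooth D phi : test_function D phi -> smooth phi.
Proof. by case=> ? _. Qed.

Lemma testP D phi : test_function D phi -> exists2 K, compact K /\ K `<=` D &
  forall x, ~ K x -> phi x = 0.
Proof.
move=> [_ /=[cK KD]]; exists (closure [set x | phi x != 0]) => // x.
by move=> H; apply/eqP; apply: contrapT => /negP px; apply: H; exact: subset_closure.
Qed.

Lemma test_sub D D' phi : D `<=` D' -> test_function D phi ->
  test_function D' phi.
Proof. by move=> DD' [? /= [? H]]; split => //=; split => //; exact: subset_trans DD'. Qed.

Lemma test_subT D phi : test_function D phi -> test_function setT phi.
Proof. exact: test_sub. Qed.

Lemma test0 D phi x : test_function D phi -> ~ D x -> phi x = 0.
Proof. by move=> /testP[K [_ KD] H] Dx; apply: H => /KD. Qed.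

Lemma testMr D phi psi : test_function D phi -> smooth psi ->
  test_function D (fun x => phi x * psi x).
Proof.
move=> tp sp; have [K [cK KD] H] := testP tp.
apply: (@test_intro D K) => //; first by apply: smoothM => //; exact: test_smooth tp.
by move=> x /H ->; rewrite mul0r.
Qed.

Lemma testZ D (c : R) phi : test_function D phi ->
  test_function D (fun x => c * phi x).
Proof.
move=> tp; have := testMr tp (smooth_cst c).
by under eq_fun do rewrite mulrC.
Qed.

Lemma testD D phi psi : test_function D phi -> test_function D psi ->
  test_function D (fun x => phi x + psi x).
Proof.
move=> tp tq; have [K [cK KD] H] := testP tp; have [L [cL LD] H'] := testP tq.
apply: (@test_intro D (K `|` L)) => //.
- by apply: smoothD; [exact: test_smooth tp|exact: test_smooth tq].
- exact: compactU.
- by move=> x [/KD|/LD].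
- by move=> x /not_orP[/H -> /H' ->]; rewrite addr0.
Qed.

Lemma test_cst0 D : test_function D (fun=> 0).
Proof.
apply: (@test_intro D set0) => //; [exact: smooth_cst|exact: compact0].
Qed.

Lemma test_partial D i phi : test_function D phi -> test_function D (partial i phi).
Proof.
move=> tp; have [K [cK KD] H] := testP tp.
apply: (@test_intro D K) => //; first exact/smooth_partial/test_smooth/tp.
move=> x Kx; rewrite (@partial_near i _ (cst 0)); first by rewrite partial_cst.
have oK : open (~` K).
  by apply: closed_openC; apply: compact_closed => //; exact: norm_hausdorff.
by apply: filterS (open_nbhs_nbhs (conj oK Kx)) => y /H.
Qed.

Lemma test_bounded D phi : test_function D phi ->
  exists2 M : R, 0 <= M & forall x, `|phi x| <= M.
Proof.
move=> tp; have [K [cK KD] H] := testP tp.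
have : compact (phi @` K).
  apply: continuous_compact => //; apply: continuous_subspaceT.
  exact/smooth_cont/test_smooth/tp.
move=> /compact_bounded [M [_ HM]].
exists (`|M| + 1); first by rewrite addr_ge0.
move=> x; have [Kx|/H ->] := pselect (K x); last by rewrite normr0 addr_ge0.
by apply: HM; [rewrite ltr_pwDr// ler_norm|exists x].
Qed.

(** Since only partial derivatives are bounded, the path from [x] to [y] changes one coordinate at a
    time ([z k]), with the mean value theorem on each piece; this costs the factor [n]. *)
Lemma smooth_lipschitz f (M : R) : smooth f -> 0 <= M ->
  (forall i x, `|partial i f x| <= M) ->
  forall x y, `|f x - f y| <= n%:R * M * `|x - y|.
Proof.
move=> sf M0 H x y.
pose z (k : nat) : V := \row_j (if (j < k)%N then y 0 j else x 0 j).
have step (k : 'I_n) : `|f (z k) - f (z k.+1)| <= M * `|x - y|.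
  pose g t := f (t *: dlt k + x - x + z k).
  have dg (t : R) : is_derive t 1 g (partial k f (t *: dlt k + x - x + z k)).
    have -> : g = fun t => f (t *: dlt k + (z k)).
      by apply/funext => s; rewrite /g addrK.
    rewrite addrK.
    by apply: is_derive_line_at; exact: smooth_is_derive.
  have g0 : g 0 = f (z k) by rewrite /g scale0r add0r subrr add0r.
  have g1 : g (y 0 k - x 0 k) = f (z k.+1).
    rewrite /g addrK; congr f; apply/rowP => j; rewrite !mxE eqxx/=.
    have [->|jk] := eqVneq j k; first by rewrite ltnn ltnSn mulr1 subrK.
    by rewrite mulr0 add0r ltnS [in RHS]leq_eqVlt val_eqE (negbTE jk).
  have cg t : {for t, continuous g}.
    by apply: differentiable_continuous; apply/derivable1_diffP; case: (dg t).
  have L a b : a <= b -> `|g b - g a| <= M * (b - a).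
    move=> ab; have [|c _ ->] := @MVT_segment _ g _ a b ab (fun t _ => dg t).
      by apply: continuous_subspaceT; exact: cg.
    by rewrite normrM (ger0_norm (_ : 0 <= b - a)) ?subr_ge0// ler_wpM2r ?subr_ge0.
  have L' a b : `|g b - g a| <= M * `|b - a|.
    have [ab|/ltW ab] := leP a b; first by rewrite (ger0_norm (_ : 0 <= b - a)) ?subr_ge0 ?L.
    by rewrite distrC [in leRHS]distrC (ger0_norm (_ : 0 <= a - b)) ?subr_ge0 ?L.
  rewrite -g0 -g1 (le_trans (L' _ _))// ler_wpM2l// sub0r opprB.
  by rewrite (le_trans _ (coord_norm_le _ k))// !mxE.
have E k : (k <= n)%N -> `|f (z 0) - f (z k)| <= k%:R * M * `|x - y|.
  elim: k => [|k IH] kn; first by rewrite subrr normr0 !mul0r.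
  rewrite -[f (z 0) - _](subrKA (f (z k))).
  rewrite (le_trans (ler_normD _ _))// -natr1 !mulrDl lerD ?IH 1?ltnW// mul1r.
  exact: (step (Ordinal kn)).
have := E n (leqnn n).
have -> : z 0 = x by apply/rowP => j; rewrite mxE.
by have -> : z n = y by apply/rowP => j; rewrite mxE ltn_ord.
Qed.

Lemma test_lipschitz D phi : test_function D phi ->
  exists2 L : R, 0 <= L & forall x y, `|phi x - phi y| <= L * `|x - y|.
Proof.
move=> tp.
have /choice[M HM] : forall i, exists M : R, 0 <= M /\ forall x, `|partial i phi x| <= M.
  by move=> i; have [M M0 H] := test_bounded (test_partial i tp); exists M.
pose L := \sum_i M i; have L0 : 0 <= L by apply: sumr_ge0 => i _; exact: (HM i).1.
exists (n%:R * L); first by rewrite mulr_ge0.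
apply: smooth_lipschitz => //; first exact: test_smooth tp.
move=> i x; rewrite (le_trans ((HM i).2 x))// /L (bigD1 i)//= lerDl.
by apply: sumr_ge0 => j _; exact: (HM j).1.
Qed.

Lemma is_derive_affine f (a x : V) (c : R) i : smooth f ->
  is_derive x (dlt i) (fun y => f (a + c *: y)) (c * partial i f (a + c *: x)).
Proof.
move=> sf; apply/is_derive_line.
have D1 : is_derive ((fun t : R => c * t) 0) 1 (fun t => f (t *: dlt i + (a + c *: x)))
    (partial i f (a + c *: x)).
  rewrite mulr0; apply: is_derive_line_at; rewrite scale0r add0r.
  exact: smooth_is_derive.
have D2 : is_derive (0 : R) 1 (fun t : R => c * t) c.
  by apply: is_derive_eq (is_deriveZ c (is_derive_id (0 : R) 1)) _; rewrite [_ *: _]mulr1.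
have := is_derive1_comp D1 D2; rewrite mulrC.
apply: (@near_eq_is_derive _ _ _ _ _ (0:R) 1); near=> t => /=.
by congr f; rewrite scalerDr scalerA addrCA.
Unshelve. all: by end_near. Qed.

Lemma smooth_affine f (a : V) (c : R) : smooth f -> smooth (fun y => f (a + c *: y)).
Proof.
move=> sf.
apply: (@smooth_class _ _ (fun g => exists2 h : V -> R, smooth h & g = fun y => h (a + c *: y)));
  last by exists f.
move=> _ [{sf}f sf ->]; split.
  move=> x; apply: (@continuous_comp _ _ _ (fun y : V => a + c *: y) f); last exact: (smooth_cont sf).
  by apply: continuousD; [exact: cst_continuous|apply: continuousZr; exact: cvg_id].
move=> i; split=> [x|]; first by have [] := is_derive_affine a x c i sf.
exists (fun y => c * partial i f y); first exact/smoothZ/smooth_partial.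
by apply/funext => x; apply: partialE; exact: is_derive_affine.
Qed.

Lemma test_affine phi (a : V) (c : R) : c != 0 -> test_function setT phi ->
  test_function setT (fun y => phi (a + c *: y)).
Proof.
move=> c0 tp; have [K [cK _] H] := testP tp.
have [k kK] := bounded_setP (compact_bounded cK).
pose L := [set y : V | `|a + c *: y| <= k%:R].
have bL y : L y -> `|y| <= `|c|^-1 * (k%:R + `|a|).
  move=> Ly; rewrite ler_pdivlMl ?normr_gt0// -normrZ.
  have -> : c *: y = (a + c *: y) - a by rewrite addrAC subrr add0r.
  by rewrite (le_trans (ler_normB _ _))// lerD.
apply: (@test_intro setT (closure L)) => //; first exact/smooth_affine/test_smooth/tp.
  apply: bounded_closed_compact; last exact: closed_closure.
  exact: norm_bounded_set (closure_norm_le bL).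
by move=> x Lx; apply: H => /kK Lx'; apply: Lx; exact: subset_closure.
Qed.

End test_functions.

(** * Cutoffs for a bounded open set *)

Section cutoff.
Context {R : realType} {n : nat}.
Hypothesis n_gt0 : (0 < n)%N.
Local Notation V := 'rV[R]_n.

(** Bounds the number of factors of the cutoff that vary at a given point. Coordinate by coordinate,
    the admissible integers lie in a window of [2 L + 1] values starting at [k0 j], so [z] is
    determined by its offset in the window. The bound is independent of [N], hence of the mesh. *)
Lemma card_near_ffun (N L : nat) (al : 'I_n -> R) :
  (#|[pred z : {ffun 'I_n -> 'I_N} | [forall j, (`|al j - (z j)%:R| <= L%:R)%R]]|
   <= (L.*2.+1) ^ n)%N.
Proof.
pose k0 j := Num.truncn (al j - L%:R).
have Hz (z : {ffun 'I_n -> 'I_N}) j : `|al j - (z j)%:R| <= L%:R ->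
    (k0 j <= z j <= k0 j + L.*2)%N.
  rewrite ler_norml => /andP[z1 z2]; apply/andP; split.
    have [a0|a0] := leP 0 (al j - L%:R).
      rewrite -(ler_nat R); have /andP[+ _] := truncn_itv a0.
      by move=> /le_trans; apply; lra.
    by rewrite /k0 (truncn0Pn _ _) // -ltNge (lt_trans a0).
  rewrite -ltnS -(ltr_nat R) -addSn natrD -muln2 natrM.
  have := truncnS_gt (al j - L%:R); rewrite -/(k0 j); lra.
pose f (z : {ffun 'I_n -> 'I_N}) : {ffun 'I_n -> 'I_(L.*2.+1)} :=
  [ffun j => inord (z j - k0 j)].
rewrite -[X in (_ <= X ^ _)%N]card_ord -[n in (_ <= _ ^ n)%N]card_ord -card_ffun.
apply: (@leq_card_in _ _ f) => z1 z2 /forallP h1 /forallP h2 /ffunP H.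
apply/ffunP => j; apply/val_inj; have := congr1 val (H j).
have /andP[a1 b1] := Hz z1 j (h1 j); have /andP[a2 b2] := Hz z2 j (h2 j).
rewrite !ffunE /= !inordK ?ltnS ?leq_subLR// => E.
by rewrite -(subnK a1) E subnK.
Qed.

Lemma smooth_prod (I : Type) (r : seq I) (P : pred I) (F : I -> V -> R) :
  (forall k, smooth (F k)) -> smooth (fun x => \prod_(k <- r | P k) F k x).
Proof.
move=> sF; elim: r => [|k r IH].
  by under eq_fun do rewrite big_nil; exact: smooth_cst.
under eq_fun do rewrite big_cons; case: (P k) => //.
exact: smoothM.
Qed.

(** Leibniz rule, in which every undifferentiated factor is at most 1. *)
Lemma partial_prod_le (I : Type) (r : seq I) (P : pred I) (F : I -> V -> R) i x :
  (forall k, smooth (F k)) -> (forall k y, 0 <= F k y <= 1) ->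
  `|partial i (fun x => \prod_(k <- r | P k) F k x) x| <=
  \sum_(k <- r | P k) `|partial i (F k) x|.
Proof.
move=> sF F01.
have prod01 r' : `|\prod_(k <- r' | P k) F k x| <= 1.
  by rewrite normr_prod prodr_ile1// => k _; have /andP[? ?] := F01 k x; rewrite normr_ge0/= ger0_norm.
elim: r => [|k r IH].
  by under [X in partial i X]eq_fun do rewrite big_nil; rewrite partial_cst normr0 big_nil.
rewrite big_cons; case: ifPn => Pk; last first.
  by under [X in partial i X]eq_fun do rewrite big_cons (negbTE Pk).
under [X in partial i X]eq_fun do rewrite big_cons Pk.
rewrite partialM//; last exact: smooth_prod.
rewrite (le_trans (ler_normD _ _))// addrC lerD//.
  by rewrite normrM ler_piMl.
rewrite normrM (le_trans _ IH)// ler_piMl//.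
by have /andP[? ?] := F01 k x; rewrite ger0_norm.
Qed.

(* The cutoff is a product, over the points z of a grid of mesh 1/(m+1) that are
   close to the boundary, of functions vanishing near z and equal to 1 away from z.
   A bounded number of factors is nonconstant near a given point. *)
Section construction.
Variables (O : set V) (b db : R -> R) (B : R) (M m : nat).
Hypothesis O_open : open O.
Hypothesis O_bounded : forall x, O x -> `|x| <= M%:R.
Hypothesis b01 : forall r, 0 <= b r <= 1.
Hypothesis b0 : forall r, r <= 0 -> b r = 0.
Hypothesis b1 : forall r, 1 <= r -> b r = 1.
Hypothesis db_le : forall r, `|db r| <= B.
Hypothesis db_neq0 : forall r, db r != 0 -> 0 < r < 1.
Hypothesis b_smooth : forall (f : V -> R), smooth f -> smooth (b \o f).
Hypothesis b_partial : forall (f : V -> R) i x, smooth f ->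
  partial i (b \o f) x = db (f x) * partial i f x.

Let K : R := m.+1%:R.
Let K_gt0 : 0 < K. Proof. by rewrite ltr0n. Qed.
(** Number of grid points per axis: in coordinates scaled by [K], the integers from [- M * m.+1] to
    [M * m.+1], so that the grid covers the cube containing [O]. Indices start at 0, hence the shift
    by [M * K] in [c]. *)
Let N := (M * m.+1).*2.+1.
Let c (z : {ffun 'I_n -> 'I_N}) (j : 'I_n) : R := (z j)%:R - M%:R * K.
(** Squared Euclidean distance to the grid point [z], in units of the mesh; being a polynomial, it
    is smooth, unlike the sup norm. *)
Let Q (z : {ffun 'I_n -> 'I_N}) (x : V) : R :=
  \sum_j (K * x 0 j - c z j) * (K * x 0 j - c z j).

Let lin_smooth (z : {ffun 'I_n -> 'I_N}) j :
  smooth (fun x : V => K * x 0 j - c z j).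
Proof.
by apply: smoothB; [exact/smoothZ/smooth_coord|exact: smooth_cst].
Qed.

Let Q_smooth z : smooth (Q z).
Proof. by apply: smooth_sum => j; apply: smoothM; exact: lin_smooth. Qed.

Let Q_partial z i x : partial i (Q z) x = 2 * K * (K * x 0 i - c z i).
Proof.
have pl j : partial i (fun x : V => K * x 0 j - c z j) x = K * (j == i)%:R.
  rewrite partialB; [|exact/smoothZ/smooth_coord|exact: smooth_cst].
  rewrite partial_cst subr0 partialZ; last exact: smooth_coord.
  by rewrite (partialE (is_derive_coord i j x)).
rewrite /Q partial_sum; last by move=> j; apply: smoothM; exact: lin_smooth.
rewrite (bigD1 i)//= big1 ?addr0; last first.
  by move=> j ji; rewrite partialM// !pl (negbTE ji) !mulr0 addr0.
by rewrite partialM// !pl eqxx mulr1; ring.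
Qed.

Let Q_coord z x : Q z x < n.+1%:R -> forall j, `|K * x 0 j - c z j| < n.+1%:R.
Proof.
move=> Qx j; rewrite ltNge; apply/negP => nx.
suff : n.+1%:R <= Q z x by rewrite leNgt Qx.
rewrite /Q (bigD1 j)//= ler_wpDr ?sumr_ge0// => [k _|]; first by rewrite -expr2 sqr_ge0.
rewrite -expr2 -real_normK ?num_real// expr2 (le_trans nx)// ler_peMl//.
by rewrite (le_trans _ nx)// ler1n.
Qed.

(** The threshold [n] is the squared diagonal of a grid cell, so that every boundary point has a
    nearby grid point. The factor attached to [z] is 0 where [Q z <= n] and 1 where
    [Q z >= n + 1]. *)
Let nearby z := `[< exists2 h, boundary O h & Q z h < n%:R >].
Let factor z : V -> R := b \o (fun x => Q z x - n%:R).

Let factor_smooth z : smooth (factor z).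
Proof. by apply: b_smooth; apply: smoothB => //; exact: smooth_cst. Qed.

Let psi (x : V) : R := \prod_(z | nearby z) factor z x.

Let psi_smooth : smooth psi.
Proof. exact: smooth_prod. Qed.

Let psi_near0 h : boundary O h -> \forall x \near h, psi x = 0.
Proof.
move=> bh; have [clh _] := (boundary_closure h O_open).1 bh.
have hM j : `|h 0 j| <= M%:R.
  by rewrite (le_trans (coord_norm_le _ _))// (closure_norm_le O_bounded).
have t_ge0 j : 0 <= K * h 0 j + M%:R * K.
  have := hM j; rewrite ler_norml => /andP[h1 _].
  have -> : K * h 0 j + M%:R * K = K * (h 0 j + M%:R) by ring.
  by apply: mulr_ge0; [exact: ltW|lra].
have ltN j : (Num.truncn (K * h 0 j + M%:R * K)%R < N)%N.
  rewrite truncn_lt_nat//.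
  have -> : N%:R = M%:R * K * 2 + 1 :> R by rewrite /N -addn1 natrD -muln2 !natrM.
  have := hM j; rewrite ler_norml => /andP[_ h2].
  have : K * h 0 j <= K * M%:R by apply: ler_wpM2l => //; exact: ltW.
  by lra.
(* Rounding down the scaled coordinates of [h] gives [n] differences in [[0, 1)], so [Q z h < n],
   strictly because [n] is positive. By continuity the factor of [z] then vanishes near [h]. *)
pose z : {ffun 'I_n -> 'I_N} := [ffun j => Ordinal (ltN j)].
have Qzh : Q z h < n%:R.
  have lt1 j : (K * h 0 j - c z j) * (K * h 0 j - c z j) < 1.
    have /andP[u1 u2] := truncn_itv (t_ge0 j).
    rewrite /c ffunE /=; set k := Num.truncn _ in u1 u2 *.
    rewrite -natr1 in u2.
    have e1 : 0 <= K * h 0 j - (k%:R - M%:R * K) by lra.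
    have e2 : K * h 0 j - (k%:R - M%:R * K) < 1 by lra.
    by rewrite (le_lt_trans _ e2)// ler_piMl// ltW.
  rewrite -[n in ltRHS]card_ord -sumr_const /Q.
  by apply: ltr_sum => //; apply/hasP; exists (Ordinal n_gt0); rewrite ?mem_index_enum.
have nz : nearby z by apply/asboolP; exists h.
have : \forall x \near h, Q z x < n%:R.
  have cQ : continuous_at h (Q z) by exact: smooth_cont.
  by move: cQ => /cvgr_lt; apply.
apply: filterS => x Qx; rewrite /psi (bigD1 z)//= /factor /= b0 ?mul0r//.
by rewrite subr_le0 ltW.
Qed.

Let psi01 x : 0 <= psi x <= 1.
Proof.
apply/andP; split; first by apply: prodr_ge0 => z _; have /andP[] := b01 (Q z x - n%:R).
by apply: prodr_ile1 => z _; exact: b01.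
Qed.

Let close_point z h x : Q z h < n%:R -> Q z x < n.+1%:R ->
  `|x - h| <= (2 * n.+1%:R) / K.
Proof.
move=> Qh Qx; apply: norm_le_coord; first by rewrite divr_ge0 ?mulr_ge0 ?ltW.
move=> j; rewrite ler_pdivlMr// mulrC -[X in X * _](ger0_norm (ltW K_gt0)) -normrM.
have {}Qh : Q z h < n.+1%:R by rewrite (lt_le_trans Qh)// ler_nat.
have := Q_coord Qh j; have := Q_coord Qx j; rewrite !mxE.
have -> : K * (x 0 j - h 0 j) = (K * x 0 j - c z j) - (K * h 0 j - c z j) by ring.
move=> h1 h2; rewrite (le_trans (ler_normB _ _))// mulrDl mul1r.
by apply: lerD; apply: ltW.
Qed.

(** The power counts the factors that can vary at [x]. The rest bounds the derivative of one factor: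
    [db] is at most [B], the derivative of [Q z] is [2 K] times a linear form, and this form is
    below [n + 1] wherever [db] does not vanish. *)
Let dpsi_le i x : `|partial i psi x| <=
  (n.+1.*2.+1 ^ n)%:R * (B * (2 * n.+1%:R)) * K.
Proof.
have B0 : 0 <= B by rewrite (le_trans _ (db_le 0)).
have cbd : 0 <= B * (2 * n.+1%:R) * K by rewrite !mulr_ge0// ltW.
apply: (le_trans (@partial_prod_le _ _ nearby factor i x factor_smooth (fun k y => b01 _))).
have term z : `|partial i (factor z) x| <=
   if [forall j, `|(K * x 0 j + M%:R * K) - (z j)%:R| <= n.+1%:R]
   then B * (2 * n.+1%:R) * K else 0.
  rewrite b_partial; last by apply: smoothB => //; exact: smooth_cst.
  rewrite partialB//; last exact: smooth_cst.
  rewrite partial_cst subr0 Q_partial.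
  have [->|/db_neq0/andP[d0 d1]] := eqVneq (db (Q z x - n%:R)) 0.
    by rewrite mul0r normr0; case: ifP.
  have Qx : Q z x < n.+1%:R by rewrite -natr1; lra.
  have eqc j : K * x 0 j + M%:R * K - (z j)%:R = K * x 0 j - c z j by rewrite /c; ring.
  rewrite ifT; last by apply/forallP => j; rewrite eqc ltW// Q_coord.
  rewrite normrM -[leRHS]mulrA; apply: ler_pM => //.
  have -> : `|2 * K * (K * x 0 i - c z i)| = 2 * `|K * x 0 i - c z i| * K.
    by rewrite !normrM (ger0_norm (ltW K_gt0)) (ger0_norm (_ : 0 <= 2))//; ring.
  apply: ler_wpM2r; first exact: ltW.
  apply: ler_wpM2l => //; apply: ltW; exact: Q_coord.
pose P := [pred z : {ffun 'I_n -> 'I_N} |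
  [forall j, `|(K * x 0 j + M%:R * K) - (z j)%:R| <= n.+1%:R]].
apply: (@le_trans _ _ (\sum_(z in P) (B * (2 * n.+1%:R) * K))).
  rewrite big_mkcond [leRHS]big_mkcond; apply: ler_sum => z _.
  have : `|partial i (factor z) x| <=
    (if z \in P then B * (2 * n.+1%:R) * K else 0) := term z.
  by case: (z \in P); case: (nearby z).
rewrite sumr_const -[leRHS]mulrA -[leLHS]mulr_natl.
apply: ler_wpM2r; first exact: cbd.
by rewrite ler_nat; exact: (card_near_ffun N n.+1).
Qed.

(** As [psi] vanishes near the boundary of [O], its truncation outside [O] stays smooth and its
    support is contained in [O]. *)
Let zeta (x : V) : R := if `[< O x >] then psi x else 0.

Let zeta_in x : O x -> \forall y \near x, zeta y = psi y.
Proof.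
move=> Ox; have := open_nbhs_nbhs (conj O_open Ox).
by apply: filterS => y Oy; rewrite /zeta asboolT.
Qed.

Let zeta_out x : ~ O x -> \forall y \near x, zeta y = 0.
Proof.
move=> nOx; have [clx|/near_notin] := pselect (closure O x); last first.
  by apply: filterS => y nOy; rewrite /zeta asboolF.
have : \forall y \near x, psi y = 0.
  by apply: psi_near0; apply/boundary_closure.
by apply: filterS => y; rewrite /zeta; case: ifP.
Qed.

Lemma cutoff_construction : exists zeta : V -> R,
  [/\ test_function O zeta, forall x, 0 <= zeta x <= 1,
     forall i x, `|partial i zeta x| <=
       (n.+1.*2.+1 ^ n)%:R * (B * (2 * n.+1%:R)) * m.+1%:R,
     forall i x, partial i zeta x != 0 -> O x /\
       exists2 h, boundary O h & `|x - h| <= 2 * n.+1%:R / m.+1%:R &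
     forall x, O x -> zeta x != 1 ->
       exists2 h, boundary O h & `|x - h| <= 2 * n.+1%:R / m.+1%:R].
Proof.
have B0 : 0 <= B by rewrite (le_trans _ (db_le 0)).
have sz : smooth zeta.
  apply: smooth_local => x; have [Ox|nOx] := pselect (O x).
    by exists psi => //; exact: zeta_in.
  by exists (cst 0); [exact: smooth_cst|exact: zeta_out].
exists zeta; split.
- apply: (@test_intro _ _ O (closure [set x | zeta x != 0])) => //.
  + apply: bounded_closed_compact; last exact: closed_closure.
    apply: (@norm_bounded_set _ _ _ M%:R); apply: closure_norm_le => x.
    rewrite /= /zeta; case: ifPn; last by rewrite eqxx.
    by move=> /asboolP/O_bounded.
  + move=> x clx; apply: contrapT => /zeta_out /clx [y []] /= /eqP + E.
    by rewrite E.
  + by move=> x H; apply: contrapT => /eqP z0; apply: H; exact: subset_closure.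
- by move=> x; rewrite /zeta; case: ifP => // _; rewrite lexx ler01.
- move=> i x; have [Ox|nOx] := pselect (O x).
    by rewrite (partial_near _ (zeta_in Ox)) dpsi_le.
  rewrite (partial_near _ (zeta_out nOx)) partial_cst normr0.
  by rewrite !mulr_ge0.
- move=> i x; have [Ox|nOx] := pselect (O x); last first.
    by rewrite (partial_near _ (zeta_out nOx)) partial_cst eqxx.
  rewrite (partial_near _ (zeta_in Ox)) => px; split => //.
  have [z nz pz] : exists2 z, nearby z & partial i (factor z) x != 0.
    apply: contrapT => H; move: px; apply/negP; rewrite negbK -normr_le0.
    apply: (le_trans (@partial_prod_le _ _ nearby factor i x factor_smooth (fun k y => b01 _))).
    rewrite big1// => z nz; apply/eqP; rewrite normr_eq0.
    by apply: contrapT => /negP pz; apply: H; exists z.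
  move: pz; rewrite b_partial; last by apply: smoothB => //; exact: smooth_cst.
  rewrite mulf_eq0 negb_or => /andP[/db_neq0/andP[_ d1] _].
  move: nz => /asboolP[h bh Qh]; exists h => //; apply: close_point Qh _.
  by rewrite -natr1; lra.
- move=> x Ox; rewrite /zeta asboolT// => px.
  have [z nz pz] : exists2 z, nearby z & factor z x != 1.
    apply: contrapT => H; move: px; apply/negP; rewrite negbK /psi big1// => z nz.
    by apply/eqP; apply: contrapT => /negP pz; apply: H; exists z.
  move: nz => /asboolP[h bh Qh]; exists h => //; apply: close_point Qh _.
  rewrite ltNge; apply/negP => nQ; move: pz; rewrite /factor /= b1 ?eqxx//.
  by rewrite lerBrDr addrC natr1.
Qed.

End construction.

(** The constant [C] is the sum of the gradient constant and of the width constant of the strip, so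
    that it bounds both. A point of [O] has positive distance to the boundary and leaves the strip
    for large [m], whence the eventual value 1. *)
Lemma cutoff (O : set V) : open O -> bounded_set O ->
  exists C : R, 0 < C /\ exists zeta : nat -> V -> R,
  (forall m, [/\ test_function O (zeta m), forall x, 0 <= zeta m x <= 1,
     forall i x, `|partial i (zeta m) x| <= C * m.+1%:R &
     forall i x, partial i (zeta m) x != 0 -> O x /\
       exists2 h, boundary O h & `|x - h| <= C / m.+1%:R]) /\
  (forall x, O x -> \forall m \near \oo, zeta m x = 1).
Proof.
move=> oO /bounded_setP[M OM].
have [b [db [B [[b01 b0 b1 dB d0] bs]]]] := @plateau_exists R.
have B0 : 0 <= B by rewrite (le_trans _ (dB 0)).
pose C := (n.+1.*2.+1 ^ n)%:R * (B * (2 * n.+1%:R)) + 2 * n.+1%:R.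
have C1 : (n.+1.*2.+1 ^ n)%:R * (B * (2 * n.+1%:R)) <= C by rewrite lerDl mulr_ge0.
have C2 : 2 * n.+1%:R <= C by rewrite lerDr !mulr_ge0.
exists C; split; first by rewrite (lt_le_trans _ C2)// mulr_gt0.
have /choice[zeta Hz] m := @cutoff_construction O b db B M m oO OM b01 b0 b1 dB d0
  (fun f sf => (bs _ f sf).1) (fun f i x sf => (bs _ f sf).2 i x).
exists zeta; split.
  move=> m; have [z1 z2 z3 z4 _] := Hz m; split => // i x.
    by rewrite (le_trans (z3 i x))// ler_wpM2r.
  move=> /z4[Ox [h bh xh]]; split => //; exists h => //.
  by rewrite (le_trans xh)// ler_wpM2r// invr_ge0.
move=> x Ox; have [e e0 He] : exists2 e : R, 0 < e & forall y, `|x - y| < e -> O y.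
  by apply/near_normP; apply: open_nbhs_nbhs.
have e2 : 0 < e / (2 * n.+1%:R) by rewrite divr_gt0// mulr_gt0.
have := near_infty_natSinv_lt (PosNum e2); apply: filterS => m /= me.
have [_ _ _ _ z5] := Hz m; apply/eqP; apply: contrapT => /negP /(z5 x Ox)[h bh xh].
have [_] := (boundary_closure h oO).1 bh; apply; apply: He.
rewrite (le_lt_trans xh)// mulrC -ltr_pdivlMr ?mulr_gt0//.
Qed.

End cutoff.

(** * Square-integrable functions *)

Section square_integrable.
Context {d : measure_display} {T : measurableType d} {R : realType}.
Context {mu : {measure set T -> \bar R}}.
Implicit Types (D : set T) (f g h : T -> R).

Definition sqint D f := measurable_fun D f /\
  mu.-integrable D (EFin \o (fun x => f x ^+ 2)).

(** The square of the L^2 norm; the triangle inequality is replaced by the bound with factors 2 in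
    [nrm2D_le]. A divergent integral gives the value 0, so smallness is meaningful only together
    with [sqint]. *)
Definition nrm2 D f : R := \int[mu]_(x in D) (f x ^+ 2).

Lemma measurable_sq D f : measurable_fun D f ->
  measurable_fun D (EFin \o (fun x => f x ^+ 2)).
Proof. by move=> mf; apply/measurable_EFinP; exact: measurable_funX. Qed.

Lemma sqintP D f : measurable D -> measurable_fun D f ->
  sqint D f <-> (\int[mu]_(x in D) (f x ^+ 2)%:E < +oo)%E.
Proof.
move=> mD mf; split=> [[_ /integrableP[_]]|H].
  by under eq_integral do rewrite /comp gee0_abs ?lee_fin ?sqr_ge0//.
split => //; apply/integrableP; split; first exact: measurable_sq.
by under eq_integral do rewrite /comp gee0_abs ?lee_fin ?sqr_ge0//.
Qed.

Lemma nrm2E D f : measurable D -> sqint D f ->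
  (\int[mu]_(x in D) (f x ^+ 2)%:E = (nrm2 D f)%:E)%E.
Proof.
by move=> mD [mf fi]; rewrite /nrm2 /Rintegral fineK//; exact: integrable_fin_num.
Qed.

Lemma nrm2_ge0 D f : 0 <= nrm2 D f.
Proof. by apply: Rintegral_ge0 => x _; exact: sqr_ge0. Qed.

Lemma sqint_le D f (G : T -> R) : measurable D -> measurable_fun D f ->
  mu.-integrable D (EFin \o G) -> (forall x, D x -> f x ^+ 2 <= G x) ->
  sqint D f.
Proof.
move=> mD mf iG H; split => //.
apply: le_integrable iG => //; first exact: measurable_sq.
move=> x Dx; rewrite /= lee_fin ger0_norm ?sqr_ge0//.
by rewrite (le_trans (H x Dx))// ler_norm.
Qed.

Lemma nrm2_le D f (G : T -> R) : measurable D -> measurable_fun D f ->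
  mu.-integrable D (EFin \o G) -> (forall x, D x -> f x ^+ 2 <= G x) ->
  nrm2 D f <= \int[mu]_(x in D) G x.
Proof.
move=> mD mf iG H; apply: le_Rintegral => //.
by have [] := sqint_le mD mf iG H.
Qed.

Lemma eq_sqint D f g : measurable D -> (forall x, D x -> f x = g x) -> sqint D f -> sqint D g.
Proof.
move=> mD fg [mf fi]; split.
  by apply: eq_measurable_fun mf => x /set_mem; exact: fg.
by apply: eq_integrable fi => // x /set_mem Dx /=; rewrite fg.
Qed.

Lemma eq_nrm2 D f g : (forall x, D x -> f x = g x) -> nrm2 D f = nrm2 D g.
Proof. by move=> fg; apply: eq_Rintegral => x /set_mem Dx; rewrite fg. Qed.

Section fixed_domain.
Variable D : set T.
Hypothesis mD : measurable D.

Let sq2 (a b : R) : (a + b) ^+ 2 <= 2 * a ^+ 2 + 2 * b ^+ 2.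
Proof. by have := sqr_ge0 (a - b); rewrite !expr2; nra. Qed.

Lemma integrableZ_EFin (c : R) f : mu.-integrable D (EFin \o f) ->
  mu.-integrable D (EFin \o (fun x => c * f x)).
Proof. by move=> fi; have := integrableZl mD c fi. Qed.

Lemma integrableD_EFin f g : mu.-integrable D (EFin \o f) ->
  mu.-integrable D (EFin \o g) -> mu.-integrable D (EFin \o (fun x => f x + g x)).
Proof. by move=> fi gi; have := integrableD mD fi gi. Qed.

Lemma integrableB_EFin f g : mu.-integrable D (EFin \o f) ->
  mu.-integrable D (EFin \o g) -> mu.-integrable D (EFin \o (fun x => f x - g x)).
Proof. by move=> fi gi; have := integrableB mD fi gi. Qed.

Lemma sqintZ (c : R) f : sqint D f -> sqint D (fun x => c * f x).
Proof.
move=> [mf fi]; apply: (@sqint_le _ _ (fun x => c ^+ 2 * f x ^+ 2)) => //.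
- by apply: measurable_funM.
- exact: integrableZ_EFin.
- by move=> x _; rewrite exprMn.
Qed.

Lemma nrm2Z (c : R) f : sqint D f -> nrm2 D (fun x => c * f x) = c ^+ 2 * nrm2 D f.
Proof.
move=> [mf fi]; rewrite /nrm2 -RintegralZl//.
by apply: eq_Rintegral => x _; rewrite exprMn.
Qed.

Let int_sq2 f g : sqint D f -> sqint D g ->
  mu.-integrable D (EFin \o (fun x => 2 * f x ^+ 2 + 2 * g x ^+ 2)).
Proof.
by move=> [_ fi] [_ gi]; apply: integrableD_EFin; exact: integrableZ_EFin.
Qed.

Lemma sqintD f g : sqint D f -> sqint D g -> sqint D (fun x => f x + g x).
Proof.
move=> sf sg; apply: (sqint_le mD _ (int_sq2 sf sg)) => [|x _]; last exact: sq2.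
by apply: measurable_funD; [case: sf|case: sg].
Qed.

Lemma nrm2D_le f g : sqint D f -> sqint D g ->
  nrm2 D (fun x => f x + g x) <= 2 * nrm2 D f + 2 * nrm2 D g.
Proof.
move=> sf sg; have [[mf fi] [mg gi]] := (sf, sg).
apply: (le_trans (nrm2_le mD _ (int_sq2 sf sg) _)) => [|x _|].
- exact: measurable_funD.
- exact: sq2.
- rewrite RintegralD//; [|exact: integrableZ_EFin..].
  by rewrite !RintegralZl.
Qed.

Lemma sqintB f g : sqint D f -> sqint D g -> sqint D (fun x => f x - g x).
Proof.
move=> sf sg; have := sqintD sf (sqintZ (-1) sg).
by under eq_fun do rewrite mulN1r.
Qed.

Lemma sqint0 : sqint D (fun=> 0).
Proof.
split; first exact: measurable_cst.
rewrite (_ : _ \o _ = cst 0%E); first exact: integrable0.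
by apply/funext => x; rewrite /= expr0n.
Qed.

Lemma sqintMb f h (M : R) : sqint D f -> measurable_fun D h ->
  (forall x, D x -> `|h x| <= M) -> sqint D (fun x => f x * h x).
Proof.
move=> [mf fi] mh hM; apply: (@sqint_le _ _ (fun x => M ^+ 2 * f x ^+ 2)) => //.
- exact: measurable_funM.
- exact: integrableZ_EFin.
move=> x Dx; rewrite exprMn mulrC ler_wpM2r ?sqr_ge0//.
by rewrite -real_normK ?num_real// lerXn2r ?nnegrE// ?(le_trans _ (hM x Dx)) ?hM.
Qed.

Lemma sqint_mul f g : sqint D f -> sqint D g ->
  mu.-integrable D (EFin \o (fun x => f x * g x)).
Proof.
move=> sf sg; have [[mf fi] [mg gi]] := (sf, sg).
apply: (@le_integrable _ _ _ _ _ mD _ _ _ _ (int_sq2 sf sg)).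
  by apply/measurable_EFinP; exact: measurable_funM.
move=> x _; rewrite /= lee_fin [leRHS]ger0_norm; last first.
  by rewrite addr_ge0// mulr_ge0// sqr_ge0.
by rewrite ler_norml !expr2; apply/andP; split; nra.
Qed.

(** Weighted Young inequality in place of Cauchy-Schwarz, with the weight left free for limit
    arguments. *)
Lemma Rintegral_mul_le f g (s : R) : 0 < s -> sqint D f -> sqint D g ->
  `|\int[mu]_(x in D) (f x * g x)| <= s^-1 * nrm2 D f + s * nrm2 D g.
Proof.
move=> s0 sf sg; have [[mf fi] [mg gi]] := (sf, sg).
have fgi := sqint_mul sf sg.
apply: (le_trans (le_normr_Rintegral mD fgi)).
rewrite /nrm2 -!RintegralZl// -RintegralD//; [|exact: integrableZ_EFin..].
apply: le_Rintegral => //; first exact: integrable_norm.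
  by apply: integrableD_EFin; exact: integrableZ_EFin.
move=> x _; set a := f x; set b := g x.
rewrite normrM -(real_normK (num_real a)) -(real_normK (num_real b)).
set p := `|a|; set q := `|b|.
have p0 : 0 <= p := normr_ge0 a.
have q0 : 0 <= q := normr_ge0 b.
suff : s * (p * q) <= p ^+ 2 + (s * q) ^+ 2.
  move=> H; rewrite -(ler_pM2l s0); apply: (le_trans H).
  by rewrite le_eqVlt; apply/orP; left; apply/eqP; field; rewrite gt_eqF.
rewrite mulrCA; have : 0 <= s * q by rewrite mulr_ge0// ltW.
by have := sqr_ge0 (p - s * q); rewrite !expr2; nra.
Qed.

Definition cvg2 (f_ : nat -> T -> R) f :=
  nrm2 D (fun x => f_ k x - f x) @[k --> \oo] --> (0 : R).

Lemma cvg2P (f_ : nat -> T -> R) f : cvg2 f_ f <->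
  forall e : R, 0 < e -> \forall k \near \oo, nrm2 D (fun x => f_ k x - f x) <= e.
Proof.
split=> [/cvgrPdist_le H e /H|H].
  by apply: filterS => k; rewrite sub0r normrN ger0_norm// nrm2_ge0.
apply/cvgrPdist_le => e /H.
by apply: filterS => k; rewrite sub0r normrN ger0_norm// nrm2_ge0.
Qed.

Lemma cvg2_Rintegral (f_ : nat -> T -> R) f g : (forall k, sqint D (f_ k)) ->
  sqint D f -> sqint D g -> cvg2 f_ f ->
  \int[mu]_(x in D) (f_ k x * g x) @[k --> \oo] --> \int[mu]_(x in D) (f x * g x).
Proof.
move=> sf_ sf sg /cvg2P H; apply/cvgrPdist_le => e e0.
(* With this weight the term in [g] is at most [e / 2] for every [k]; the added 1 keeps the
   denominator positive. *)
pose s := e / (2 * (nrm2 D g + 1)).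
have G0 : 0 < nrm2 D g + 1 by rewrite ltr_wpDl// nrm2_ge0.
have s0 : 0 < s by rewrite divr_gt0// mulr_gt0.
have se0 : 0 < s * (e / 2) by rewrite mulr_gt0// divr_gt0.
have := H _ se0; apply: filterS => k Hk.
rewrite distrC -RintegralB//; [|exact: sqint_mul..].
rewrite (@eq_Rintegral _ _ _ _ _ (fun x => (f_ k x - f x) * g x)); last first.
  by move=> x _; rewrite mulrBl.
apply: (le_trans (Rintegral_mul_le s0 (sqintB (sf_ k) sf) sg)).
rewrite [leRHS](splitr e) lerD//.
  by rewrite ler_pdivrMl.
have -> : s * nrm2 D g = e / 2 * (nrm2 D g / (nrm2 D g + 1)).
  by rewrite /s; field; rewrite gt_eqF.
apply: ler_piMr; first by rewrite divr_ge0// ltW.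
by rewrite ler_pdivrMr// mul1r lerDl.
Qed.

Lemma cvg2_dominated (f_ : nat -> T -> R) f g : (forall k, measurable_fun D (f_ k)) ->
  measurable_fun D f -> sqint D g ->
  (forall x, D x -> f_ k x @[k --> \oo] --> f x) ->
  (forall k x, D x -> `|f_ k x - f x| <= `|g x|) -> cvg2 f_ f.
Proof.
move=> mf_ mf [mg gi] fc fd.
have h1 : {ae mu, forall x, D x ->
    (fun k => ((f_ k x - f x) ^+ 2)%:E) @ \oo --> (cst 0%E : T -> \bar R) x}.
  apply: aeW => x Dx.
  rewrite (_ : cst 0%E x = ((0 : R) ^+ 2)%:E); last by rewrite /= expr0n.
  apply: cvg_EFin; first exact: nearW.
  apply: cvgM; rewrite -[X in _ --> X](subrr (f x));
    by apply: cvgB; [exact: fc|exact: cvg_cst].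
have h2 : {ae mu, forall x k, D x ->
    (`|((f_ k x - f x) ^+ 2)%:E| <= (g x ^+ 2)%:E)%E}.
  apply: aeW => x k Dx; rewrite lee_fin ger0_norm ?sqr_ge0//.
  by rewrite -real_normK ?num_real// -[leRHS]real_normK ?num_real// lerXn2r ?nnegrE// fd.
have m1 k : measurable_fun D (fun x => ((f_ k x - f x) ^+ 2)%:E).
  by apply: measurable_sq; exact: measurable_funB.
have [_ _ H] := @dominated_convergence _ _ _ mu D mD
  (fun k x => ((f_ k x - f x) ^+ 2)%:E) (cst 0%E) (fun x => (g x ^+ 2)%:E)
  m1 (measurable_cst _) h1 gi h2.
rewrite integral_cst// mul0e in H.
exact: fine_cvg H.
Qed.

Lemma nrm2_eq0 f : sqint D f -> nrm2 D f = 0 -> {ae mu, forall x, D x -> f x = 0}.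
Proof.
move=> sf n0; have [mf fi] := sf.
have := nrm2E mD sf; rewrite n0 => H.
have : ae_eq mu D (EFin \o (fun x => f x ^+ 2)) (cst 0%E).
  apply/(ae_eq_integral_abs mu mD (measurable_sq mf)).
  by under eq_integral do rewrite /comp gee0_abs ?lee_fin ?sqr_ge0//.
apply: filterS => x H' Dx; have /= [/eqP] := H' Dx.
by rewrite sqrf_eq0 => /eqP.
Qed.

End fixed_domain.

End square_integrable.

(** * Lebesgue measure on row vectors *)

Section lebesgue_rV_theory.
Context {R : realType}.
Local Notation leb n := (@lebesgue_rV R n).

Lemma measurable_forall_ord {d} {T : measurableType d} n (F : 'I_n -> set T) :
  (forall i, measurable (F i)) -> measurable [set x | forall i, F i x].
Proof.
move=> mF; rewrite (_ : [set _ | _] = ~` \bigcup_i ~` F i); last first.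
  apply/seteqP; split => [x H [i _]|x H i]; first by apply; exact: H.
  by apply: contrapT => nF; apply: H; exists i.
apply: measurableC; apply: countable_bigcupT_measurable; first exact: countableP.
by move=> i; exact: measurableC.
Qed.

(** The sigma-algebra is generated by coordinates, so the open set is written as a countable union
    of boxes with rational centres and radii [1/(k+1)]. *)
Lemma open_measurable_rV n (A : set 'rV[R]_n) : open A -> measurable A.
Proof.
move=> oA.
pose box (pk : 'rV[rat]_n * nat) : set 'rV[R]_n :=
  [set x | forall i, `|x 0 i - ratr (pk.1 0 i)| < pk.2.+1%:R^-1].
have mbox pk : measurable (box pk).
  apply: measurable_forall_ord => i.
  rewrite (_ : (fun _ => _) = (fun x : 'rV[R]_n => x 0 i) @^-1` (ball (ratr (pk.1 0 i) : R) pk.2.+1%:R^-1)).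
    rewrite -[X in measurable X]setTI.
    by apply: measurable_coord => //; exact: measurable_ball.
  by apply/seteqP; split => x; rewrite /= /ball/= distrC.
have -> : A = \bigcup_(pk in [set pk | box pk `<=` A]) box pk.
  apply/seteqP; split => [x Ax|x [pk /= H] /H//].
  have [e e0 He] : exists2 e : R, 0 < e & forall y, `|x - y| < e -> A y.
    by apply/near_normP; exact: open_nbhs_nbhs.
  have e2 : 0 < e / 2 by rewrite divr_gt0.
  have [k ke] : exists k : nat, k.+1%:R^-1 < e / 2 :> R.
    by have [k _ H] := near_infty_natSinv_lt (PosNum e2); exists k; exact: (H k (leqnn k)).
  have /choice[q Hq] i : exists q : rat, `|x 0 i - ratr q| < k.+1%:R^-1 :> R.
    have : x 0 i - k.+1%:R^-1 < x 0 i + k.+1%:R^-1 :> R.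
      by rewrite ltrD2l gtrN// invr_gt0.
    move=> /rat_in_itvoo[q]; rewrite in_itv/= => /andP[q1 q2]; exists q.
    by rewrite distrC ltr_distl q1 q2.
  exists (\row_i q i, k) => /=; last by move=> i /=; rewrite mxE.
  move=> y Hy; apply: He; apply: (@le_lt_trans _ _ (k.+1%:R^-1 + k.+1%:R^-1)).
    apply: norm_le_coord; first by rewrite addr_ge0.
    move=> i; have := Hy i; rewrite !mxE /= => yq.
    have -> : x 0 i - y 0 i = (x 0 i - ratr (q i)) - (y 0 i - ratr (q i)) :> R by ring.
    by rewrite (le_trans (ler_normB _ _))// lerD// ltW.
  by rewrite [ltRHS](splitr e) ltrD.
rewrite bigcup_mkcond; apply: countable_bigcupT_measurable => [|pk].
  exact: countableP.
by case: ifP.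
Qed.

Lemma closed_measurable_rV n (A : set 'rV[R]_n) : closed A -> measurable A.
Proof.
move=> cA; rewrite -(setCK A); apply: measurableC; apply: open_measurable_rV.
exact: closed_openC.
Qed.

Lemma continuous_measurable_rV n (f : 'rV[R]_n -> R) :
  continuous f -> measurable_fun setT f.
Proof.
move=> cf; apply: (measurability _ (RGenOpens.measurableE R)).
move=> _ [_ [a [b ->] <-]]; rewrite setTI; apply: open_measurable_rV.
by move/continuousP : cf; apply; exact: interval_open.
Qed.

(** Open sets generate the sigma-algebra and are stable under intersection, which is what a Dynkin
    induction on measurable sets requires. *)
Lemma measurable_rV_openE n :
  @measurable _ 'rV[R]_n = <<s [set A : set 'rV[R]_n | open A] >>.
Proof.
apply/seteqP; split; last first.
  apply: smallest_sub; first exact: sigma_algebra_measurable.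
  exact: open_measurable_rV.
apply: smallest_sub; first exact: smallest_sigma_algebra.
rewrite -bigcup_seq/=; apply: bigcup_sub => i _ A [B mB <-].
pose T := g_sigma_algebraType [set A : set 'rV[R]_n | open A].
have mc : measurable_fun [set: T] (fun x : T => (x : 'rV[R]_n) 0 i).
  apply: (measurability _ (RGenOpens.measurableE R)).
  move=> _ [_ [a [b ->] <-]]; rewrite setTI; apply: sub_sigma_algebra => /=.
  have /continuousP := @coord_continuous R 1 n 0 i.
  by apply; exact: interval_open.
exact: mc measurableT B mB.
Qed.

Lemma lebesgue_rV_cube n (A : set R) : measurable (A : set (measurableTypeR R)) ->
  leb n [set x | forall i, A (x 0 i)] = ((@lebesgue_measure R A) ^+ n)%E.
Proof.
move=> mA; elim: n => [|n IH].
  by rewrite expe0 /= diracE mem_set//= => -[].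
rewrite [LHS]/=.
rewrite /lebesgue_rV_step /pushforward.
have -> : (@cons_rV R n) @^-1` [set x | forall i, A (x 0 i)] =
    A `*` [set x : 'rV[R]_n | forall i, A (x 0 i)].
  apply/seteqP; split => [[t x] /= H|[t x] [/= At Ax] i].
    split => /=; first by have := H ord0; rewrite mxE unlift_none.
    by move=> i; have := H (lift ord0 i); rewrite mxE liftK.
  by rewrite mxE; case: unliftP => [j _|_].
have mAn : measurable [set x : 'rV[R]_n | forall i, A (x 0 i)].
  apply: measurable_forall_ord => i; rewrite -[X in measurable X]setTI.
  exact: (@measurable_coord _ R n i).
by rewrite product_measure1E// IH expeS.
Qed.

Lemma lebesgue_rV_bounded n (A : set 'rV[R]_n) : measurable A -> bounded_set A ->
  (leb n A < +oo)%E.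
Proof.
move=> mA /bounded_setP[k Ak].
pose J := `[- k%:R : R, k%:R]%classic.
apply: (@le_lt_trans _ _ (leb n [set x | forall i, J (x 0 i)])).
  apply: le_measure; rewrite ?inE//.
    apply: measurable_forall_ord => i; rewrite -[X in measurable X]setTI.
    by apply: (@measurable_coord _ R n i) => //; exact: measurable_itv.
  move=> x /Ak xk i; rewrite /J /= in_itv/= -ler_norml.
  exact: le_trans (coord_norm_le _ _) xk.
rewrite lebesgue_rV_cube//; last exact: measurable_itv.
have : (@lebesgue_measure R J < +oo)%E.
  by rewrite /J lebesgue_measure_itv/=; case: ifP => // _; rewrite ltry.
elim: (n) => [|m IH] H; first by rewrite expe0 ltry.
by rewrite expeS lte_mul_pinfty ?IH// ge0_fin_numE.
Qed.

Lemma lebesgue_rV_cube_gt0 n (e : R) : 0 < e ->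
  (0 < leb n [set y : 'rV[R]_n | forall i, - e < y 0 i < e]%R)%E.
Proof.
move=> e0.
have E : [set y : 'rV[R]_n | forall i, - e < y 0 i < e] =
    [set y : 'rV[R]_n | forall i, `](- e), e[%classic (y 0 i)].
  by apply/seteqP; split => x H i; have := H i; rewrite /= in_itv.
rewrite E lebesgue_rV_cube; last exact: measurable_itv.
rewrite lebesgue_measure_itv/= ifT ?lte_fin; last by lra.
elim: (n) => [|m IH]; first by rewrite expe0.
by rewrite expeS mule_gt0// lte_fin; lra.
Qed.

Local Open Scope ereal_scope.

Lemma lebesgue_translate (a : R) (A : set (measurableTypeR R)) : measurable A ->
  pushforward (@lebesgue_measure R) (fun t : measurableTypeR R => (a + t)%R : measurableTypeR R) A =
  @lebesgue_measure R A.
Proof.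
move=> mA.
have mt : measurable_fun [set: measurableTypeR R]
    (fun t : measurableTypeR R => (a + t)%R : measurableTypeR R).
  apply: (@continuous_measurable_fun R (fun t => (a + t)%R)) => t.
  by apply: cvgD; [exact: cvg_cst|exact: cvg_id].
pose pm : {measure set (measurableTypeR R) -> \bar R} :=
  measure_function_pushforward__canonical__measure_function_Measure
    (@lebesgue_measure R) mt.
apply/esym; apply: (@lebesgue_measure_unique R pm) => // _ [[u v]] _ <-.
rewrite /pm /= /pushforward.
have -> : (fun t : R => (a + t)%R) @^-1` `]u, v]%classic = `](u - a)%R, (v - a)%R]%classic.
  by apply/seteqP; split => t /=; rewrite !in_itv/= => /andP[h1 h2]; apply/andP; split; lra.
rewrite !lebesgue_measure_itv/= !lte_fin.
rewrite ltrD2r; case: ifP => // _; rewrite -!EFinB; congr EFin.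
by rewrite opprB addrA subrK.
Qed.

Lemma ge0_integral_translate (a : R) (f : measurableTypeR R -> \bar R) :
  measurable_fun setT f -> (forall t, 0 <= f t) ->
  \int[@lebesgue_measure R]_t f (a + t)%R = \int[@lebesgue_measure R]_t f t.
Proof.
move=> mf f0.
have mt : measurable_fun [set: measurableTypeR R]
    (fun t : measurableTypeR R => (a + t)%R : measurableTypeR R).
  apply: (@continuous_measurable_fun R (fun t => (a + t)%R)) => t.
  by apply: cvgD; [exact: cvg_cst|exact: cvg_id].
have := ge0_integral_pushforward mt (@lebesgue_measure R) measurableT mf (fun y _ => f0 y).
rewrite preimage_setT => <-.
apply: eq_measure_integral => //= A mA _.
exact: lebesgue_translate.
Qed.

Lemma ge0_integral_rVS n (f : 'rV[R]_n.+1 -> \bar R) :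
  measurable_fun setT f -> (forall x, 0 <= f x) ->
  \int[leb n.+1]_x f x = \int[@lebesgue_measure R]_t \int[leb n]_x f (cons_rV (t, x)).
Proof.
move=> mf f0.
have := ge0_integral_pushforward (@measurable_cons_rV R n)
  (@lebesgue_measure R \x leb n) measurableT mf (fun y _ => f0 y).
rewrite preimage_setT => H.
rewrite [LHS]H fubini_tonelli1//=.
exact: measurableT_comp mf (@measurable_cons_rV R n).
Qed.

(** Tonelli peels off the first coordinate: it is translated on the line, and the others by
    induction. *)
Lemma ge0_integral_rV_translate n (a : 'rV[R]_n) (f : 'rV[R]_n -> \bar R) :
  measurable_fun setT f -> (forall x, 0 <= f x) ->
  \int[leb n]_x f (a + x)%R = \int[leb n]_x f x.
Proof.
elim: n a f => [|n IH] a f mf f0.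
  by apply: eq_integral => x _; congr f; apply/rowP => -[].
have mt : measurable_fun setT (fun x => f (a + x)%R).
  apply: measurableT_comp mf _; apply: measurable_fun_coord => i.
  under eq_fun do rewrite mxE.
  exact: (measurable_funD (measurable_cst (a 0%R i)) (@measurable_coord _ R n.+1 i)).
rewrite !ge0_integral_rVS//.
pose F (t : measurableTypeR R) := \int[leb n]_x f (cons_rV (t, x)).
have mF : measurable_fun setT F.
  apply: (@measurable_fun_fubini_tonelli_F _ _ _ _ R (leb n) (f \o @cons_rV R n)) => [|x]; last exact: f0.
  exact: measurableT_comp mf (@measurable_cons_rV R n).
have F0 t : 0 <= F t by apply: integral_ge0.
rewrite -(ge0_integral_translate (a 0%R ord0) mF F0).
apply: eq_integral => t _; rewrite /F.
pose g x := f (cons_rV ((a 0 ord0 + t)%R, x)).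
rewrite -(IH (\row_j a 0%R (lift ord0 j)) g) ; last by move=> x; exact: f0.
  apply: eq_integral => x _; rewrite /g; congr f; apply/rowP => i; rewrite !mxE.
  by case: unliftP => [j ->|->] /=; rewrite ?mxE.
apply: measurableT_comp mf _.
apply: measurableT_comp (@measurable_cons_rV R n) _.
by apply: measurable_fun_pair => //; exact: measurable_cst.
Qed.

End lebesgue_rV_theory.

Import HBNNSimple.

(** * Density of test functions *)

Section density.
Context {R : realType} {n : nat}.
Hypothesis n_gt0 : (0 < n)%N.
Local Notation V := 'rV[R]_n.
Local Notation leb := (@lebesgue_rV R n).
Implicit Types (f g : V -> R) (D A : set V).

Lemma sqintS D D' f : measurable D -> measurable D' -> D `<=` D' ->
  sqint (mu := leb) D' f -> sqint (mu := leb) D f.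
Proof.
move=> mD mD' DD' [mf fi]; split; first exact: measurable_funS mf.
exact: integrableS fi.
Qed.

Lemma integrable_bounded_set (M : R) A : measurable A -> bounded_set A ->
  leb.-integrable A (EFin \o (fun=> M)).
Proof.
move=> mA bA; apply: measurable_bounded_integrable => //.
  exact: lebesgue_rV_bounded.
exact: bounded_cst.
Qed.

Lemma integrable_indic_bounded (M : R) A : measurable A -> bounded_set A ->
  leb.-integrable setT (EFin \o (fun x => M * \1_A x)).
Proof.
move=> mA bA.
have := (integrable_mkcond (mu := leb) (EFin \o (fun=> M)) mA).1 (integrable_bounded_set M mA bA).
apply: eq_integrable => // x _ /=; rewrite patchE indicE.
by case: (x \in A); rewrite ?mulr1 ?mulr0.
Qed.

Lemma test_measurable D phi : test_function D phi -> measurable_fun setT phi.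
Proof.
by move=> /test_smooth sp; apply: continuous_measurable_rV; exact: smooth_cont.
Qed.

Lemma test_sqint D phi : test_function D phi -> sqint (mu := leb) setT phi.
Proof.
move=> tp; have mp := test_measurable tp.
have [M M0 HM] := test_bounded tp; have [K [cK KD] HK] := testP tp.
have mK : measurable K.
  by apply: closed_measurable_rV; apply: compact_closed => //; exact: norm_hausdorff.
apply: (@sqint_le _ _ _ _ _ _ (fun x => M ^+ 2 * \1_K x)) => //.
  by apply: integrable_indic_bounded => //; exact: compact_bounded.
move=> x _; rewrite indicE; have [/set_mem Kx|Kx] := boolP (x \in K).
  by rewrite mulr1 -real_normK ?num_real// lerXn2r ?nnegrE.
have nK : ~ K x by move: Kx; rewrite notin_setE.
by rewrite HK// mulr0 expr0n.
Qed.

Section bounded_open.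
Variable O : set V.
Hypothesis oO : open O.
Hypothesis bO : bounded_set O.

Let mO : measurable O. Proof. exact: open_measurable_rV. Qed.

Lemma sqint_bounded (M : R) f : measurable_fun O f ->
  (forall x, O x -> `|f x| <= M) -> sqint (mu := leb) O f.
Proof.
move=> mf H; apply: (@sqint_le _ _ _ _ _ _ (fun=> M ^+ 2)) => //.
  exact: integrable_bounded_set.
move=> x Ox; have M0 : 0 <= M := le_trans (normr_ge0 _) (H x Ox).
by rewrite -real_normK ?num_real// lerXn2r ?nnegrE// H.
Qed.

Let tsq phi : test_function O phi -> sqint (mu := leb) O phi.
Proof. by move=> /test_sqint; apply: sqintS => //; exact: measurableT. Qed.

(** The closure of the test functions in L^2(O). It is a linear space closed under L^2 limits, which
    reduces density to indicators, and these to indicators of open sets. *)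
Definition approx2 f := sqint (mu := leb) O f /\ forall e : R, 0 < e ->
  exists2 phi, test_function O phi & nrm2 (mu := leb) O (fun x => f x - phi x) <= e.

Let approx2_test phi : test_function O phi -> approx2 phi.
Proof.
move=> tp; split; first exact: tsq.
move=> e e0; exists phi => //; rewrite (@eq_nrm2 _ _ _ _ _ _ (fun=> 0)).
  by rewrite /nrm2 expr0n /= Rintegral_cst// mul0r; exact: ltW.
by move=> x _; rewrite subrr.
Qed.

Let approx2_lim f : sqint (mu := leb) O f -> (forall e : R, 0 < e ->
  exists2 g, approx2 g & nrm2 (mu := leb) O (fun x => f x - g x) <= e) -> approx2 f.
Proof.
move=> sf H; split => // e e0.
have e4 : 0 < e / 4 by rewrite divr_gt0.
have [g [sg Hg] fg] := H _ e4; have [phi tp gp] := Hg _ e4.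
exists phi => //.
rewrite (@eq_nrm2 _ _ _ _ _ _ (fun x => (f x - g x) + (g x - phi x))); last first.
  by move=> x _; rewrite addrA subrK.
apply: (le_trans (nrm2D_le mO (sqintB mO sf sg) (sqintB mO sg (tsq tp)))).
by lra.
Qed.

Let approx2_cvg (f_ : nat -> V -> R) f : sqint (mu := leb) O f ->
  (forall k, approx2 (f_ k)) -> cvg2 (mu := leb) O f_ f -> approx2 f.
Proof.
move=> sf H /cvg2P c; apply: approx2_lim => // e /c[k _ /(_ k (leqnn k)) Hk].
exists (f_ k) => //; rewrite (le_trans _ Hk)// (@eq_nrm2 _ _ _ _ _ _ (fun x => - 1 * (f_ k x - f x))).
  by rewrite nrm2Z//; [rewrite sqrrN expr1n mul1r|apply: sqintB => //; exact: (H k).1].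
by move=> x _; rewrite mulN1r opprB.
Qed.

Let approx2D f g : approx2 f -> approx2 g -> approx2 (fun x => f x + g x).
Proof.
move=> [sf Hf] [sg Hg]; split; first exact: sqintD.
move=> e e0; have e4 : 0 < e / 4 by rewrite divr_gt0.
have [phi tp fp] := Hf _ e4; have [psi tq gp] := Hg _ e4.
exists (fun x => phi x + psi x); first exact: testD.
rewrite (@eq_nrm2 _ _ _ _ _ _ (fun x => (f x - phi x) + (g x - psi x))); last first.
  by move=> x _; rewrite opprD addrACA.
apply: (le_trans (nrm2D_le mO (sqintB mO sf (tsq tp)) (sqintB mO sg (tsq tq)))).
by lra.
Qed.

Let approx2Z (c : R) f : approx2 f -> approx2 (fun x => c * f x).
Proof.
move=> [sf Hf]; split; first exact: sqintZ.
move=> e e0; have c1 : 0 < c ^+ 2 + 1 by rewrite ltr_wpDl// sqr_ge0.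
have ec : 0 < e / (c ^+ 2 + 1) by rewrite divr_gt0.
have [phi tp fp] := Hf _ ec; exists (fun x => c * phi x); first exact: testZ.
rewrite (@eq_nrm2 _ _ _ _ _ _ (fun x => c * (f x - phi x))); last first.
  by move=> x _; rewrite mulrBr.
rewrite nrm2Z//; last by apply: sqintB => //; exact: tsq.
apply: (@le_trans _ _ ((c ^+ 2 + 1) * (e / (c ^+ 2 + 1)))); last first.
  by rewrite mulrCA mulfV ?gt_eqF// mulr1.
by apply: ler_pM => //; [exact: sqr_ge0|exact: nrm2_ge0|rewrite lerDl].
Qed.

Let approx2_sum (I : Type) (r : seq I) (F : I -> V -> R) :
  (forall k, approx2 (F k)) -> approx2 (fun x => \sum_(k <- r) F k x).
Proof.
move=> H; elim: r => [|k r IH].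
  by under eq_fun do rewrite big_nil; apply: approx2_test; exact: test_cst0.
by under eq_fun do rewrite big_cons; exact: approx2D.
Qed.

Let indic_sqint A : measurable A -> sqint (mu := leb) O (\1_A : V -> R).
Proof.
move=> mA; apply: (@sqint_bounded 1).
  exact: measurable_indic.
by move=> x _; rewrite indicE; case: (x \in A); rewrite ?normr1 ?normr0.
Qed.

Let indic_diff_le A B (x : V) : `|\1_A x - \1_B x| <= `|1 : R|.
Proof.
rewrite !indicE normr1; case: (x \in A); case: (x \in B) => /=;
  by rewrite ?subrr ?subr0 ?sub0r ?normrN ?normr1 ?normr0.
Qed.

Let sqint1 : sqint (mu := leb) O (fun=> 1).
Proof. by apply: (@sqint_bounded 1) => [|x _]; rewrite ?normr1//; exact: measurable_cst. Qed.

(** On [O] the indicator of [A] is that of the bounded open set [O] cap [A], whose cutoffs converge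
    to it pointwise and boundedly. *)
Let approx2_open A : open A -> approx2 (\1_A).
Proof.
move=> oA; have oOA : open (O `&` A) by exact: openI.
have [k kO] := bounded_setP bO.
have bOA : bounded_set (O `&` A).
  by apply: (@norm_bounded_set _ _ _ k%:R) => x [/kO].
have [C [_ [zeta [Hz z1]]]] := cutoff n_gt0 oOA bOA.
have tz m : test_function O (zeta m).
  by have [tz _ _ _] := Hz m; apply: test_sub tz; exact: subIsetl.
apply: (@approx2_cvg zeta).
- by apply: indic_sqint; exact: open_measurable_rV.
- by move=> m; exact: approx2_test.
apply: (@cvg2_dominated _ _ _ _ _ mO _ _ (fun=> 1)) => //.
- by move=> m; apply: measurable_funTS; exact: test_measurable (tz m).
- by apply: measurable_funTS; apply: measurable_indic; exact: open_measurable_rV.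
- move=> x Ox; rewrite indicE; have [/set_mem Ax|Ax] := boolP (x \in A).
    apply: cvg_near_cst; exact: z1.
  apply: cvg_near_cst; apply: nearW => m.
  have [tzm _ _ _] := Hz m; apply: (test0 tzm) => -[_ Ax'].
  by move: Ax; rewrite notin_setE.
- move=> m x Ox; rewrite indicE normr1.
  have [_ /(_ x)/andP[z0 z2] _ _] := Hz m.
  by case: (x \in A); rewrite /= ?subr0 ler_norml; apply/andP; split; lra.
Qed.

(** Dynkin induction from open sets. Complements use [1 - 1_A]; for a disjoint union the finite
    partial unions converge under the bound 1, which is square integrable because [O] is bounded. *)
Let approx2_indic A : measurable A -> approx2 (\1_A).
Proof.
move=> mA; have := mA; rewrite measurable_rV_openE; move: A {mA}.
apply: (dynkin_induction (P := fun A => approx2 (\1_A))).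
- exact: measurable_rV_openE.
- by move=> A B /= oA oB; exact: openI.
- by apply: approx2_open; exact: openT.
- by move=> A /= oA; exact: approx2_open.
- move=> A mA HA.
  have -> : \1_(~` A) = (fun x : V => \1_setT x + -1 * \1_A x : R).
    apply/funext => x; rewrite !indicE in_setC in_setT.
    by case: (x \in A) => /=; ring.
  by apply: approx2D; [apply: approx2_open; exact: openT|exact: approx2Z].
move=> F mF tF HF.
apply: (@approx2_cvg (fun N => \1_(\big[setU/set0]_(k < N) F k))).
- by apply: indic_sqint; exact: bigcupT_measurable.
- move=> N; elim: N => [|N IH].
    rewrite big_ord0 indic0; apply: approx2_test; exact: test_cst0.
  rewrite big_ord_recr/= (_ : \1_ _ = (fun x : V => \1_(\big[setU/set0]_(k < N) F k) x + \1_(F N) x : R)).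
    exact: approx2D.
  apply/funext => x; rewrite !indicE in_setU.
  have [xF|xF] := boolP (x \in F N); rewrite ?orbT ?orbF ?addr0//.
  rewrite (_ : x \in _ = false) ?add0r//; apply/negbTE; rewrite notin_setE.
  rewrite -bigcup_mkord => -[k /= kN Fk].
  move: tF => /trivIsetP/(_ k N I I); rewrite (ltn_eqF kN) => /(_ isT).
  by apply/eqP/set0P; exists x; split => //; exact: set_mem.
apply: (@cvg2_dominated _ _ _ _ _ mO _ _ (fun=> 1)) => //.
- by move=> N; apply: measurable_funTS; apply: measurable_indic; exact: bigsetU_measurable.
- by apply: measurable_funTS; apply: measurable_indic; exact: bigcupT_measurable.
move=> x Ox; apply: cvg_near_cst; rewrite !indicE.
have [/set_mem[k _ Fk]|nx] := boolP (x \in \bigcup_k F k).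
  exists k.+1 => // N /= kN; rewrite indicE mem_set//.
  by rewrite -bigcup_mkord; exists k.
apply: nearW => N; rewrite indicE (_ : x \in _ = false)//; apply/negbTE.
apply: contra nx => /set_mem; rewrite -bigcup_mkord => -[k _ Fk].
by apply/mem_set; exists k.
Qed.

Let approx2_ge0 f : sqint (mu := leb) O f -> measurable_fun setT f ->
  (forall x, 0 <= f x) -> approx2 f.
Proof.
move=> sf mf f0.
have mf' : measurable_fun setT (EFin \o f) by apply/measurable_EFinP.
pose g := nnsfun_approx measurableT mf'.
have gc (x : V) : (fun k => g k x) @ \oo --> f x.
  have := @cvg_nnsfun_approx _ _ _ _ measurableT _ mf' (fun y _ => f0 y) x I.
  by move=> /fine_cvg.
have gf k x : g k x <= f x.
  rewrite -(cvg_lim (@Rhausdorff R) (gc x)).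
  apply: (@nondecreasing_cvgn_le _ (fun k => g k x)); last by apply/cvg_ex; exists (f x); exact: gc.
  by move=> a b ab; have /lefP := nd_nnsfun_approx measurableT mf' ab; apply.
apply: (@approx2_cvg (fun k => g k)) => //.
  move=> k.
  rewrite (funext (fimfunE (g k))).
  under eq_fun do rewrite fsbig_finite//=.
  apply: approx2_sum => y; apply: approx2Z; apply: approx2_indic.
  exact: measurable_sfunP.
apply: (cvg2_dominated mO _ _ sf) => //.
- by move=> k; apply: measurable_funTS.
- exact: measurable_funTS.
- move=> k x _; rewrite (ger0_norm (f0 x)) distrC ger0_norm ?subr_ge0//.
  by rewrite gerBl.
Qed.

Lemma sqint_approx f : sqint (mu := leb) O f -> forall e : R, 0 < e ->
  exists2 phi, test_function O phi & nrm2 (mu := leb) O (fun x => f x - phi x) <= e.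
Proof.
move=> sf; pose h := f \_ O.
have hf x : O x -> h x = f x by move=> Ox; rewrite /h patchE mem_set.
have mh : measurable_fun setT h.
  exact: (measurable_restrictT f mO).1 sf.1.
have sh : sqint (mu := leb) O h by apply: eq_sqint sf => // x Ox; rewrite hf.
have sp (s : R) : `|s| = 1 -> approx2 (fun x => Num.max (s * h x) 0).
  move=> s1.
  have mm : measurable_fun setT (fun x => Num.max (s * h x) 0).
    apply: measurable_maxr; last exact: measurable_cst.
    by apply: measurable_funM => //; exact: measurable_cst.
  apply: approx2_ge0 => //; last by move=> x; rewrite le_max lexx orbT.
  apply: (@sqint_le _ _ _ _ _ _ (fun x => h x ^+ 2)) => //.
  - exact: measurable_funTS.
  - by case: sh.
  move=> x Ox; rewrite -[leRHS]real_normK ?num_real// -[`|h x|]mul1r -s1 -normrM.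
  rewrite lerXn2r ?nnegrE// ?le_max ?lexx ?orbT//.
  by rewrite ge_max ler_norm normr_ge0.
have [_ H] : approx2 h.
  have -> : h = fun x => Num.max (1 * h x) 0 + -1 * Num.max (-1 * h x) 0.
    apply/funext => x; rewrite mul1r !mulN1r; case: (leP 0 (h x)) => hx.
      by rewrite max_r ?oppr_le0// oppr0 addr0.
    by rewrite max_l ?oppr_ge0 1?ltW// opprK add0r.
  apply: approx2D; first by apply: sp; rewrite normr1.
  by apply: approx2Z; apply: sp; rewrite normrN normr1.
move=> e /H[phi tp hp]; exists phi => //.
by rewrite (le_trans _ hp)// (@eq_nrm2 _ _ _ _ _ _ (fun x => h x - phi x))// => x Ox; rewrite hf.
Qed.

(** Orthogonality to test functions that converge to [f] itself gives [nrm2 O f = 0] in the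
    limit. *)
Lemma test_orthogonal_ae0 f : sqint (mu := leb) O f ->
  (forall phi, test_function O phi -> \int[leb]_(x in O) (f x * phi x) = 0) ->
  {ae leb, forall x, O x -> f x = 0}.
Proof.
move=> sf H; apply: nrm2_eq0 => //.
have /choice[phi Hphi] (k : nat) : exists phi, test_function O phi /\
    nrm2 (mu := leb) O (fun x => f x - phi x) <= k.+1%:R^-1.
  by have [//|phi tp fp] := sqint_approx sf (_ : 0 < k.+1%:R^-1 :> R); exists phi.
have c : cvg2 (mu := leb) O phi f.
  apply/cvg2P => e e0; have := near_infty_natSinv_lt (PosNum e0).
  apply: filterS => k /= ke.
  rewrite (@eq_nrm2 _ _ _ _ _ _ (fun x => - 1 * (f x - phi k x))); last first.
    by move=> x _; rewrite mulN1r opprB.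
  have [tp fp] := Hphi k.
  rewrite nrm2Z//; last by apply: sqintB => //; exact: tsq.
  by rewrite sqrrN expr1n mul1r (le_trans fp)// ltW.
have := cvg2_Rintegral mO (fun k => tsq (Hphi k).1) sf sf c.
under eq_cvg => k.
  rewrite (@eq_Rintegral _ _ _ _ _ (fun x => f x * phi k x)); last by move=> x _; rewrite mulrC.
  rewrite H; last exact: (Hphi k).1.
  over.
move=> /cvg_lim; rewrite lim_cst// => /(_ (@Rhausdorff R)).
by rewrite /nrm2 => ->; apply: eq_Rintegral => x _; rewrite expr2.
Qed.

End bounded_open.

End density.

(** * Mollification *)

Section mollification.
Context {R : realType} {n : nat}.
Hypothesis n_gt0 : (0 < n)%N.
Local Notation V := 'rV[R]_n.
Local Notation dlt i := (delta_mx 0 i : V).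
Local Notation leb := (@lebesgue_rV R n).
Implicit Types (f g w phi : V -> R).

Lemma test_le_indic D phi : test_function D phi -> exists M : R, exists K : set V,
  [/\ 0 <= M, measurable K, bounded_set K & forall x, `|phi x| <= M * \1_K x].
Proof.
move=> tp; have [M M0 HM] := test_bounded tp; have [K [cK KD] HK] := testP tp.
exists M, K; split => //.
- by apply: closed_measurable_rV; apply: compact_closed => //; exact: norm_hausdorff.
- exact: compact_bounded.
- move=> x; rewrite indicE; have [/set_mem Kx|] := boolP (x \in K).
    by rewrite mulr1.
  by rewrite notin_setE => Kx; rewrite mulr0 (HK _ Kx) normr0.
Qed.

Lemma test_integrable D phi : test_function D phi ->
  leb.-integrable setT (EFin \o phi).
Proof.
move=> tp; have [M [K [M0 mK bK H]]] := test_le_indic tp.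
apply: le_integrable (integrable_indic_bounded M mK bK) => //.
  by apply/measurable_EFinP; exact: test_measurable tp.
by move=> x _; rewrite /= lee_fin (le_trans (H x))// ler_norm.
Qed.

Lemma Rintegral_zero_off (D : set V) f : (forall x, ~ D x -> f x = 0) ->
  \int[leb]_(x in setT) f x = \int[leb]_(x in D) f x.
Proof.
move=> H; rewrite [RHS]Rintegral_mkcond; apply: eq_Rintegral => x _.
by rewrite patchE; case: ifPn => //; rewrite notin_setE => /H ->.
Qed.

Lemma nrm2_zero_off (D : set V) f : (forall x, ~ D x -> f x = 0) ->
  nrm2 (mu := leb) setT f = nrm2 (mu := leb) D f.
Proof. by move=> H; apply: Rintegral_zero_off => x /H ->; rewrite expr0n. Qed.

Lemma ge0_integral_translateR (a : V) f : measurable_fun setT f -> (forall x, 0 <= f x) ->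
  (\int[leb]_x (f (a + x))%:E = \int[leb]_x (f x)%:E)%E.
Proof.
move=> mf f0; apply: (@ge0_integral_rV_translate R n a (EFin \o f)).
  exact/measurable_EFinP.
by move=> x; rewrite lee_fin.
Qed.

Lemma measurable_sub_rV : measurable_fun [set: V * V] (fun p => p.1 - p.2).
Proof.
apply: measurable_fun_coord => i.
under eq_fun do rewrite !mxE.
apply: measurable_funB.
  exact: (measurableT_comp (@measurable_coord _ R n i) measurable_fst).
exact: (measurableT_comp (@measurable_coord _ R n i) measurable_snd).
Qed.

(** Symmetry turns [rho (x - y)], as a function of [y], into a translate of [rho], so that its
    integral follows from translation invariance alone. *)
Record mollifier (e : R) (rho : V -> R) : Prop := Mollifier {
  mollifier_test : test_function setT rho ;
  mollifier_ge0 : forall x, 0 <= rho x ;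
  mollifier_sym : forall x, rho (- x) = rho x ;
  mollifier_supp : forall x, rho x != 0 -> `|x| <= e ;
  mollifier_int : (\int[leb]_x (rho x)%:E = 1)%E }.

Lemma mollifier_exists (e : R) : 0 < e -> exists rho, mollifier e rho.
Proof.
move=> e0; have [g [sg [g0 gp gle _ _]]] := @smooth_step_exists R.
pose q (x : V) := 1 - (e ^- 2) * \sum_i (x 0 i * x 0 i).
have sq : smooth q.
  apply: smoothB; first exact: smooth_cst.
  by apply: smoothZ; apply: smooth_sum => i; apply: smoothM; exact: smooth_coord.
pose r := g \o q; have sr : smooth r by exact: smooth_comp.
have e2 : 0 < e ^+ 2 by rewrite exprn_gt0.
have ge0 x : 0 <= g x by have [/g0 ->|/gp/ltW] := leP x 0.
have suppr x : r x != 0 -> `|x| <= e.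
  rewrite /r /= => rx; have qx : 0 < q x.
    by rewrite ltNge; apply/negP => /g0 H; rewrite H eqxx in rx.
  apply: norm_le_coord; first exact: ltW.
  move=> i; have : x 0 i * x 0 i <= e ^+ 2.
    have : \sum_j (x 0 j * x 0 j) < e ^+ 2.
      by move: qx; rewrite /q subr_gt0 mulrC ltr_pdivrMr// mul1r.
    move=> /ltW; apply: le_trans; rewrite (bigD1 i)//= lerDl.
    by apply: sumr_ge0 => j _; rewrite -expr2 sqr_ge0.
  rewrite -expr2 => h.
  by rewrite -(@ler_pXn2r _ 2) ?nnegrE ?(ltW e0)// real_normK ?num_real.
have tr : test_function setT r.
  apply: (@test_intro _ _ setT (closure [set x | r x != 0])) => //.
    apply: bounded_closed_compact; last exact: closed_closure.
    by apply: (@norm_bounded_set _ _ _ e); apply: closure_norm_le.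
  by move=> x H; apply: contrapT => /eqP z0; apply: H; exact: subset_closure.
have ir := test_integrable tr.
pose c := \int[leb]_(x in setT) r x.
have cE : (\int[leb]_x (r x)%:E = c%:E)%E.
  by rewrite /c /Rintegral fineK//; exact: integrable_fin_num.
have c0 : 0 < c.
  (* The mass is positive because on the cube of half-side [d] the argument of [g] is at least
     [1 - n / (n+1)^2], which is positive. *)
  pose d := e / n.+1%:R; have d0 : 0 < d by rewrite divr_gt0.
  pose A := [set y : V | forall i, - d < y 0 i < d].
  have mA : measurable A.
    apply: measurable_forall_ord => i.
    rewrite (_ : (fun _ => _) = (fun x : V => x 0 i) @^-1` `](- d), d[%classic).
      rewrite -[X in measurable X]setTI.
      by apply: (@measurable_coord _ R n i) => //; exact: measurable_itv.
    by apply/seteqP; split => x; rewrite /= in_itv.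
  have lA : (0 < leb A)%E := lebesgue_rV_cube_gt0 n d0.
  pose k := g (1 - n%:R / n.+1%:R ^+ 2).
  have k0 : 0 < k.
    apply: gp; rewrite subr_gt0 ltr_pdivrMr ?exprn_gt0// mul1r -natrX ltr_nat.
    by rewrite (@leq_ltn_trans (n.+1 * n))// ?leq_pmull// expnS expn1 ltn_mul2l/=.
  have kr y : A y -> k <= r y.
    move=> Ay; apply: gle; rewrite lerD2l lerN2.
    have -> : n%:R / n.+1%:R ^+ 2 = e ^- 2 * (n%:R * d ^+ 2).
      rewrite /d expr_div_n [RHS]mulrCA; congr (_ * _).
      by rewrite mulrA mulVf ?gt_eqF// mul1r.
    rewrite ler_wpM2l ?invr_ge0 ?(ltW e2)//.
    have -> : n%:R * d ^+ 2 = \sum_(i < n) d ^+ 2.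
      by rewrite sumr_const card_ord mulr_natl.
    apply: ler_sum => i _; rewrite -expr2 -real_normK ?num_real//.
    by rewrite lerXn2r ?nnegrE ?(ltW d0)// ltW// ltr_norml; exact: Ay.
  have H : (k%:E * leb A <= \int[leb]_x (r x)%:E)%E.
    rewrite -integral_cst//.
    apply: (@le_trans _ _ (\int[leb]_(x in A) (r x)%:E)%E).
      apply: ge0_le_integral => //.
      - by move=> x _; rewrite lee_fin ltW.
      - by apply: measurable_funTS; apply/measurable_EFinP; exact: test_measurable tr.
    apply: ge0_subset_integral => //.
    - by apply/measurable_EFinP; exact: test_measurable tr.
    - by move=> x _; rewrite lee_fin; exact: ge0.
  have : (0 < \int[leb]_x (r x)%:E)%E by apply: lt_le_trans H; rewrite mule_gt0.
  by rewrite cE lte_fin.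
exists (fun x => c^-1 * r x); split.
- exact: testZ.
- by move=> x; rewrite mulr_ge0 ?invr_ge0 ?(ltW c0)//; exact: ge0.
- move=> x; rewrite /r /q /=; congr (_ * g (_ - _ * _)).
  by apply: eq_bigr => i _; rewrite !mxE mulrNN.
- by move=> x; rewrite mulf_eq0 negb_or => /andP[_ /suppr].
- under eq_integral do rewrite EFinM.
  rewrite ge0_integralZl//.
  + by rewrite cE -EFinM mulVf// gt_eqF.
  + by apply/measurable_EFinP; exact: test_measurable tr.
  + by move=> x _; rewrite lee_fin; exact: ge0.
  + by rewrite lee_fin invr_ge0 ltW.
Qed.

Section kernel.
Variables (e : R) (rho : V -> R).
Hypothesis H : mollifier e rho.

Let mrho : measurable_fun setT rho.
Proof. exact: test_measurable (mollifier_test H). Qed.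

Let rho_sub x y : rho (x - y) = rho (- x + y).
Proof. by rewrite -(mollifier_sym H) opprB addrC. Qed.

Let msub : measurable_fun [set: V * V] (fun p => rho (p.1 - p.2)).
Proof. exact: measurableT_comp mrho measurable_sub_rV. Qed.

Let msub1 x : measurable_fun [set: V] (fun y => rho (x - y)).
Proof. exact: (measurable_fun_pair2 x msub). Qed.

Let msub2 y : measurable_fun [set: V] (fun x => rho (x - y)).
Proof. exact: (measurable_fun_pair1 y msub). Qed.

Lemma mollifier_int1 x : (\int[leb]_y (rho (x - y))%:E = 1)%E.
Proof.
under eq_integral do rewrite rho_sub.
by rewrite ge0_integral_translateR//; [exact: mollifier_int H|exact: mollifier_ge0 H].
Qed.

Lemma mollifier_int2 y : (\int[leb]_x (rho (x - y))%:E = 1)%E.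
Proof.
under eq_integral do rewrite addrC.
by rewrite ge0_integral_translateR//; [exact: mollifier_int H|exact: mollifier_ge0 H].
Qed.

Lemma mollifier_tonelli2 g : measurable_fun setT g -> (forall x, 0 <= g x) ->
  (\int[leb]_x \int[leb]_y (rho (x - y) * g y)%:E = \int[leb]_y (g y)%:E)%E.
Proof.
move=> mg g0.
have mm : measurable_fun [set: V * V] (fun p => (rho (p.1 - p.2) * g p.2)%:E).
  apply/measurable_EFinP; apply: measurable_funM => //.
  exact: measurableT_comp mg measurable_snd.
rewrite (@fubini_tonelli _ _ _ _ R leb leb (fun p => (rho (p.1 - p.2) * g p.2)%:E))//; last first.
  by move=> p; rewrite lee_fin mulr_ge0// (mollifier_ge0 H).
apply: eq_integral => y _ /=.
under eq_integral do rewrite mulrC EFinM.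
rewrite ge0_integralZl//; last 3 first.
- exact/measurable_EFinP.
- by move=> x _; rewrite lee_fin (mollifier_ge0 H).
- by rewrite lee_fin.
by rewrite mollifier_int2 mule1.
Qed.

Lemma mollifier_tonelli1 g : measurable_fun setT g -> (forall x, 0 <= g x) ->
  (\int[leb]_x \int[leb]_y (rho (x - y) * g x)%:E = \int[leb]_x (g x)%:E)%E.
Proof.
move=> mg g0; apply: eq_integral => x _.
under eq_integral do rewrite mulrC EFinM.
rewrite ge0_integralZl//; last 3 first.
- exact/measurable_EFinP.
- by move=> y _; rewrite lee_fin (mollifier_ge0 H).
- by rewrite lee_fin.
by rewrite mollifier_int1 mule1.
Qed.

(** Bounds the squared L^2 distance from [w] to its mollification, by Jensen's inequality. No
    convolution occurs in it, and it is subadditive up to a factor 2, so the two parts of a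
    decomposition of [w] can be estimated separately. *)
Definition oscillation w : \bar R :=
  (\int[leb]_x \int[leb]_y (rho (x - y) * (w y - w x) ^+ 2)%:E)%E.

Let mosc (k : V * V -> R) : measurable_fun setT k -> (forall p, 0 <= k p) ->
  measurable_fun setT (fun x => \int[leb]_y (k (x, y))%:E)%E.
Proof.
move=> mk k0.
apply: (@measurable_fun_fubini_tonelli_F _ _ _ _ R leb (EFin \o k)).
  exact/measurable_EFinP.
by move=> p; rewrite lee_fin.
Qed.

Let double_le (k1 k2 : V * V -> R) : measurable_fun setT k1 -> measurable_fun setT k2 ->
  (forall p, 0 <= k1 p) -> (forall p, k1 p <= k2 p) ->
  (\int[leb]_x \int[leb]_y (k1 (x, y))%:E <= \int[leb]_x \int[leb]_y (k2 (x, y))%:E)%E.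
Proof.
move=> m1 m2 p1 p12; have p2 p : 0 <= k2 p := le_trans (p1 p) (p12 p).
apply: ge0_le_integral => //.
- by move=> x _; apply: integral_ge0 => y _; rewrite lee_fin.
- exact: mosc.
- exact: mosc.
move=> x _; apply: ge0_le_integral => //.
- by move=> y _; rewrite lee_fin.
- by apply/measurable_EFinP; exact: (measurable_fun_pair2 x m1).
- by apply/measurable_EFinP; exact: (measurable_fun_pair2 x m2).
- by move=> y _; rewrite lee_fin.
Qed.

Let double_add (k1 k2 : V * V -> R) (c : R) : 0 <= c ->
  measurable_fun setT k1 -> measurable_fun setT k2 ->
  (forall p, 0 <= k1 p) -> (forall p, 0 <= k2 p) ->
  (\int[leb]_x \int[leb]_y (c * (k1 (x, y) + k2 (x, y)))%:E =
   c%:E * (\int[leb]_x \int[leb]_y (k1 (x, y))%:E + \int[leb]_x \int[leb]_y (k2 (x, y))%:E))%E.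
Proof.
move=> c0 m1 m2 p1 p2.
have mp (k : V * V -> R) x : measurable_fun setT k ->
    measurable_fun setT (fun y => (k (x, y))%:E).
  by move=> mk; apply/measurable_EFinP; exact: (measurable_fun_pair2 x mk).
transitivity (\int[leb]_x (c%:E * (\int[leb]_y (k1 (x, y))%:E + \int[leb]_y (k2 (x, y))%:E)))%E.
  apply: eq_integral => x _.
  rewrite -ge0_integralD//; [|by move=> y _; rewrite lee_fin|exact: mp|by move=> y _; rewrite lee_fin|exact: mp].
  rewrite -ge0_integralZl//.
    by apply: emeasurable_funD; exact: mp.
  by move=> y _; rewrite -EFinD lee_fin addr_ge0.
rewrite ge0_integralZl//; last 2 first.
- by apply: emeasurable_funD; exact: mosc.
- by move=> x _; rewrite adde_ge0//; apply: integral_ge0 => y _; rewrite lee_fin.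
rewrite ge0_integralD//.
- by move=> x _; apply: integral_ge0 => y _; rewrite lee_fin.
- exact: mosc.
- by move=> x _; apply: integral_ge0 => y _; rewrite lee_fin.
- exact: mosc.
Qed.

Let mkern w : measurable_fun setT w ->
  measurable_fun [set: V * V] (fun p => rho (p.1 - p.2) * (w p.2 - w p.1) ^+ 2).
Proof.
move=> mw; apply: measurable_funM => //; apply: measurable_funX.
by apply: measurable_funB; [exact: measurableT_comp mw measurable_snd|
  exact: measurableT_comp mw measurable_fst].
Qed.

Lemma oscillation_add w1 w2 : measurable_fun setT w1 -> measurable_fun setT w2 ->
  (oscillation (fun x => (w1 x + w2 x)%R) <= 2%:E * (oscillation w1 + oscillation w2))%E.
Proof.
move=> m1 m2; rewrite /oscillation.
rewrite -(@double_add (fun p => rho (p.1 - p.2) * (w1 p.2 - w1 p.1) ^+ 2)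
  (fun p => rho (p.1 - p.2) * (w2 p.2 - w2 p.1) ^+ 2) 2)//; try exact: mkern;
  try by move=> p; rewrite mulr_ge0 ?sqr_ge0 ?(mollifier_ge0 H).
apply: (@double_le (fun p => rho (p.1 - p.2) * ((w1 p.2 + w2 p.2) - (w1 p.1 + w2 p.1)) ^+ 2)
  (fun p => 2 * (rho (p.1 - p.2) * (w1 p.2 - w1 p.1) ^+ 2 + rho (p.1 - p.2) * (w2 p.2 - w2 p.1) ^+ 2))).
- by apply: (mkern (w := fun x => w1 x + w2 x)); exact: measurable_funD.
- apply: measurable_funM; first exact: measurable_cst.
  by apply: measurable_funD; exact: mkern.
- by move=> p; rewrite mulr_ge0 ?sqr_ge0 ?(mollifier_ge0 H).
- move=> p; rewrite -mulrDr [leRHS]mulrCA ler_wpM2l ?(mollifier_ge0 H)//.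
  set a := w1 p.2 - w1 p.1; set b := w2 p.2 - w2 p.1.
  have -> : w1 p.2 + w2 p.2 - (w1 p.1 + w2 p.1) = a + b by rewrite /a /b; ring.
  by have := sqr_ge0 (a - b); rewrite !expr2; nra.
Qed.

(** The kernel has mass 1 in each variable, so [G x] and [G y] each contribute the integral of [G],
    hence the factor 2. The choices of use are the square of a small remainder and, for a Lipschitz
    function of compact support, an indicator. *)
Lemma oscillation_dominated w (c : R) (G : V -> R) : 0 <= c ->
  measurable_fun setT w -> measurable_fun setT G -> (forall x, 0 <= G x) ->
  (forall x y, `|x - y| <= e -> (w y - w x) ^+ 2 <= c * (G x + G y)) ->
  (oscillation w <= (2 * c)%:E * \int[leb]_x (G x)%:E)%E.
Proof.
move=> c0 mw mG G0 D.
have mG1 : measurable_fun [set: V * V] (fun p => rho (p.1 - p.2) * G p.1).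
  by apply: measurable_funM => //; exact: measurableT_comp mG measurable_fst.
have mG2 : measurable_fun [set: V * V] (fun p => rho (p.1 - p.2) * G p.2).
  by apply: measurable_funM => //; exact: measurableT_comp mG measurable_snd.
have p1 (p : V * V) : 0 <= rho (p.1 - p.2) * G p.1 by rewrite mulr_ge0// (mollifier_ge0 H).
have p2 (p : V * V) : 0 <= rho (p.1 - p.2) * G p.2 by rewrite mulr_ge0// (mollifier_ge0 H).
have := double_add c0 mG1 mG2 p1 p2.
rewrite /= mollifier_tonelli1// mollifier_tonelli2// => E.
apply: (@le_trans _ _ (\int[leb]_x \int[leb]_y (c * (rho (x - y) * G x + rho (x - y) * G y))%:E)%E).
  apply: (@double_le (fun p => rho (p.1 - p.2) * (w p.2 - w p.1) ^+ 2)
    (fun p => c * (rho (p.1 - p.2) * G p.1 + rho (p.1 - p.2) * G p.2))).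
  - exact: mkern.
  - by apply: measurable_funM; [exact: measurable_cst|exact: measurable_funD].
  - by move=> p; rewrite mulr_ge0 ?sqr_ge0 ?(mollifier_ge0 H).
  - move=> p; have [->|r0] := eqVneq (rho (p.1 - p.2)) 0; first by rewrite !mul0r addr0 mulr0.
    rewrite -mulrDr [leRHS]mulrCA ler_wpM2l ?(mollifier_ge0 H)//.
    by apply: D; exact: mollifier_supp r0.
rewrite E mulrC EFinM -muleA lee_wpmul2l ?lee_fin//.
have -> : (2%:E = 1%:E + 1%:E :> \bar R)%E by rewrite -EFinD.
by rewrite ge0_muleDl ?mul1e// lee_fin.
Qed.

Definition mollify w (x : V) : R := \int[leb]_(y in setT) (w y * rho (x - y)).

(** Jensen's inequality for the probability density [rho (x - y)]: with [m] the mean of [w], the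
    second moment about [w x] is the variance plus [(m - w x)^2], and the variance is
    nonnegative. *)
Lemma mollify_sq_le w x : sqint (mu := leb) setT w ->
  (((mollify w x - w x) ^+ 2)%:E <= \int[leb]_y (rho (x - y) * (w y - w x) ^+ 2)%:E)%E.
Proof.
move=> sw; have [mw wi] := sw.
have tr : test_function setT (fun y => rho (x - y)).
  have := test_affine x (_ : (-1 : R) != 0) (mollifier_test H).
  by under eq_fun do rewrite scaleN1r; apply; rewrite oppr_eq0 oner_neq0.
have [M M0 HM] := test_bounded (mollifier_test H).
have ip : leb.-integrable setT (EFin \o (fun y => rho (x - y))) by exact: test_integrable tr.
have iwp : leb.-integrable setT (EFin \o (fun y => w y * rho (x - y))).
  by apply: sqint_mul => //; exact: test_sqint tr.
have iwwp : leb.-integrable setT (EFin \o (fun y => w y ^+ 2 * rho (x - y))).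
  apply: le_integrable (integrableZ_EFin measurableT M wi) => //.
    by apply/measurable_EFinP; apply: measurable_funM => //; exact: measurable_funX.
  move=> y _; rewrite /= lee_fin !normrM mulrC ler_wpM2r// (le_trans (HM _))//.
  exact: ler_norm.
have int1 : \int[leb]_(y in setT) rho (x - y) = 1 by rewrite /Rintegral mollifier_int1.
pose m := mollify w x.
have J (a : R) : \int[leb]_(y in setT) (rho (x - y) * (w y - a) ^+ 2) =
    \int[leb]_(y in setT) (w y ^+ 2 * rho (x - y)) - 2 * a * m + a ^+ 2 /\
    leb.-integrable setT (EFin \o (fun y => rho (x - y) * (w y - a) ^+ 2)).
  have Ef : (fun y => rho (x - y) * (w y - a) ^+ 2) =
     (fun y => (w y ^+ 2 * rho (x - y) - (2 * a) * (w y * rho (x - y))) + a ^+ 2 * rho (x - y)).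
    by apply/funext => y; ring.
  have i1 := integrableZ_EFin measurableT (2 * a) iwp.
  have i2 := integrableZ_EFin measurableT (a ^+ 2) ip.
  have i3 := integrableB_EFin measurableT iwwp i1.
  rewrite Ef; split; last exact: integrableD_EFin.
  by rewrite RintegralD// RintegralB// !RintegralZl// int1 mulr1.
have [E1 I1] := J (w x); have [E2 _] := J m.
have p0 : 0 <= \int[leb]_(y in setT) (rho (x - y) * (w y - m) ^+ 2).
  by apply: Rintegral_ge0 => y _; rewrite mulr_ge0 ?sqr_ge0 ?(mollifier_ge0 H).
have -> : (\int[leb]_y (rho (x - y) * (w y - w x) ^+ 2)%:E =
   (\int[leb]_(y in setT) (rho (x - y) * (w y - w x) ^+ 2))%:E)%E.
  by rewrite /Rintegral fineK//; exact: integrable_fin_num.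
rewrite lee_fin E1; move: p0; rewrite E2 -/m.
by rewrite !expr2; nra.
Qed.

Lemma mollify_nrm2_le w : sqint (mu := leb) setT w -> measurable_fun setT (mollify w) ->
  (\int[leb]_x ((mollify w x - w x) ^+ 2)%:E <= oscillation w)%E.
Proof.
move=> sw mm; have [mw _] := sw; apply: ge0_le_integral => //.
- by move=> x _; rewrite lee_fin sqr_ge0.
- by apply: measurable_sq; exact: measurable_funB.
- apply: (mosc (mkern mw)) => p.
  by rewrite mulr_ge0 ?sqr_ge0 ?(mollifier_ge0 H).
- by move=> x _; exact: mollify_sq_le.
Qed.

End kernel.

End mollification.

(** * Convolution with test functions and approximation in H^1 *)

Section smoothing.
Context {R : realType} {n : nat}.
Hypothesis n_gt0 : (0 < n)%N.
Local Notation V := 'rV[R]_n.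
Local Notation dlt i := (delta_mx 0 i : V).
Local Notation leb := (@lebesgue_rV R n).
Implicit Types (f g w v phi : V -> R).

Lemma test_sub_right phi (x : V) : test_function setT phi ->
  test_function setT (fun y => phi (x - y)).
Proof.
move=> tp; have := test_affine x (_ : (-1 : R) != 0) tp.
by under eq_fun do rewrite scaleN1r; apply; rewrite oppr_eq0 oner_neq0.
Qed.

Lemma partial_sub_right phi (x y : V) i : test_function setT phi ->
  partial i (fun y => phi (x - y)) y = - partial i phi (x - y).
Proof.
move=> /test_smooth sp; apply: partialE.
have := is_derive_affine x y (-1) i sp.
under eq_fun do rewrite scaleN1r.
by rewrite scaleN1r mulN1r.
Qed.

Section convolution.
Variable w : V -> R.
Hypothesis iw : leb.-integrable setT (EFin \o w).

Let mw : measurable_fun setT w.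
Proof. by have /measurable_int/measurable_EFinP := iw. Qed.

Definition convolution phi (x : V) : R := \int[leb]_(y in setT) (w y * phi (x - y)).

Let conv_integrable phi x : test_function setT phi ->
  leb.-integrable setT (EFin \o (fun y => w y * phi (x - y))).
Proof.
move=> tp; have [M M0 HM] := test_bounded tp.
apply: le_integrable (integrableZ_EFin measurableT M iw) => //.
  apply/measurable_EFinP; apply: measurable_funM => //.
  exact: test_measurable (test_sub_right x tp).
by move=> y _; rewrite /= lee_fin !normrM mulrC ler_wpM2r// (le_trans (HM _))// ler_norm.
Qed.

Let conv_continuous phi : test_function setT phi -> continuous (convolution phi).
Proof.
move=> tp; have [L L0 HL] := test_lipschitz tp.
pose W := \int[leb]_(y in setT) `|w y|.
have W0 : 0 <= W by apply: Rintegral_ge0.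
have lip x x' : `|convolution phi x - convolution phi x'| <= (L * W + 1) * `|x - x'|.
  rewrite /convolution -RintegralB//; [|exact: conv_integrable..].
  have i1 := integrableB_EFin measurableT (conv_integrable x tp) (conv_integrable x' tp).
  apply: (le_trans (le_normr_Rintegral measurableT i1)).
  have i2 := integrable_norm iw.
  apply: (@le_trans _ _ (\int[leb]_(y in setT) (L * `|x - x'| * `|w y|))).
    apply: le_Rintegral => //; first exact: integrable_norm.
      exact: integrableZ_EFin.
    move=> y _; rewrite -mulrBr normrM mulrC ler_wpM2r//.
    by rewrite (le_trans (HL _ _))// opprB addrA subrK.
  by rewrite RintegralZl// -/W mulrAC ler_wpM2r// lerDl.
move=> x; apply/(@cvgrPdist_le _ _ _ (nbhs (x : V))) => e e0.
have k0 : 0 < L * W + 1 by rewrite ltr_wpDl// mulr_ge0.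
apply/near_normP; exists (e / (L * W + 1)); first by rewrite divr_gt0.
move=> y xy; rewrite (le_trans (lip _ _))// mulrC -ler_pdivlMr//.
exact: ltW.
Qed.

Let conv_is_derive phi x i : test_function setT phi ->
  is_derive x (dlt i) (convolution phi) (convolution (partial i phi) x).
Proof.
move=> tp; apply/is_derive_line.
pose f (t : R) (y : V) := w y * phi (t *: dlt i + x - y).
have sp := test_smooth tp.
have D (t : R) y : is_derive t 1 (f ^~ y) (w y * partial i phi (t *: dlt i + x - y)).
  have D1 : is_derive t 1 (fun t : R => phi (t *: dlt i + x - y))
      (partial i phi (t *: dlt i + x - y)).
    rewrite (_ : (fun t : R => _) = fun t : R => phi (t *: dlt i + (x - y))).
      by rewrite -addrA; apply: is_derive_line_at; exact: smooth_is_derive.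
    by apply/funext => s; rewrite addrA.
  exact: (is_deriveZ (w y) D1).
have [M M0 HM] := test_bounded (test_partial i tp).
have I0 : (`]-1, 1[%classic : set R) 0 by rewrite /= in_itv/= oppr_lt0 ltr01.
have int1 (t : R) : `]-1, 1[%classic t -> leb.-integrable setT (EFin \o f t).
  by move=> _; exact: conv_integrable.
have der1 (t : R) (y : V) : (`]-1, 1[%classic : set R) t -> setT y -> derivable (f ^~ y) t 1.
  by move=> _ _; have [] := D t y.
have E (t : R) y : partial1of2 f t y = w y * partial i phi (t *: dlt i + x - y).
  by rewrite partial1of2E; have [_ ->] := D t y.
have G0 y : 0 <= M * `|w y| by rewrite mulr_ge0.
have iG : leb.-integrable setT (EFin \o (fun y => M * `|w y|)).
  by apply: integrableZ_EFin => //; exact: integrable_norm.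
have ub (t : R) (y : V) : (`]-1, 1[%classic : set R) t -> setT y -> `|partial1of2 f t y| <= M * `|w y|.
  by move=> _ _; rewrite E normrM mulrC ler_wpM2r.
have d1 := derivable_under_integral measurableT I0 int1 der1 G0 iG ub.
have d2 := differentiation_under_integral measurableT I0 int1 der1 G0 iG ub.
apply: DeriveDef => //.
rewrite -derive1E d2; apply: eq_Rintegral => y _ /=.
by rewrite E scale0r add0r.
Qed.

Lemma convolution_smooth phi : test_function setT phi -> smooth (convolution phi).
Proof.
move=> tp; apply: (@smooth_class _ _ (fun f => exists2 phi, test_function setT phi & f = convolution phi));
  last by exists phi.
move=> _ [{tp}phi tp ->]; split; first exact: conv_continuous.
move=> i; split=> [x|]; first by have [] := conv_is_derive x i tp.
exists (partial i phi); first exact: test_partial.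
by apply/funext => x; apply: partialE; exact: conv_is_derive.
Qed.

Lemma convolution_partial phi i x : test_function setT phi ->
  partial i (convolution phi) x = convolution (partial i phi) x.
Proof. by move=> tp; apply: partialE; exact: conv_is_derive. Qed.

End convolution.

(** Tested on the whole space: for a function that vanishes off [O], this excludes a contribution of
    the boundary of [O], and it allows translated kernels as test functions. *)
Definition global_wderiv i v w := forall phi, test_function setT phi ->
  \int[leb]_(x in setT) (v x * partial i phi x) =
  - \int[leb]_(x in setT) (w x * phi x).

(** The test function is [y |-> phi (x - y)], whose derivative has a minus sign that cancels the one
    of integration by parts. *)
Lemma convolution_wderiv i v w phi x : global_wderiv i v w ->
  sqint (mu := leb) setT v -> sqint (mu := leb) setT w ->
  test_function setT phi ->
  convolution v (partial i phi) x = convolution w phi x.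
Proof.
move=> H sv sw tp; apply: oppr_inj.
have E : \int[leb]_(y in setT) (v y * partial i (fun y => phi (x - y)) y) =
    - convolution v (partial i phi) x.
  rewrite /convolution -mulN1r -RintegralZl//; last first.
    exact: (sqint_mul measurableT sv (test_sqint (test_sub_right x (test_partial i tp)))).
  by apply: eq_Rintegral => y _; rewrite partial_sub_right// mulN1r mulrN.
by rewrite -E (H _ (test_sub_right x tp)).
Qed.

Section inner.
Variable O : set V.
Hypothesis oO : open O.
Hypothesis bO : bounded_set O.

Let mO : measurable O. Proof. exact: open_measurable_rV. Qed.

Lemma sqint_integrable v : sqint (mu := leb) setT v -> (forall x, ~ O x -> v x = 0) ->
  leb.-integrable setT (EFin \o v).
Proof.
move=> sv v0.
have s1 : sqint (mu := leb) setT (\1_O : V -> R).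
  split; first exact: measurable_indic.
  apply: eq_integrable (integrable_indic_bounded 1 mO bO) => // x _ /=.
  by rewrite indicE; case: (x \in O); rewrite ?expr1n ?expr0n ?mul1r.
apply: eq_integrable (sqint_mul measurableT sv s1) => // x _ /=.
rewrite indicE; have [xO|] := boolP (x \in O); first by rewrite mulr1.
by rewrite notin_setE => /v0 ->; rewrite mul0r.
Qed.

(** By density [w] is a test function [phi] plus a small remainder [g]. The oscillation of [g] is at
    most 4 times its squared norm, hence the 32; that of [phi] is of order [e^2]. Each is made at
    most [eta / 8]. *)
Lemma mollify_cvg w : sqint (mu := leb) setT w -> (forall x, ~ O x -> w x = 0) ->
  forall eta : R, 0 < eta -> \forall k \near \oo, forall rho,
  mollifier (k.+1%:R^-1) rho ->
  nrm2 (mu := leb) setT (fun x => mollify rho w x - w x) <= eta.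
Proof.
move=> sw w0 eta eta0.
have iw := sqint_integrable sw w0.
have sO := sqintS mO measurableT (subsetT O) sw.
have eta32 : 0 < eta / 32 by rewrite divr_gt0.
have [phi tp Hphi] := sqint_approx n_gt0 oO bO sO eta32.
have tpT := test_subT tp.
pose g x := w x - phi x.
have sp := test_sqint tp.
have sg : sqint (mu := leb) setT g by exact: sqintB.
have ng : nrm2 (mu := leb) setT g <= eta / 32.
  by rewrite (@nrm2_zero_off _ _ O)// => x Ox; rewrite /g w0// (test0 tp Ox) subrr.
have [M [K [M0 mK bK HK]]] := test_le_indic tp.
have [L L0 HL] := test_lipschitz tp.
pose kK := fine (leb K).
have kKE : leb K = kK%:E.
  by rewrite /kK fineK// ge0_fin_numE//; exact: lebesgue_rV_bounded.
have kK0 : 0 <= kK by rewrite fine_ge0.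
(* The oscillation of [phi] is at most [2 * (L * e)^2 * kK]; as [e^2 <= e], scales below this number
   make it at most [eta / 8]. *)
have q0 : 0 < eta / (8 * (2 * L ^+ 2 * kK + 1)).
  by rewrite divr_gt0// mulr_gt0// ltr_wpDl// !mulr_ge0// sqr_ge0.
have := near_infty_natSinv_lt (PosNum q0); apply: filterS => k /= kq rho Hrho.
pose e : R := k.+1%:R^-1.
have e0 : 0 < e by rewrite invr_gt0.
have e1 : e <= 1 by rewrite invf_le1// ler1n.
have [[[mg _] [mp _]] [mw _]] := (sg, sp, sw).
have oscg : (oscillation rho g <= (eta / 8)%:E)%E.
  apply: (@le_trans _ _ ((2 * 2)%:E * \int[leb]_x (g x ^+ 2)%:E)%E).
    apply: (oscillation_dominated Hrho) => //.
    - exact: measurable_funX.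
    - by move=> x; exact: sqr_ge0.
    - by move=> x y _; have := sqr_ge0 (g x + g y); rewrite !expr2; nra.
  by rewrite nrm2E// -EFinM lee_fin; lra.
have oscp : (oscillation rho phi <= (eta / 8)%:E)%E.
  apply: (@le_trans _ _ ((2 * (L * e) ^+ 2)%:E * \int[leb]_x (\1_K x)%:E)%E).
    apply: (oscillation_dominated Hrho) => //.
    - exact: sqr_ge0.
    - move=> x y xy.
      (* Either [x] or [y] lies in [K] and the sum of the two indicators is at least 1, or both
         values of [phi] vanish. *)
      have H0 z : z \notin K -> phi z = 0.
        move=> zK; apply/eqP; rewrite -normr_le0 (le_trans (HK z))// indicE.
        by rewrite (negbTE zK) mulr0.
      have HLe : (phi y - phi x) ^+ 2 <= (L * e) ^+ 2.
        rewrite -real_normK ?num_real// lerXn2r ?nnegrE// ?mulr_ge0 ?(ltW e0)//.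
        by rewrite (le_trans (HL _ _))// distrC ler_wpM2l.
      rewrite !indicE.
      have [xK|xK] := boolP (x \in K); have [yK|yK] := boolP (y \in K) => /=.
      + by rewrite (le_trans HLe)// ler_peMr ?sqr_ge0// lerDl.
      + by rewrite addr0 mulr1.
      + by rewrite add0r mulr1.
      + by rewrite (H0 _ xK) (H0 _ yK) subrr expr0n addr0 mulr0.
  have -> : (\int[leb]_x (\1_K x)%:E = kK%:E)%E.
    by rewrite integral_indic// setIT; exact: kKE.
  rewrite -EFinM lee_fin exprMn.
  have ee : e ^+ 2 <= e by rewrite expr2 ler_piMl// ltW.
  have B0 : 0 <= 2 * L ^+ 2 * kK by rewrite !mulr_ge0// sqr_ge0.
  have -> : 2 * (L ^+ 2 * e ^+ 2) * kK = (2 * L ^+ 2 * kK) * e ^+ 2 by ring.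
  apply: (le_trans (ler_wpM2l B0 ee)).
  apply: (le_trans (ler_wpM2l B0 (ltW kq))).
  set b := 2 * L ^+ 2 * kK in B0 *.
  have b1 : 0 < b + 1 by rewrite ltr_wpDl.
  have -> : b * (eta / (8 * (b + 1))) = (eta / 8) * (b / (b + 1)).
    by field; rewrite gt_eqF.
  rewrite ler_piMr//; first by rewrite divr_ge0// ltW.
  by rewrite ler_pdivrMr// mul1r lerDl.
have smol : smooth (mollify rho w).
  exact: convolution_smooth iw _ (mollifier_test Hrho).
have mmol : measurable_fun setT (mollify rho w).
  by apply: continuous_measurable_rV; exact: smooth_cont.
have := mollify_nrm2_le Hrho sw mmol.
have Ew : w = (fun x => g x + phi x) by apply/funext => x; rewrite /g subrK.
have osc : (oscillation rho w <= (eta / 2)%:E)%E.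
  rewrite Ew; apply: (le_trans (oscillation_add Hrho mg mp)).
  apply: (@le_trans _ _ (2%:E * ((eta / 8)%:E + (eta / 8)%:E))%E).
    by rewrite lee_wpmul2l ?lee_fin// leeD.
  by rewrite -EFinD -EFinM lee_fin; lra.
move=> H; have {}H := le_trans H osc.
rewrite -lee_fin -nrm2E//; last first.
  apply/sqintP => //; first exact: measurable_funB.
  by rewrite (le_lt_trans H)// ltry.
by rewrite (le_trans H)// lee_fin; lra.
Qed.

(** A kernel of radius less than the distance from the closure of [O] to the complement of [U] keeps
    the support in [U]. One kernel serves for [v] and all the [w i], because the partial derivatives
    of the mollified [v] are the mollified [w i]. *)
Lemma inner_approx (U : set V) v (w : 'I_n -> V -> R) :
  open U -> closure O `<=` U ->
  sqint (mu := leb) setT v -> (forall i, sqint (mu := leb) setT (w i)) ->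
  (forall x, ~ O x -> v x = 0) -> (forall i x, ~ O x -> w i x = 0) ->
  (forall i, global_wderiv i v (w i)) ->
  forall eta : R, 0 < eta -> exists h, [/\ test_function setT h,
    forall x, ~ U x -> h x = 0,
    nrm2 (mu := leb) setT (fun x => h x - v x) <= eta &
    forall i, nrm2 (mu := leb) setT (fun x => partial i h x - w i x) <= eta].
Proof.
move=> oU OU sv sw v0 w0 Hw eta eta0.
have [kO HkO] := bounded_setP bO.
have cO : compact (closure O).
  apply: bounded_closed_compact; last exact: closed_closure.
  exact: norm_bounded_set (closure_norm_le HkO).
have [d d0 Hd] := compact_sub_open cO oU OU.
have N1 := mollify_cvg sv v0 eta0.
have N2 : \forall k \near \oo, forall i rho, mollifier (k.+1%:R^-1) rho ->
    nrm2 (mu := leb) setT (fun x => mollify rho (w i) x - w i x) <= eta.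
  by apply: filter_forall => i; exact: mollify_cvg (sw i) (w0 i) _ eta0.
have N3 := near_infty_natSinv_lt (PosNum d0).
have [k [H1 H2 H3]] : exists k : nat, [/\ forall rho, mollifier (k.+1%:R^-1) rho ->
    nrm2 (mu := leb) setT (fun x => mollify rho v x - v x) <= eta,
    forall i rho, mollifier (k.+1%:R^-1) rho ->
    nrm2 (mu := leb) setT (fun x => mollify rho (w i) x - w i x) <= eta &
    k.+1%:R^-1 < d].
  near \oo => k; exists k; split; [near: k; exact: N1|near: k; exact: N2|near: k; exact: N3].
have ek : 0 < k.+1%:R^-1 :> R by rewrite invr_gt0.
have [rho Hrho] := @mollifier_exists R n _ ek.
have iv := sqint_integrable sv v0.
have tr := mollifier_test Hrho.
have supp x : mollify rho v x != 0 -> exists2 y, O y & `|y - x| <= k.+1%:R^-1.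
  move=> mx; apply: contrapT => nH; move: mx; apply/negP; rewrite negbK.
  rewrite /mollify (@eq_Rintegral _ _ _ _ _ (fun=> 0)); first by rewrite Rintegral_cst// mul0r.
  move=> y _; have [Oy|/v0 ->] := pselect (O y); last by rewrite mul0r.
  have [->|/(mollifier_supp Hrho) xy] := eqVneq (rho (x - y)) 0; first by rewrite mulr0.
  by exfalso; apply: nH; exists y => //; rewrite distrC.
exists (mollify rho v); split.
- apply: (@test_intro _ _ setT (closure [set x | mollify rho v x != 0])) => //.
  + exact: convolution_smooth.
  + apply: bounded_closed_compact; last exact: closed_closure.
    apply: (@norm_bounded_set _ _ _ (kO%:R + 1)); apply: closure_norm_le => x /supp[y Oy xy].
    have -> : x = y - (y - x) by rewrite subKr.
    rewrite (le_trans (ler_normB _ _))// lerD ?HkO// (le_trans xy)//.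
    by rewrite invf_le1// ler1n.
  + by move=> x H; apply: contrapT => /eqP z0; apply: H; exact: subset_closure.
- move=> x Ux; apply: contrapT => /eqP /supp[y Oy yx]; apply: Ux.
  by apply: (Hd y); [exact: subset_closure|exact: le_lt_trans yx H3].
- exact: H1.
- move=> i; rewrite (@eq_nrm2 _ _ _ _ _ _ (fun x => mollify rho (w i) x - w i x)) ?H2//.
  move=> x _; congr (_ - _).
  rewrite [LHS](convolution_partial iv i x tr).
  exact: convolution_wderiv.
Unshelve. all: by end_near. Qed.

End inner.

End smoothing.

(** * Weak derivatives *)

Section weak_derivatives.
Context {R : realType} {n : nat}.
Hypothesis n_gt0 : (0 < n)%N.
Local Notation V := 'rV[R]_n.
Local Notation C := R[i].
Local Notation leb := (@lebesgue_rV R n).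

(** A boolean selects the real or the imaginary part, so that statements on complex functions become
    one statement on real functions for both values of [b]. *)
Definition cpart (b : bool) (z : C) : R := if b then complex.Re z else complex.Im z.

Lemma sqmodE (z : C) : sqmod z = cpart true z ^+ 2 + cpart false z ^+ 2.
Proof. by []. Qed.

Lemma sqmod_ge0 (z : C) : 0 <= sqmod z.
Proof. by rewrite addr_ge0// sqr_ge0. Qed.

Lemma cpart_sq_le b (z : C) : cpart b z ^+ 2 <= sqmod z.
Proof. by case: b; rewrite sqmodE ?lerDl ?lerDr sqr_ge0. Qed.

Lemma cpartD b (y z : C) : cpart b (y + z) = cpart b y + cpart b z.
Proof. by case: b; case: y; case: z. Qed.

Lemma cpartB b (y z : C) : cpart b (y - z) = cpart b y - cpart b z.
Proof. by case: b; case: y; case: z. Qed.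

Lemma cpartMr b (z : C) (r : R) : cpart b (z * r%:C%C) = cpart b z * r.
Proof. by case: b; case: z => x y /=; ring. Qed.

Lemma cpart0 b : cpart b 0 = 0.
Proof. by case: b. Qed.

Lemma cpart_inj (y z : C) : (forall b, cpart b y = cpart b z) -> y = z.
Proof.
case: y => a b; case: z => c d H.
by have /= -> := H true; have /= -> := H false.
Qed.

Definition cpartF b (u : V -> C) : V -> R := fun x => cpart b (u x).

Definition wderiv (D : set V) i (v w : V -> R) := forall phi, test_function D phi ->
  \int[leb]_(x in D) (v x * partial i phi x) = - \int[leb]_(x in D) (w x * phi x).

Lemma cintegral_oppP (D : set V) (f g : V -> C) :
  cintegral D f = - cintegral D g <->
  forall b, \int[leb]_(x in D) cpartF b f x = - \int[leb]_(x in D) cpartF b g x.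
Proof.
split=> [H b|H].
  by have := congr1 (cpart b) H; case: b.
by apply: cpart_inj; case; [exact: (H true)|exact: (H false)].
Qed.

Section domain.
Variable D : set V.
Hypothesis oD : open D.
Hypothesis bD : bounded_set D.

Let mD : measurable D. Proof. exact: open_measurable_rV. Qed.

Lemma sqmod_integrable (u : V -> C) :
  (forall b, sqint (mu := leb) D (cpartF b u)) ->
  leb.-integrable D (EFin \o (fun x => sqmod (u x))).
Proof.
move=> H; have [_ i1] := H true; have [_ i2] := H false.
exact: integrableD_EFin.
Qed.

Lemma L2P (u : V -> C) : L2 D u <-> forall b, sqint (mu := leb) D (cpartF b u).
Proof.
split=> [[mr mi fi] b|H].
  have ms : measurable_fun D (fun x => sqmod (u x)).
    by apply: measurable_funD; exact: measurable_funX.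
  have isq : leb.-integrable D (EFin \o (fun x => sqmod (u x))).
    apply/integrableP; split; first exact/measurable_EFinP.
    by under eq_integral do rewrite /comp gee0_abs ?lee_fin ?sqmod_ge0//.
  apply: sqint_le isq _ => //; first by case: b.
  by move=> x _; exact: cpart_sq_le.
split; [exact: (H true).1|exact: (H false).1|].
exact: (integrable_lty mD (sqmod_integrable H)).
Qed.

Lemma weak_gradientP (u : V -> C) (w : 'I_n -> V -> C) : weak_gradient D u w <->
  forall i b, sqint (mu := leb) D (cpartF b (w i)) /\
    wderiv D i (cpartF b u) (cpartF b (w i)).
Proof.
have E b (g : V -> C) (r : V -> R) :
    (fun x => cpartF b (fun x => g x * (r x)%:C%C) x) = (fun x => cpartF b g x * r x).
  by apply/funext => x; exact: cpartMr.
split=> [H i b|H i].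
  have [/L2P w2 Hi] := H i; split => // phi /Hi /cintegral_oppP /(_ b).
  by rewrite !E.
split; first by apply/L2P => b; have [] := H i b.
move=> phi tp; apply/cintegral_oppP => b; rewrite !E.
by have [_] := H i b; apply.
Qed.

Lemma grad_weak (u : V -> C) : H1 D u -> weak_gradient D u (grad D u).
Proof. by move=> [_ [w Hw]]; apply: (@xgetPex _ (fun _ _ => 0) [set w | weak_gradient D u w]); exists w. Qed.

Let mulint (f : V -> R) phi : sqint (mu := leb) D f -> test_function D phi ->
  leb.-integrable D (EFin \o (fun x => f x * phi x)).
Proof.
move=> sf tp; apply: sqint_mul => //.
exact: sqintS (test_sqint tp).
Qed.

Lemma wderiv_unique i (v w w' : V -> R) :
  sqint (mu := leb) D w -> sqint (mu := leb) D w' ->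
  wderiv D i v w -> wderiv D i v w' -> {ae leb, forall x, D x -> w x = w' x}.
Proof.
move=> sw sw' H H'.
have : {ae leb, forall x, D x -> w x - w' x = 0}.
  apply: (test_orthogonal_ae0 n_gt0 oD bD (sqintB mD sw sw')) => phi tp.
  rewrite (@eq_Rintegral _ _ _ _ _ (fun x => w x * phi x - w' x * phi x)); last first.
    by move=> x _; rewrite mulrBl.
  rewrite RintegralB//; [|exact: mulint..].
  by apply/eqP; rewrite subr_eq0 -eqr_opp -H// -H'.
by apply: filterS => x + Dx => /(_ Dx) /eqP; rewrite subr_eq0 => /eqP.
Qed.

(** Since [grad] is chosen by [xget], formulas for it can only be derived through this uniqueness,
    and hold almost everywhere. *)
Lemma weak_gradient_unique (u : V -> C) w w' :
  weak_gradient D u w -> weak_gradient D u w' ->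
  {ae leb, forall x, D x -> forall i, w i x = w' i x}.
Proof.
move=> /weak_gradientP H /weak_gradientP H'.
have U : {ae leb, forall x, forall i, D x -> w i x = w' i x}.
  apply: (@filter_forall _ _ (fun i => [set x | D x -> w i x = w' i x])) => i.
  have P b : {ae leb, forall x, D x -> cpartF b (w i) x = cpartF b (w' i) x}.
    by have [s1 d1] := H i b; have [s2 d2] := H' i b; exact: wderiv_unique d1 d2.
  apply: filterS2 (P true) (P false) => x P1 P2 Dx.
  by apply: cpart_inj; case; [exact: P1|exact: P2].
by apply: filterS U => x U Dx i; exact: U.
Qed.

Lemma wderivD i (v1 v2 w1 w2 : V -> R) :
  sqint (mu := leb) D v1 -> sqint (mu := leb) D v2 ->
  sqint (mu := leb) D w1 -> sqint (mu := leb) D w2 ->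
  wderiv D i v1 w1 -> wderiv D i v2 w2 ->
  wderiv D i (fun x => v1 x + v2 x) (fun x => w1 x + w2 x).
Proof.
move=> sv1 sv2 sw1 sw2 H1' H2' phi tp; have tq := test_partial i tp.
rewrite (@eq_Rintegral _ _ _ _ _ (fun x => v1 x * partial i phi x + v2 x * partial i phi x)); last first.
  by move=> x _; rewrite mulrDl.
rewrite RintegralD//; [|exact: mulint..].
rewrite [in RHS](@eq_Rintegral _ _ _ _ _ (fun x => w1 x * phi x + w2 x * phi x)); last first.
  by move=> x _; rewrite mulrDl.
rewrite [in RHS]RintegralD//; [|exact: mulint..].
by rewrite H1'// H2'// opprD.
Qed.

Lemma wderivZ i (c : R) (v w : V -> R) :
  sqint (mu := leb) D v -> sqint (mu := leb) D w ->
  wderiv D i v w -> wderiv D i (fun x => c * v x) (fun x => c * w x).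
Proof.
move=> sv sw Hvw phi tp; have tq := test_partial i tp.
rewrite (@eq_Rintegral _ _ _ _ _ (fun x => c * (v x * partial i phi x))); last first.
  by move=> x _; rewrite mulrA.
rewrite RintegralZl//; last exact: mulint.
rewrite [in RHS](@eq_Rintegral _ _ _ _ _ (fun x => c * (w x * phi x))); last first.
  by move=> x _; rewrite mulrA.
rewrite [in RHS]RintegralZl//; last exact: mulint.
by rewrite Hvw// mulrN.
Qed.

Lemma wderivB i (v1 v2 w1 w2 : V -> R) :
  sqint (mu := leb) D v1 -> sqint (mu := leb) D v2 ->
  sqint (mu := leb) D w1 -> sqint (mu := leb) D w2 ->
  wderiv D i v1 w1 -> wderiv D i v2 w2 ->
  wderiv D i (fun x => v1 x - v2 x) (fun x => w1 x - w2 x).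
Proof.
move=> sv1 sv2 sw1 sw2 H1' H2'.
have := wderivD sv1 (sqintZ mD (-1) sv2) sw1 (sqintZ mD (-1) sw2) H1' (wderivZ (-1) sv2 sw2 H2').
under eq_fun do rewrite mulN1r.
by under [X in wderiv D i _ X]eq_fun do rewrite mulN1r.
Qed.

End domain.

(* A function of H^1 that is small near the boundary of O, in the sense of the
   convergence hypothesis, can be cut off sharply along this boundary. *)
Section decoupling.
Variables (D O : set V).
Hypothesis oD : open D.
Hypothesis bD : bounded_set D.
Hypothesis oO : open O.
Hypothesis OD : O `<=` D.
Variable zeta : nat -> V -> R.
Hypothesis zeta_test : forall m, test_function O (zeta m).
Hypothesis zeta01 : forall m x, 0 <= zeta m x <= 1.
Hypothesis zeta1 : forall x, O x -> \forall m \near \oo, zeta m x = 1.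

Let mD : measurable D. Proof. exact: open_measurable_rV. Qed.
Let mO : measurable O. Proof. exact: open_measurable_rV. Qed.

Definition sharp_cut (f : V -> R) : V -> R := fun x => \1_O x * f x.

Lemma sharp_cut_out (f : V -> R) x : ~ O x -> sharp_cut f x = 0.
Proof. by move=> Ox; rewrite /sharp_cut indicE memNset// mul0r. Qed.

Lemma sharp_cut_in (f : V -> R) x : O x -> sharp_cut f x = f x.
Proof. by move=> Ox; rewrite /sharp_cut indicE mem_set// mul1r. Qed.

Lemma sharp_cut_sqint (f : V -> R) : sqint (mu := leb) D f ->
  sqint (mu := leb) setT (sharp_cut f).
Proof.
move=> sf; have sfO := sqintS mO mD OD sf.
have E : sharp_cut f = f \_ O.
  by apply/funext => x; rewrite /sharp_cut indicE patchE; case: (x \in O); rewrite ?mul1r ?mul0r.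
split; first by rewrite E; exact: (measurable_restrictT f mO).1 sfO.1.
have := (integrable_mkcond (mu := leb) (EFin \o (fun x => f x ^+ 2)) mO).1 sfO.2.
apply: eq_integrable => // x _.
rewrite /= patchE /sharp_cut indicE.
by case: (x \in O); rewrite ?mul1r// mul0r expr0n.
Qed.

(** The product [zeta m * phi] is supported in [O], so it may be used in [D] for a [phi] with
    arbitrary compact support; this is why the conclusion holds on the whole space. *)
Lemma sharp_cut_wderiv i (v w : V -> R) : sqint (mu := leb) D v ->
  sqint (mu := leb) D w -> wderiv D i v w ->
  cvg2 (mu := leb) D (fun m x => v x * partial i (zeta m) x) (fun=> 0) ->
  global_wderiv i (sharp_cut v) (sharp_cut w).
Proof.
move=> sv sw Hvw Hz phi tp.
have tq := test_partial i tp.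
have restr f : sqint (mu := leb) setT f -> sqint (mu := leb) D f.
  by apply: sqintS.
have sp := restr _ (test_sqint tp).
have sq := restr _ (test_sqint tq).
have mz m : measurable_fun D (zeta m).
  by apply: measurable_funTS; exact: test_measurable (zeta_test m).
have mdz m : measurable_fun D (partial i (zeta m)).
  by apply: measurable_funTS; exact: test_measurable (test_partial i (zeta_test m)).
have zle m x : `|zeta m x| <= 1 by have /andP[z0 z1] := zeta01 m x; rewrite ger0_norm.
have sz f m : sqint (mu := leb) D f -> sqint (mu := leb) D (fun x => f x * zeta m x).
  by move=> sf; apply: (@sqintMb _ _ _ _ _ mD _ _ 1).
have sdz m : sqint (mu := leb) D (fun x => v x * partial i (zeta m) x).
  have [M M0 HM] := test_bounded (test_partial i (zeta_test m)).
  by apply: (@sqintMb _ _ _ _ _ mD _ _ M).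
have cut_cvg f : sqint (mu := leb) D f ->
    cvg2 (mu := leb) D (fun m x => f x * zeta m x) (sharp_cut f).
  move=> sf; apply: (cvg2_dominated mD _ _ sf).
  - by move=> m; exact: (sz f m sf).1.
  - exact: (restr _ (sharp_cut_sqint sf)).1.
  - move=> x _; apply: cvg_near_cst; have [Ox|Ox] := pselect (O x).
      by apply: filterS (zeta1 Ox) => m ->; rewrite sharp_cut_in// mulr1.
    by apply: nearW => m; rewrite sharp_cut_out// (test0 (zeta_test m) Ox) mulr0.
  - move=> m x _; rewrite /sharp_cut indicE mulrC -mulrBl normrM ler_piMl//.
    have /andP[z0 z1] := zeta01 m x.
    have [xO|xO] := boolP (x \in O) => /=.
      by rewrite distrC ger0_norm ?subr_ge0// gerBl.
    by rewrite subr0 ger0_norm.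
have rc f : sqint (mu := leb) D f -> sqint (mu := leb) D (sharp_cut f).
  by move=> sf; apply: restr; exact: sharp_cut_sqint.
have c1 := cvg2_Rintegral mD (fun m => sz v m sv) (rc v sv) sq (cut_cvg v sv).
have c2 := cvg2_Rintegral mD sdz (sqint0 _) sp Hz.
have c3 := cvg2_Rintegral mD (fun m => sz w m sw) (rc w sw) sp (cut_cvg w sw).
have key m : \int[leb]_(x in D) (v x * zeta m x * partial i phi x) +
    \int[leb]_(x in D) (v x * partial i (zeta m) x * phi x) =
    - \int[leb]_(x in D) (w x * zeta m x * phi x).
  have tzp : test_function D (fun x => zeta m x * phi x).
    by apply: test_sub OD _; apply: testMr => //; exact: test_smooth tp.
  rewrite -RintegralD//; last 2 first.
  - exact: (sqint_mul mD (sz v m sv) sq).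
  - exact: (sqint_mul mD (sdz m) sp).
  have := Hvw _ tzp.
  rewrite [X in X = _ -> _](@eq_Rintegral _ _ _ _ _
    (fun x => v x * zeta m x * partial i phi x + v x * partial i (zeta m) x * phi x)); last first.
    move=> x _; rewrite partialM; [|exact: test_smooth (zeta_test m)|exact: test_smooth tp].
    by ring.
  by move=> ->; congr (- _); apply: eq_Rintegral => x _; rewrite mulrA.
have L := cvgD c1 c2.
have L' := cvgN c3.
have E : \int[leb]_(x in D) (sharp_cut v x * partial i phi x) +
    \int[leb]_(x in D) (0 * phi x) = - \int[leb]_(x in D) (sharp_cut w x * phi x).
  rewrite -(cvg_lim (@Rhausdorff R) (L _)) -(cvg_lim (@Rhausdorff R) (L' _)).
  apply: (f_equal (fun h : nat -> R => lim (h @ \oo))).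
  by apply/funext => m; exact: key.
have off (f g : V -> R) x : ~ D x -> sharp_cut f x * g x = 0.
  by move=> Dx; rewrite sharp_cut_out ?mul0r// => /OD.
rewrite (Rintegral_zero_off (D := D)); last exact: off.
rewrite [in RHS](Rintegral_zero_off (D := D)); last exact: off.
rewrite -E [X in _ + X](@eq_Rintegral _ _ _ _ _ (fun=> 0)).
  by rewrite Rintegral_cst// mul0r addr0.
by move=> x _; rewrite mul0r.
Qed.

End decoupling.

End weak_derivatives.

(** * Strips along the singular hypersurface *)

Section distance.
Context {R : realType} {n : nat}.
Local Notation V := 'rV[R]_n.

Lemma norm_le_enorm (x : V) : `|x| <= enorm x.
Proof.
apply: norm_le_coord; first exact: sqrtr_ge0.
move=> i; rewrite -sqrtr_sqr /enorm; apply: ler_wsqrtr.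
by rewrite (bigD1 i)//= lerDl; apply: sumr_ge0 => j _; exact: sqr_ge0.
Qed.

Lemma enorm_le_norm (x : V) : enorm x <= n.+1%:R * `|x|.
Proof.
rewrite -[leRHS]ger0_norm ?mulr_ge0// -sqrtr_sqr /enorm; apply: ler_wsqrtr.
apply: (@le_trans _ _ (\sum_(i < n) `|x| ^+ 2)).
  apply: ler_sum => i _; rewrite -real_normK ?num_real//.
  by rewrite lerXn2r ?nnegrE// coord_norm_le.
rewrite sumr_const card_ord exprMn -[leLHS]mulr_natl; apply: ler_wpM2r; first exact: sqr_ge0.
by rewrite -natrX ler_nat (leq_trans (leqnSn n))// expnS expn1 leq_pmull.
Qed.

Lemma dist_set_le (H : set V) (x h : V) : H h -> dist_set x H <= n.+1%:R * `|x - h|.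
Proof.
move=> Hh; apply: le_trans (enorm_le_norm _).
apply: ge_inf; last by exists h.
by exists 0 => _ [y _ <-]; exact: sqrtr_ge0.
Qed.

Lemma dist_set_gt0 (H : set V) (x : V) : closed H -> H !=set0 -> ~ H x ->
  0 < dist_set x H.
Proof.
move=> cH [h0 Hh0] Hx.
have [e e0 He] : exists2 e : R, 0 < e & forall y, `|x - y| < e -> ~ H y.
  apply/near_normP; have oH : open (~` H) by exact: closed_openC.
  exact: (open_nbhs_nbhs (conj oH Hx)).
apply: (lt_le_trans e0); apply: lb_le_inf; first by exists (enorm (x - h0)); exists h0.
move=> _ [y Hy <-]; rewrite leNgt; apply/negP => xy.
by apply: (He y) => //; exact: le_lt_trans (norm_le_enorm _) xy.
Qed.

End distance.

Section singular.
Context {R : realType} {n : nat}.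
Hypothesis n_gt0 : (0 < n)%N.
Local Notation V := 'rV[R]_n.
Local Notation C := R[i].
Local Notation leb := (@lebesgue_rV R n).
Variables (D O H : set V) (mu : R).
Hypothesis oD : open D.
Hypothesis bD : bounded_set D.
Hypothesis oO : open O.
Hypothesis bO : bounded_set O.
Hypothesis cOD : closure O `<=` D.
Hypothesis cH : closed H.
Hypothesis bdO : boundary O = H.
Hypothesis mu_lt : mu < - 2.

Let mD : measurable D. Proof. exact: open_measurable_rV. Qed.

Let H_compact : compact H.
Proof.
have [k Hk] := bounded_setP bO.
apply: bounded_closed_compact => //; apply: (@norm_bounded_set _ _ _ k%:R) => x.
rewrite -bdO => /(boundary_closure x oO) [clx _].
exact: closure_norm_le clx.
Qed.

Variable c : R.
Hypothesis c0 : 0 < c.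
Variable zeta : nat -> V -> R.
Hypothesis zeta_test : forall m, test_function O (zeta m).
Hypothesis zeta_le : forall m i x, `|partial i (zeta m) x| <= c * m.+1%:R.
Hypothesis zeta_strip : forall m i x, partial i (zeta m) x != 0 -> O x /\
  exists2 h, boundary O h & `|x - h| <= c / m.+1%:R.

(* On the support of the gradient of the cutoff, the distance d to H is at most
   of order 1/m, so that m^2 = O(d^-2) = O(d^mu) = O(-q). *)
Let strip_bound (q : V -> R) : singular_potential D H mu q ->
  exists A : R, exists B : R, [/\ 0 <= A, 0 <= B & forall m i x, D x ->
    partial i (zeta m) x ^+ 2 <= A * `|q x| + B].
Proof.
move=> [_ _ [U [c1 [C0 [[oU HU UD] [_ C00 Cc qE]]]]]].
have [d d0 Hd] := compact_sub_open H_compact oU HU.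
have s0 : 0 < n.+1%:R * c by rewrite mulr_gt0.
(* For [m >= N] the strip lies in [U], where the formula for [q] holds, and the distance to [H] is
   at most 1 on it. The finitely many [m < N] are absorbed by [B]. *)
have e0 : 0 < Num.min (d / c) (n.+1%:R * c)^-1.
  by rewrite lt_min divr_gt0//= invr_gt0.
have [N _ HN] := near_infty_natSinv_lt (PosNum e0).
(* On the strip the distance [d] is at most [(n+1) c / (m+1)], so the gradient bound [c (m+1)] is at
   most [(n+1) c^2 / d]; its square is compared with [|q| >= C0 / d^2]. *)
exists ((n.+1%:R * c ^+ 2) ^+ 2 / C0), ((c * N.+1%:R) ^+ 2); split.
- by rewrite divr_ge0 ?sqr_ge0// ltW.
- exact: sqr_ge0.
move=> m i x Dx.
have [->|dz] := eqVneq (partial i (zeta m) x) 0.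
  by rewrite expr0n/= addr_ge0 ?sqr_ge0// mulr_ge0// divr_ge0 ?sqr_ge0// ltW.
have zl : partial i (zeta m) x ^+ 2 <= (c * m.+1%:R) ^+ 2.
  rewrite -real_normK ?num_real// lerXn2r ?nnegrE// mulr_ge0//; exact: ltW.
have [mN|Nm] := ltnP m N.
  apply: (le_trans zl); rewrite ler_wpDl//.
    by rewrite mulr_ge0// divr_ge0 ?sqr_ge0// ltW.
  rewrite lerXn2r ?nnegrE ?mulr_ge0 ?(ltW c0)//.
  by rewrite ler_wpM2l ?(ltW c0)// ler_nat ltnW.
have [Ox [h bh xh]] := zeta_strip dz.
have /= := HN m Nm; rewrite lt_min => /andP[md ms].
have Hh : H h by rewrite -bdO.
have Ux : U x.
  apply: (Hd h) => //; rewrite distrC (le_lt_trans xh)//.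
  by rewrite mulrC -ltr_pdivlMr.
have nHx : ~ H x.
  by rewrite -bdO => /(boundary_closure x oO)[_]; apply.
have dH0 : 0 < dist_set x H by apply: dist_set_gt0 => //; exists h.
have dHm : dist_set x H <= (n.+1%:R * c) / m.+1%:R.
  by apply: (le_trans (dist_set_le x Hh)); rewrite -mulrA ler_wpM2l.
have dH1 : dist_set x H <= 1.
  apply: (le_trans dHm); rewrite mulrC -ler_pdivlMr// mul1r.
  exact: ltW.
(* This is where [mu < - 2] enters: for a base in [(0, 1]] the power decreases with the exponent. *)
have pw : (dist_set x H ^+ 2)^-1 <= dist_set x H `^ mu.
  have := @ger_powR R (dist_set x H); rewrite dH0 dH1 => /(_ isT _ _ (ltW mu_lt)).
  by rewrite powRN -(powR_mulrn 2 (ltW dH0)).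
have qx : (dist_set x H ^+ 2)^-1 * C0 <= `|q x|.
  rewrite (qE _ Ux nHx) normrN ger0_norm; last first.
    by rewrite mulr_ge0 ?powR_ge0// (le_trans (ltW C00))// ltW// Cc.
  by apply: ler_pM => //; [rewrite invr_ge0 sqr_ge0|exact: ltW|exact/ltW/Cc].
apply: (le_trans zl); rewrite ler_wpDr ?sqr_ge0//.
apply: (@le_trans _ _ ((n.+1%:R * c ^+ 2) ^+ 2 / C0 * ((dist_set x H ^+ 2)^-1 * C0))); last first.
  by rewrite ler_wpM2l// divr_ge0 ?sqr_ge0// ltW.
have -> : (n.+1%:R * c ^+ 2) ^+ 2 / C0 * ((dist_set x H ^+ 2)^-1 * C0) =
    (n.+1%:R * c ^+ 2 / dist_set x H) ^+ 2.
  by field; rewrite !gt_eqF.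
rewrite lerXn2r ?nnegrE ?mulr_ge0 ?divr_ge0 ?(ltW c0) ?invr_ge0 ?(ltW dH0) ?sqr_ge0//.
rewrite ler_pdivlMr//; apply: (@le_trans _ _ (c * m.+1%:R * ((n.+1%:R * c) / m.+1%:R))).
  by rewrite ler_wpM2l// mulr_ge0// ltW.
rewrite le_eqVlt; apply/orP; left; apply/eqP; field.
by rewrite gt_eqF.
Qed.

(** Dominated convergence: [G] is integrable because [q |u|^2] is, and its square root dominates the
    sequence. Pointwise the limit is 0, since each point of [O] leaves the strip. *)
Lemma singular_cvg2 (q : V -> R) (u : V -> C) b i : singular_potential D H mu q ->
  (forall b, sqint (mu := leb) D (cpartF b u)) ->
  leb.-integrable D (fun x => (q x * sqmod (u x))%:E) ->
  cvg2 (mu := leb) D (fun m x => cpartF b u x * partial i (zeta m) x) (fun=> 0).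
Proof.
move=> sq su iq; have [A [B [A0 B0 AB]]] := strip_bound sq.
have isq := sqmod_integrable oD su.
have iabs : leb.-integrable D (EFin \o (fun x => `|q x * sqmod (u x)|)).
  exact: integrable_norm.
pose G x := A * `|q x * sqmod (u x)| + B * sqmod (u x).
have iG : leb.-integrable D (EFin \o G).
  by apply: integrableD_EFin => //; exact: integrableZ_EFin.
have G0 x : 0 <= G x by rewrite addr_ge0// mulr_ge0// sqmod_ge0.
have mG : measurable_fun D G by have /measurable_int/measurable_EFinP := iG.
have sG : sqint (mu := leb) D (fun x => Num.sqrt (G x)).
  apply: (sqint_le mD _ iG) => [|x _]; last by rewrite sqr_sqrtr.
  apply: measurableT_comp mG; apply: continuous_measurable_fun.
  exact: sqrt_continuous.
have tz m := test_partial i (zeta_test m).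
apply: (cvg2_dominated mD _ _ sG).
- move=> m; apply: measurable_funM; first exact: (su b).1.
  by apply: measurable_funTS; exact: test_measurable (tz m).
- exact: measurable_cst.
- move=> x Dx; apply: cvg_near_cst.
  have [Ox|Ox] := pselect (O x); last first.
    apply: nearW => m; apply/eqP; rewrite mulf_eq0; apply/orP; right.
    by apply/eqP; exact: test0 (tz m) Ox.
  have [e e0 He] : exists2 e : R, 0 < e & forall y, `|x - y| < e -> O y.
    by apply/near_normP; exact: (open_nbhs_nbhs (conj oO Ox)).
  have ec : 0 < e / c by rewrite divr_gt0.
  have := near_infty_natSinv_lt (PosNum ec); apply: filterS => m /= me.
  have [->|/zeta_strip[_ [h /(boundary_closure h oO)[_ nOh] xh]]] :=
    eqVneq (partial i (zeta m) x) 0; first by rewrite mulr0.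
  exfalso; apply: nOh; apply: He; rewrite (le_lt_trans xh)//.
  by rewrite mulrC -ltr_pdivlMr.
- move=> m x Dx; rewrite subr0 (ger0_norm (sqrtr_ge0 _)) -sqrtr_sqr.
  apply: ler_wsqrtr; rewrite exprMn mulrC.
  apply: (@le_trans _ _ ((A * `|q x| + B) * sqmod (u x))).
    apply: ler_pM; [exact: sqr_ge0|exact: sqr_ge0|exact: AB|exact: cpart_sq_le].
  by rewrite /G mulrDl -mulrA normrM (ger0_norm (sqmod_ge0 _)).
Qed.

End singular.

(** * Changing a function of H^1 inside a domain *)

Section gluing.
Context {R : realType} {n : nat}.
Hypothesis n_gt0 : (0 < n)%N.
Local Notation V := 'rV[R]_n.
Local Notation C := R[i].
Local Notation leb := (@lebesgue_rV R n).
Variables (D O : set V).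
Hypothesis oD : open D.
Hypothesis bD : bounded_set D.
Hypothesis oO : open O.
Hypothesis cOD : closure O `<=` D.

Let OD : O `<=` D. Proof. by apply: subset_trans cOD; exact: subset_closure. Qed.
Let mD : measurable D. Proof. exact: open_measurable_rV. Qed.
Let mO : measurable O. Proof. exact: open_measurable_rV. Qed.
Let mDO : measurable (D `\` O). Proof. exact: measurableD. Qed.
Let bO : bounded_set O.
Proof.
by have [k H] := bounded_setP bD; apply: (@norm_bounded_set _ _ _ k%:R) => x /OD /H.
Qed.

Let DE : D = O `|` (D `\` O).
Proof.
apply/seteqP; split=> [x Dx|x [/OD//|[]//]].
by have [Ox|nOx] := pselect (O x); [left|right].
Qed.

Lemma integrable_glue (f : V -> R) : leb.-integrable O (EFin \o f) ->
  leb.-integrable (D `\` O) (EFin \o f) -> leb.-integrable D (EFin \o f).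
Proof.
move=> i1 i2; apply/(integrable_mkcond _ mD).2.
have := integrableD measurableT ((integrable_mkcond _ mO).1 i1) ((integrable_mkcond _ mDO).1 i2).
apply: eq_integrable => // x _ /=.
rewrite !patchE in_setD.
have [/set_mem Ox|nO] := boolP (x \in O) => /=.
  by rewrite andbF (mem_set (OD Ox)) adde0.
by rewrite andbT add0e.
Qed.

(** An element of H^1 of the whole space that vanishes off [O], with a representative of its
    gradient that vanishes there everywhere. These are the perturbations that leave the trace on the
    boundary of [D] unchanged. *)
Record inner (z : V -> C) (w : 'I_n -> V -> C) : Prop := Inner {
  inner_sq : forall b, sqint (mu := leb) setT (cpartF b z) ;
  inner_gsq : forall b i, sqint (mu := leb) setT (cpartF b (w i)) ;
  inner_out : forall x, ~ O x -> z x = 0 ;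
  inner_gout : forall i x, ~ O x -> w i x = 0 ;
  inner_wd : forall b i, global_wderiv i (cpartF b z) (cpartF b (w i)) }.

Lemma inner_wderiv b i z w : inner z w -> wderiv D i (cpartF b z) (cpartF b (w i)).
Proof.
move=> Hz phi tp; have := inner_wd Hz b i (test_subT tp).
rewrite (Rintegral_zero_off (D := D)).
  rewrite (Rintegral_zero_off (D := D))// => x Dx.
  by rewrite (test0 tp Dx) mulr0.
by move=> x Dx; rewrite (test0 (test_partial i tp) Dx) mulr0.
Qed.

Lemma inner_weak z w : inner z w -> weak_gradient D z w.
Proof.
move=> Hz; apply/weak_gradientP => // i b; split; last exact: inner_wderiv.
exact: (sqintS mD measurableT (subsetT D) (inner_gsq Hz b i)).
Qed.

Lemma cpartFD b (f g : V -> C) :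
  cpartF b (fun x => f x + g x) = (fun x => cpartF b f x + cpartF b g x).
Proof. by apply/funext => x; exact: cpartD. Qed.

Lemma cpartFB b (f g : V -> C) :
  cpartF b (fun x => f x - g x) = (fun x => cpartF b f x - cpartF b g x).
Proof. by apply/funext => x; exact: cpartB. Qed.

Lemma add_inner_weak a z w : H1 D a -> inner z w ->
  weak_gradient D (fun x => a x + z x) (fun i x => grad D a i x + w i x).
Proof.
move=> Ha Hz; have /weak_gradientP Ga := grad_weak Ha.
have /weak_gradientP Gz := inner_weak Hz.
apply/weak_gradientP => // i b; rewrite !cpartFD.
have [sa da] := Ga oD i b; have [sz dz] := Gz oD i b.
have sA : sqint (mu := leb) D (cpartF b a) by have [/(L2P oD)] := Ha.
have sZ : sqint (mu := leb) D (cpartF b z).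
  exact: (sqintS mD measurableT (subsetT D) (inner_sq Hz b)).
by split; [exact: sqintD|exact: wderivD].
Qed.

Lemma add_inner_H1 a z w : H1 D a -> inner z w -> H1 D (fun x => a x + z x).
Proof.
move=> Ha Hz; split; last by exists (fun i x => grad D a i x + w i x); exact: add_inner_weak.
apply/L2P => // b; rewrite cpartFD; apply: sqintD => //.
  by have [/(L2P oD)] := Ha.
exact: (sqintS mD measurableT (subsetT D) (inner_sq Hz b)).
Qed.

Lemma add_inner_grad a z w : H1 D a -> inner z w ->
  {ae leb, forall x, D x -> forall i, grad D (fun x => a x + z x) i x = grad D a i x + w i x}.
Proof.
move=> Ha Hz; apply: (weak_gradient_unique n_gt0 oD bD (u := fun x => a x + z x)).
  exact: grad_weak (add_inner_H1 Ha Hz).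
exact: add_inner_weak.
Qed.

Lemma sqmod_measurable (A : set V) (f : V -> C) :
  (forall b, measurable_fun A (cpartF b f)) -> measurable_fun A (fun x => (sqmod (f x))%:E).
Proof.
move=> mf; apply/measurable_EFinP; apply: measurable_funD; apply: measurable_funX.
  exact: (mf true).
exact: (mf false).
Qed.

Lemma integral_sqmodD_le (f g : V -> C) :
  (forall b, measurable_fun D (cpartF b f)) -> (forall b, measurable_fun D (cpartF b g)) ->
  (\int[leb]_(x in D) (sqmod (f x + g x))%:E <=
   2%:E * \int[leb]_(x in D) (sqmod (f x))%:E + 2%:E * \int[leb]_(x in D) (sqmod (g x))%:E)%E.
Proof.
move=> mf mg; have [mf' mg'] := (sqmod_measurable mf, sqmod_measurable mg).
have p0 (h : V -> C) x : (0 <= (sqmod (h x))%:E)%E by rewrite lee_fin sqmod_ge0.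
have Z0 (h : V -> C) x : (0 <= 2%:E * (sqmod (h x))%:E)%E by rewrite mule_ge0// lee_fin.
rewrite -!ge0_integralZl ?lee_fin//; [|by move=> x _; exact: p0..].
have mZ (h : V -> C) : measurable_fun D (fun x => (sqmod (h x))%:E) ->
    measurable_fun D (fun x => (2%:E * (sqmod (h x))%:E)%E).
  by move=> mh; exact: emeasurable_funM.
rewrite -ge0_integralD//; [|exact: mZ|exact: mZ].
apply: ge0_le_integral => //.
- by move=> x _; rewrite lee_fin sqmod_ge0.
- apply: sqmod_measurable => b; rewrite cpartFD.
  by apply: measurable_funD; [exact: mf|exact: mg].
- by apply: emeasurable_funD; exact: mZ.
move=> x _; rewrite -!EFinM -EFinD lee_fin !sqmodE !cpartD.
set p := cpart true _; set q := cpart true _; set r := cpart false _; set s := cpart false _.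
by have := sqr_ge0 (p - q); have := sqr_ge0 (r - s); rewrite !expr2; nra.
Qed.

Lemma integral_sqmod_le (f : V -> C) (e : R) :
  (forall b, sqint (mu := leb) setT (cpartF b f)) ->
  (forall b, nrm2 (mu := leb) setT (cpartF b f) <= e) ->
  (\int[leb]_(x in D) (sqmod (f x))%:E <= (2 * e)%:E)%E.
Proof.
move=> sf fe; have mf : measurable_fun setT (fun x => (sqmod (f x))%:E).
  by apply: sqmod_measurable => b; exact: (sf b).1.
have f0 x : (0 <= (sqmod (f x))%:E)%E by rewrite lee_fin sqmod_ge0.
apply: (@le_trans _ _ (\int[leb]_x (sqmod (f x))%:E)%E).
  by apply: ge0_subset_integral.
under eq_integral do rewrite sqmodE EFinD.
rewrite ge0_integralD//.
- rewrite (nrm2E measurableT (sf true)) (nrm2E measurableT (sf false)).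
  by rewrite -EFinD lee_fin mulrDl mul1r lerD.
- by move=> x _; rewrite lee_fin sqr_ge0.
- exact: measurable_sq (sf true).1.
- by move=> x _; rewrite lee_fin sqr_ge0.
- exact: measurable_sq (sf false).1.
Qed.

(** The perturbation is approximated in H^1 by test functions that vanish off [D], hence on its
    boundary. Added to a sequence that approximates [a], they leave its boundary values as they
    are. *)
Lemma add_inner_trace a z w f : H1 D a -> inner z w -> is_trace D a f ->
  is_trace D (fun x => a x + z x) f.
Proof.
move=> Ha Hz [mf1 mf2 [g [tg gH gB]]]; split => //.
have /choice[h Hh] (kb : nat * bool) : exists h, [/\ test_function setT h,
    forall x, ~ D x -> h x = 0,
    nrm2 (mu := leb) setT (fun x => h x - cpartF kb.2 z x) <= kb.1.+1%:R^-1 &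
    forall i, nrm2 (mu := leb) setT (fun x => partial i h x - cpartF kb.2 (w i) x) <= kb.1.+1%:R^-1].
  have out0 (u : V -> C) : (forall x, ~ O x -> u x = 0) -> forall x, ~ O x -> cpartF kb.2 u x = 0.
    by move=> H x /H; rewrite /cpartF => ->; exact: cpart0.
  apply: (inner_approx n_gt0 oO bO oD cOD (inner_sq Hz kb.2) (inner_gsq Hz kb.2)) => //.
  - exact: out0 (inner_out Hz).
  - by move=> i; exact: out0 (inner_gout Hz i).
  - exact: inner_wd.
pose H k (x : V) : C := Complex (h (k, true) x) (h (k, false) x).
pose dH k i (x : V) : C := Complex (partial i (h (k, true)) x) (partial i (h (k, false)) x).
have tH k b : test_function setT (cpartF b (H k)).
  by case: b; [have [] := Hh (k, true)|have [] := Hh (k, false)].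
have tgb k b : test_function setT (cpartF b (g k)) by case: b; have [] := tg k.
have sT (u : V -> R) : sqint (mu := leb) setT u -> sqint (mu := leb) D u.
  by apply: sqintS.
have HG k b : cpartF b (fun x => g k x + H k x) = (fun x => cpartF b (g k) x + cpartF b (H k) x).
  exact: cpartFD.
have sa b : sqint (mu := leb) D (cpartF b a) by have [/(L2P oD)] := Ha.
have /weak_gradientP Ga := grad_weak Ha.
have sga b i : sqint (mu := leb) D (cpartF b (grad D a i)) by have [] := Ga oD i b.
have /weak_gradientP Gaz := grad_weak (add_inner_H1 Ha Hz).
exists (fun k x => g k x + H k x); split.
- by move=> k; split; [have := testD (tgb k true) (tH k true)|have := testD (tgb k false) (tH k false)];
    rewrite -HG.
- pose e k : R := k.+1%:R^-1.
  (* Each of the [n + 1] integrals contributes [4 * e k]: a factor 2 for the real and imaginary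
     parts, another one from [integral_sqmodD_le]. *)
  have bound k : (H1_sqdist D (fun x => (g k x + H k x)%R) (fun x => (a x + z x)%R) <=
      2%:E * H1_sqdist D (g k) a + (4 * n.+1%:R * e k)%R%:E)%E.
    have sHz b : sqint (mu := leb) setT (cpartF b (fun x => H k x - z x)).
      rewrite cpartFB; apply: sqintB => //; first exact: test_sqint (tH k b).
      exact: (inner_sq Hz b).
    have nHz b : nrm2 (mu := leb) setT (cpartF b (fun x => H k x - z x)) <= e k.
      by rewrite cpartFB; case: b; [have [] := Hh (k, true)|have [] := Hh (k, false)].
    have tdH b i : test_function setT (cpartF b (dH k i)).
      by case: b; apply: test_partial; [exact: (tH k true)|exact: (tH k false)].
    have sdH b i : sqint (mu := leb) setT (cpartF b (fun x => dH k i x - w i x)).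
      rewrite cpartFB; apply: sqintB => //; first exact: test_sqint (tdH b i).
      exact: (inner_gsq Hz b i).
    have ndH b i : nrm2 (mu := leb) setT (cpartF b (fun x => dH k i x - w i x)) <= e k.
      by rewrite cpartFB; case: b; [have [_ _ _] := Hh (k, true)|have [_ _ _] := Hh (k, false)]; apply.
    have t1 : (\int[leb]_(x in D) (sqmod (g k x + H k x - (a x + z x))%R)%:E <=
        2%:E * \int[leb]_(x in D) (sqmod (g k x - a x)%R)%:E + (4 * e k)%R%:E)%E.
      rewrite (@eq_integral _ _ _ leb D (fun x => (sqmod ((g k x - a x) + (H k x - z x))%R)%:E)); last first.
        by move=> x _; rewrite opprD addrACA.
      apply: (le_trans (@integral_sqmodD_le (fun x => g k x - a x) (fun x => H k x - z x) _ _)).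
      - move=> b; rewrite cpartFB; apply: measurable_funB; last exact: (sa b).1.
        by apply: measurable_funTS; exact: test_measurable (tgb k b).
      - by move=> b; exact: (sT _ (sHz b)).1.
      rewrite leeD2l// (le_trans (lee_wpmul2l _ (integral_sqmod_le sHz nHz)))//.
      by rewrite -EFinM lee_fin; lra.
    have t2 i : (\int[leb]_(x in D) (sqmod (cpartial i (fun x => g k x + H k x) x -
          grad D (fun x => a x + z x) i x)%R)%:E <=
        2%:E * \int[leb]_(x in D) (sqmod (cpartial i (g k) x - grad D a i x)%R)%:E + (4 * e k)%R%:E)%E.
      have cg b : cpartF b (cpartial i (g k)) = partial i (cpartF b (g k)) by case: b.
      have mcg b : measurable_fun D (cpartF b (cpartial i (g k))).
        rewrite cg; apply: measurable_funTS.
        exact: test_measurable (test_partial i (tgb k b)).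
      have cgH : cpartial i (fun x => g k x + H k x) = (fun x => cpartial i (g k) x + dH k i x).
        apply/funext => x; apply: cpart_inj => b.
        rewrite cpartD.
        have -> : cpart b (cpartial i (fun x => g k x + H k x) x) =
            partial i (cpartF b (fun x => g k x + H k x)) x by case: b.
        rewrite HG partialD; [|exact: test_smooth (tgb k b)|exact: test_smooth (tH k b)].
        by case: b.
      have m1 b : measurable_fun D (cpartF b (fun x => cpartial i (g k) x - grad D a i x)).
        by rewrite cpartFB; apply: measurable_funB => //; exact: (sga b i).1.
      have m2 b : measurable_fun D (cpartF b (fun x => dH k i x - w i x)).
        exact: (sT _ (sdH b i)).1.
      rewrite cgH (_ : (\int[leb]_(x in D) _ = \int[leb]_(x in D)
         (sqmod ((cpartial i (g k) x - grad D a i x) + (dH k i x - w i x))%R)%:E)%E); last first.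
        apply: ae_eq_integral => //.
        - apply: sqmod_measurable => b; rewrite cpartFB cpartFD.
          apply: measurable_funB; last by have [[]] := Gaz oD i b.
          apply: measurable_funD => //; apply: measurable_funTS.
          exact: test_measurable (tdH b i).
        - apply: sqmod_measurable => b; rewrite cpartFD.
          by apply: measurable_funD.
        - apply: filterS (add_inner_grad Ha Hz) => x E Dx.
          by rewrite E// opprD addrACA.
      apply: (le_trans (@integral_sqmodD_le _ _ m1 m2)).
      rewrite leeD2l// (le_trans (lee_wpmul2l _ (integral_sqmod_le (fun b => sdH b i) (fun b => ndH b i))))//.
      by rewrite -EFinM lee_fin; lra.
    rewrite /H1_sqdist.
    apply: (le_trans (leeD t1 (lee_sum _ (fun i _ => t2 i)))).
    rewrite big_split/= -ge0_sume_distrr; last first.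
      by move=> i _; apply: integral_ge0 => x _; rewrite lee_fin sqmod_ge0.
    rewrite addeACA -ge0_muleDr//; last 2 first.
    + by apply: integral_ge0 => x _; rewrite lee_fin sqmod_ge0.
    + by apply: sume_ge0 => i _; apply: integral_ge0 => x _; rewrite lee_fin sqmod_ge0.
    rewrite leeD2l// sumEFin -EFinD lee_fin sumr_const card_ord -mulr_natl.
    by rewrite -natr1 le_eqVlt; apply/orP; left; apply/eqP; ring.
  have lim0 : (2%:E * H1_sqdist D (g k) a + (4 * n.+1%:R * e k)%R%:E)%E @[k --> \oo] --> 0%E.
    have -> : 0%E = (2%:E * 0 + (4 * n.+1%:R * 0)%R%:E)%E :> \bar R.
      by rewrite mule0 mulr0 adde0.
    apply: cvgeD => //; first by apply: cvgeZl.
    apply: cvg_EFin; first exact: nearW.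
    by apply: cvgMl_tmp; exact: cvg_harmonic.
  apply: (@squeeze_cvge _ _ _ _ (cst 0%E) _ _ _ _ _ lim0); last exact: cvg_cst.
  apply: nearW => k /=; rewrite bound andbT /H1_sqdist adde_ge0//.
    by apply: integral_ge0 => x _; rewrite lee_fin sqmod_ge0.
  by apply: sume_ge0 => i _; apply: integral_ge0 => x _; rewrite lee_fin sqmod_ge0.
- apply: cvg_trans gB; apply: near_eq_cvg; apply: nearW => k.
  apply: eq_integral => x /set_mem /(boundary_closure x oD)[_ nDx].
  have -> : H k x = 0.
    apply: cpart_inj => b; rewrite cpart0.
    by case: b; [have [_ H0 _ _] := Hh (k, true)|have [_ H0 _ _] := Hh (k, false)]; exact: H0.
  by rewrite addr0.
Qed.

End gluing.

(** * Integration by parts for test functions *)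

Section test_parts.
Context {R : realType} {n : nat}.
Local Notation V := 'rV[R]_n.
Local Notation leb := (@lebesgue_rV R n).

Lemma integral_translate (a : V) (f : V -> \bar R) : measurable_fun setT f ->
  (\int[leb]_x f (a + x)%R = \int[leb]_x f x)%E.
Proof.
move=> mf; rewrite integralE [RHS]integralE; congr (_ - _)%E.
- rewrite -[RHS](@ge0_integral_rV_translate R n a (f^\+)%E)//.
    by apply: eq_integral => x _; rewrite !funeposE.
  exact: measurable_funepos.
- rewrite -[RHS](@ge0_integral_rV_translate R n a (f^\-)%E)//.
    by apply: eq_integral => x _; rewrite !funenegE.
  exact: measurable_funeneg.
Qed.

(* The difference quotients of [phi] have integral zero and converge boundedly
   to the derivative. *)
Lemma Rintegral_partial_test i (phi : V -> R) : test_function setT phi ->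
  \int[leb]_x partial i phi x = 0.
Proof.
move=> tp; have [L L0 HL] := test_lipschitz tp.
have [K [cK _] K0] := testP tp.
have /bounded_setP[M HM] := compact_bounded cK.
pose e : V := delta_mx 0 i; pose h k : R := k.+1%:R^-1.
have h0 k : 0 < h k by rewrite invr_gt0.
have h1 k : h k <= 1 by rewrite invf_le1// ler1n.
have e0 : 0 <= `|e| by exact: normr_ge0.
(* As [h k <= 1], all difference quotients vanish off this single ball, which provides an integrable
   bound. *)
pose B : set V := [set x | `|x| <= M%:R + `|e|].
have cB : closed B.
  by apply: (@closed_comp _ _ (fun x : V => `|x|) [set y | y <= M%:R + `|e|]);
    [move=> x _; exact: norm_continuous|exact: closed_le].
have mB : measurable B by exact: closed_measurable_rV.
have bB : bounded_set B by apply: (@norm_bounded_set _ _ _ (M%:R + `|e|)).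
pose f k x := (h k)^-1 * (phi (h k *: e + x) - phi x).
have mp : measurable_fun setT phi by exact: test_measurable tp.
have mt k : measurable_fun setT (fun x => phi (h k *: e + x)).
  apply: continuous_measurable_rV => x.
  have c1 : {for x, continuous (fun x : V => h k *: e + x)}.
    by apply: continuousD; [exact: cst_continuous|exact: cvg_id].
  apply: (continuous_comp c1).
  exact/smooth_cont/test_smooth/tp.
have mf k : measurable_fun setT (f k).
  by apply: measurable_funM => //; exact: measurable_funB.
have ft x : f k x @[k --> \oo] --> partial i phi x.
  have [dv _] := smooth_is_derive i x (test_smooth tp).
  have hc : h @ \oo --> (0 : R)^'.
    move=> P HP; have : \forall k \near \oo, h k != 0 -> P (h k).
      exact: (@cvg_harmonic R _ HP).
    by apply: filterS => k; apply; rewrite gt_eqF// h0.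
  exact: (cvg_comp _ _ hc dv).
have ip := test_integrable tp.
have it k : leb.-integrable setT (fun x => (phi (h k *: e + x))%:E).
  apply/integrableP; split; first exact/measurable_EFinP.
  rewrite (integral_translate (h k *: e) (f := fun x => `|(phi x)%:E|%E)).
    by have /integrableP[] := ip.
  by apply: measurableT_comp => //; exact/measurable_EFinP.
have f0 k : (\int[leb]_x (f k x)%:E = 0)%E.
  rewrite (eq_integral (fun x => ((h k)^-1)%:E * ((phi (h k *: e + x))%:E - (phi x)%:E))%E)//.
  rewrite integralZl//; last exact: integrableB.
  rewrite integralB//; rewrite (integral_translate (h k *: e) (f := EFin \o phi)).
    by rewrite subee ?mule0//; exact: integrable_fin_num.
  exact/measurable_EFinP.
have fB k x : `|f k x| <= L * `|e| * \1_B x.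
  rewrite indicE; have [/set_mem _|/negP xB] := boolP (x \in B).
    rewrite mulr1 normrM gtr0_norm ?invr_gt0// ler_pdivrMl//.
    by rewrite (le_trans (HL _ _))// addrK normrZ gtr0_norm//; rewrite mulrCA.
  have {}xB : M%:R + `|e| < `|x| by rewrite ltNge; apply/negP => H; apply: xB; exact: mem_set.
  rewrite /f !K0 ?subr0 ?mulr0 ?normr0//.
    by move=> /HM; lra.
  move=> /HM H; have := ler_normB (h k *: e + x) (h k *: e).
  rewrite [h k *: e + x]addrC addrK normrZ gtr0_norm// => H'.
  rewrite addrC in H.
  have : h k * `|e| <= `|e| by rewrite ler_piMl.
  by move: H H' xB; lra.
have iB := integrable_indic_bounded (L * `|e|) mB bB.
have [||||_ _ lim] := @dominated_convergence _ _ _ leb setT measurableT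
  (fun k => EFin \o f k) (EFin \o partial i phi) _ _ _ _ iB.
- by move=> k; exact/measurable_EFinP.
- by apply/measurable_EFinP; exact: test_measurable (test_partial i tp).
- by apply: aeW => x _; apply: cvg_EFin; [exact: nearW|exact: ft].
- by apply: aeW => x k _; rewrite lee_fin.
have /(cvg_unique (@ereal_hausdorff R) lim) E :
    (\int[leb]_x (EFin \o f k) x @[k --> \oo] --> 0)%E.
  by rewrite (_ : (fun k => _) = fun=> 0%E); [exact: cvg_cst|apply/funext => k; exact: f0].
by rewrite /Rintegral E.
Qed.

(** Makes the cutoffs themselves inner perturbations, for the case where every competitor has
    infinite energy. *)
Lemma test_global_wderiv i (phi : V -> R) : test_function setT phi ->
  global_wderiv i phi (partial i phi).
Proof.
move=> tp psi tq; have H := Rintegral_partial_test i (testMr tp (test_smooth tq)).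
have E : (fun x => partial i (fun x => phi x * psi x) x) =
    (fun x => phi x * partial i psi x + partial i phi x * psi x).
  by apply/funext => x; rewrite partialM; [rewrite [psi x * _]mulrC|exact: test_smooth tp|exact: test_smooth tq].
have i1 : leb.-integrable setT (EFin \o (fun x => phi x * partial i psi x)).
  by apply: sqint_mul => //; [exact: test_sqint tp|exact: test_sqint (test_partial i tq)].
have i2 : leb.-integrable setT (EFin \o (fun x => partial i phi x * psi x)).
  by apply: sqint_mul => //; [exact: test_sqint (test_partial i tp)|exact: test_sqint tq].
by apply/eqP; rewrite -addr_eq0 -RintegralD// -E H.
Qed.

End test_parts.

(** * Splitting the energy *)

Section mixing.
Context {R : realType} {n : nat}.
Hypothesis n_gt0 : (0 < n)%N.
Local Notation V := 'rV[R]_n.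
Local Notation C := R[i].
Local Notation leb := (@lebesgue_rV R n).
Variables (D O : set V).
Hypothesis oD : open D.
Hypothesis bD : bounded_set D.
Hypothesis oO : open O.
Hypothesis cOD : closure O `<=` D.
Variable zeta : nat -> V -> R.
Hypothesis zeta_test : forall m, test_function O (zeta m).
Hypothesis zeta01 : forall m x, 0 <= zeta m x <= 1.
Hypothesis zeta1 : forall x, O x -> \forall m \near \oo, zeta m x = 1.
Variable E : R.

Let OD : O `<=` D. Proof. by apply: subset_trans cOD; exact: subset_closure. Qed.
Let mD : measurable D. Proof. exact: open_measurable_rV. Qed.
Let mO : measurable O. Proof. exact: open_measurable_rV. Qed.
Let mDO : measurable (D `\` O). Proof. exact: measurableD. Qed.

Let DE : O `|` (D `\` O) = D.
Proof.
apply/seteqP; split=> [x [/OD//|[]//]|x Dx].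
by have [Ox|nOx] := pselect (O x); [left|right].
Qed.

Let dOD : [disjoint O & D `\` O].
Proof. by apply/disj_setPS => x [Ox [_]]. Qed.

Definition decoupled (u : V -> C) := forall b i,
  cvg2 (mu := leb) D (fun m x => cpartF b u x * partial i (zeta m) x) (fun=> 0).

Definition ccut (u : V -> C) : V -> C := fun x => if x \in O then u x else 0.

Lemma cpartF_ccut b u : cpartF b (ccut u) = sharp_cut O (cpartF b u).
Proof.
apply/funext => x; rewrite /cpartF /ccut /sharp_cut indicE.
by case: ifP => _; rewrite ?mul1r// mul0r cpart0.
Qed.

Lemma H1_sqint u : H1 D u -> forall b, sqint (mu := leb) D (cpartF b u).
Proof. by move=> [/(L2P oD)]. Qed.

Lemma grad_sqint u : H1 D u -> forall b i, sqint (mu := leb) D (cpartF b (grad D u i)).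
Proof. by move=> /grad_weak/weak_gradientP G b i; have [] := G oD i b. Qed.

Lemma grad_wderiv u : H1 D u ->
  forall b i, wderiv D i (cpartF b u) (cpartF b (grad D u i)).
Proof. by move=> /grad_weak/weak_gradientP G b i; have [] := G oD i b. Qed.

Lemma inner_ccut u : H1 D u -> decoupled u -> inner O (ccut u) (fun i => ccut (grad D u i)).
Proof.
move=> Hu du; split.
- by move=> b; rewrite cpartF_ccut; apply: (sharp_cut_sqint oD oO OD); exact: H1_sqint.
- by move=> b i; rewrite cpartF_ccut; apply: (sharp_cut_sqint oD oO OD); exact: grad_sqint.
- by move=> x Ox; rewrite /ccut memNset.
- by move=> i x Ox; rewrite /ccut memNset.
- move=> b i; rewrite !cpartF_ccut.
  apply: (sharp_cut_wderiv oD oO OD zeta_test zeta01 zeta1); [exact: H1_sqint|exact: grad_sqint| |].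
    exact: grad_wderiv.
  exact: du.
Qed.

Lemma innerB z w z' w' : inner O z w -> inner O z' w' ->
  inner O (fun x => z x - z' x) (fun i x => w i x - w' i x).
Proof.
move=> Hz Hz'; split.
- by move=> b; rewrite cpartFB; apply: sqintB; [exact: measurableT|exact: (inner_sq Hz b)|exact: (inner_sq Hz' b)].
- by move=> b i; rewrite cpartFB; apply: sqintB; [exact: measurableT|exact: (inner_gsq Hz b i)|exact: (inner_gsq Hz' b i)].
- by move=> x Ox; rewrite (inner_out Hz Ox) (inner_out Hz' Ox) subrr.
- by move=> i x Ox; rewrite (inner_gout Hz i Ox) (inner_gout Hz' i Ox) subrr.
- move=> b i; rewrite !cpartFB.
  apply: (wderivB openT); [exact: (inner_sq Hz b)|exact: (inner_sq Hz' b)|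
    exact: (inner_gsq Hz b i)|exact: (inner_gsq Hz' b i)|exact: (inner_wd Hz b i)|exact: (inner_wd Hz' b i)].
Qed.

(** Gluing of [b] on [O] with [a] elsewhere, written as [a] plus an inner perturbation so that the
    results on such perturbations apply. *)
Definition mix (a b : V -> C) : V -> C := fun x => a x + (ccut b x - ccut a x).

Lemma mix_in a b x : O x -> mix a b x = b x.
Proof. by move=> Ox; rewrite /mix /ccut mem_set// addrC subrK. Qed.

Lemma mix_out a b x : ~ O x -> mix a b x = a x.
Proof. by move=> Ox; rewrite /mix /ccut memNset// subrr addr0. Qed.

Section pair.
Variables a b : V -> C.
Hypothesis Ha : H1 D a.
Hypothesis Hb : H1 D b.
Hypothesis da : decoupled a.
Hypothesis db : decoupled b.

Let inner_mix : inner O (fun x => ccut b x - ccut a x)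
  (fun i x => ccut (grad D b i) x - ccut (grad D a i) x).
Proof. by apply: innerB; exact: inner_ccut. Qed.

Lemma mix_H1 : H1 D (mix a b).
Proof. exact: (add_inner_H1 oD Ha inner_mix). Qed.

Lemma mix_trace f : is_trace D a f -> is_trace D (mix a b) f.
Proof. exact: (add_inner_trace n_gt0 oD bD oO cOD Ha inner_mix). Qed.

Lemma mix_grad : {ae leb, forall x, D x -> forall i,
  grad D (mix a b) i x = mix (grad D a i) (grad D b i) x}.
Proof. exact: (add_inner_grad n_gt0 oD bD Ha inner_mix). Qed.

End pair.

Definition qint (q : V -> R) (A : set V) (u : V -> C) :=
  leb.-integrable A (fun x => (q x * sqmod (u x))%:E).

Definition density (q : V -> R) (u : V -> C) (x : V) : R :=
  \sum_i sqmod (grad D u i x) - (q x + E) * sqmod (u x).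

Lemma eq_density q u v x : u x = v x -> (forall i, grad D u i x = grad D v i x) ->
  density q u x = density q v x.
Proof. by move=> uv guv; rewrite /density uv; under eq_bigr do rewrite guv. Qed.

Lemma ae_Rintegral (A : set V) (f g : V -> R) : measurable A -> measurable_fun A f ->
  measurable_fun A g -> {ae leb, forall x, A x -> f x = g x} ->
  \int[leb]_(x in A) f x = \int[leb]_(x in A) g x.
Proof.
move=> mA mf mg fg; rewrite /Rintegral; congr fine.
apply: ae_eq_integral => //; [exact/measurable_EFinP..|].
by apply: filterS fg => x H /H /= ->.
Qed.

Definition part (q : V -> R) (A : set V) u : R := \int[leb]_(x in A) density q u x.

Lemma density_integrable q A u : measurable A -> A `<=` D -> H1 D u -> qint q A u ->
  leb.-integrable A (EFin \o density q u).
Proof.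
move=> mA AD Hu Hq.
have iS (f : V -> R) : leb.-integrable D (EFin \o f) -> leb.-integrable A (EFin \o f).
  exact: integrableS.
have i1 := iS _ (sqmod_integrable oD (H1_sqint Hu)).
have i2 : leb.-integrable A (EFin \o (fun x => \sum_i sqmod (grad D u i x))).
  have := integrable_sum mA (index_enum 'I_n) (P := xpredT)
    (fun i _ => iS _ (sqmod_integrable oD (fun b => grad_sqint Hu b i))).
  by apply: eq_integrable => // x _ /=; rewrite sumEFin.
have := integrableB_EFin mA (integrableB_EFin mA i2 Hq) (integrableZ_EFin mA E i1).
apply: eq_integrable => // x _ /=; congr EFin; rewrite /density; ring.
Qed.

Lemma energyE q u : H1 D u -> qint q D u ->
  energy D q E u = (part q (D `\` O) u + part q O u)%:E.
Proof.
move=> Hu Hq; rewrite /energy asboolT//.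
have iD := density_integrable mD (@subset_refl _ D) Hu Hq.
have fD := integrable_fin_num mD iD.
rewrite -(fineK fD) addrC; congr EFin.
rewrite -[LHS]/(\int[leb]_(x in D) density q u x) -{1}DE Rintegral_setU//.
by rewrite DE.
Qed.

Lemma energy_infinite q u : ~ qint q D u -> energy D q E u = +oo%E.
Proof. by move=> Hq; rewrite /energy asboolF. Qed.

Lemma part_ae q A u v : measurable A -> A `<=` D -> H1 D u -> H1 D v ->
  qint q A u -> qint q A v ->
  {ae leb, forall x, A x -> density q u x = density q v x} -> part q A u = part q A v.
Proof.
move=> mA AD Hu Hv qu qv; apply: ae_Rintegral => //; apply/measurable_EFinP.
- exact: (measurable_int _ (density_integrable mA AD Hu qu)).
- exact: (measurable_int _ (density_integrable mA AD Hv qv)).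
Qed.

Lemma qint_sub q A u : measurable A -> A `<=` D -> qint q D u -> qint q A u.
Proof. by move=> mA AD; apply: integrableS. Qed.

Lemma eq_qint q1 q2 A u v : measurable A ->
  (forall x, A x -> q1 x = q2 x) -> (forall x, A x -> u x = v x) -> qint q1 A u -> qint q2 A v.
Proof.
by move=> mA qq uv; apply: eq_integrable => // x /set_mem Ax /=; rewrite qq// uv.
Qed.

Lemma eq_part q1 q2 A u : (forall x, A x -> q1 x = q2 x) -> part q1 A u = part q2 A u.
Proof. by move=> qq; apply: eq_Rintegral => x /set_mem Ax; rewrite /density qq. Qed.

Section mix_energy.
Variables (q : V -> R) (a b : V -> C).
Hypothesis Ha : H1 D a.
Hypothesis Hb : H1 D b.
Hypothesis da : decoupled a.
Hypothesis db : decoupled b.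
Hypothesis qa : qint q (D `\` O) a.
Hypothesis qb : qint q O b.

Let DOD : D `\` O `<=` D. Proof. by move=> x []. Qed.

Lemma mix_qint : qint q D (mix a b).
Proof.
apply: (integrable_glue oD oO cOD).
  by apply: (eq_qint mO _ _ qb) => // x Ox; rewrite mix_in.
by apply: (eq_qint mDO _ _ qa) => // x [_ Ox]; rewrite mix_out.
Qed.

(** Integrability is asked of [a] only off [O] and of [b] only in [O], so the outer piece may come
    from a function whose energy is known to be finite only for another potential that agrees with
    [q] there. *)
Lemma mix_energy : energy D q E (mix a b) = (part q (D `\` O) a + part q O b)%:E.
Proof.
have Hm := mix_H1 Ha Hb da db; have qm := mix_qint.
rewrite energyE//; congr ((_ + _)%:E).
- apply: part_ae => //; first exact: qint_sub qm.
  apply: filterS (mix_grad Ha Hb da db) => x H [Dx Ox].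
  by apply: eq_density => [|i]; rewrite ?H// mix_out.
- apply: part_ae => //; first exact: qint_sub qm.
  apply: filterS (mix_grad Ha Hb da db) => x H Ox.
  by apply: eq_density => [|i]; [|rewrite H; last exact: OD]; rewrite mix_in.
Qed.

End mix_energy.

Definition cscale (t : R) (u : V -> C) : V -> C := fun x => u x * t%:C%C.

Lemma cpartF_scale b t u : cpartF b (cscale t u) = (fun x => t * cpartF b u x).
Proof. by apply/funext => x; rewrite /cpartF /cscale cpartMr mulrC. Qed.

Lemma sqmod_scale t (z : C) : sqmod (z * t%:C%C) = t ^+ 2 * sqmod z.
Proof. by rewrite !sqmodE !cpartMr; ring. Qed.

Lemma cscale0 u : cscale 0 u = fun=> 0.
Proof. by apply/funext => x; rewrite /cscale mulr0. Qed.

Section scale.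
Variables (t : R) (u : V -> C).
Hypothesis Hu : H1 D u.

Lemma scale_weak : weak_gradient D (cscale t u) (fun i => cscale t (grad D u i)).
Proof.
apply/weak_gradientP => // i b; rewrite !cpartF_scale; split.
  by apply: sqintZ => //; exact: grad_sqint.
by apply: (wderivZ oD); [exact: H1_sqint|exact: grad_sqint|exact: grad_wderiv].
Qed.

Lemma scale_H1 : H1 D (cscale t u).
Proof.
split; last by eexists; exact: scale_weak.
by apply/L2P => // b; rewrite cpartF_scale; apply: sqintZ => //; exact: H1_sqint.
Qed.

Lemma scale_grad : {ae leb, forall x, D x -> forall i,
  grad D (cscale t u) i x = cscale t (grad D u i) x}.
Proof.
apply: (weak_gradient_unique n_gt0 oD bD (u := cscale t u)); last exact: scale_weak.
exact: grad_weak scale_H1.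
Qed.

Lemma scale_decoupled : decoupled u -> decoupled (cscale t u).
Proof.
move=> du b i; rewrite /cvg2.
rewrite (_ : (fun k => _) = (fun k => t ^+ 2 *
  nrm2 (mu := leb) D (fun x => cpartF b u x * partial i (zeta k) x - 0))).
  have H : t ^+ 2 * nrm2 (mu := leb) D (fun x => cpartF b u x * partial i (zeta k) x - 0)
      @[k --> \oo] --> t ^+ 2 * 0 by apply: cvgMl_tmp; exact: du.
  by rewrite [t ^+ 2 * 0]mulr0 in H.
apply/funext => k; rewrite -nrm2Z//.
  by apply: eq_Rintegral => x _; rewrite cpartF_scale; congr (_ ^+ 2); ring.
have tz := test_partial i (zeta_test k); have [M M0 HM] := test_bounded tz.
under eq_fun do rewrite subr0.
apply: (@sqintMb _ _ _ _ _ mD _ _ M); [exact: H1_sqint| |by move=> x _].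
by apply: measurable_funTS; exact: test_measurable tz.
Qed.

Lemma scale_qint q A : measurable A -> qint q A u -> qint q A (cscale t u).
Proof.
move=> mA /(integrableZ_EFin mA (t ^+ 2)); apply: eq_integrable => // x _ /=.
by congr EFin; rewrite /cscale sqmod_scale; ring.
Qed.

Lemma scale_part q A : measurable A -> A `<=` D -> qint q A u ->
  part q A (cscale t u) = t ^+ 2 * part q A u.
Proof.
move=> mA AD qu; have iu := density_integrable mA AD Hu qu.
rewrite /part -RintegralZl//; apply: ae_Rintegral => //.
- apply/measurable_EFinP.
  exact: (measurable_int _ (density_integrable mA AD scale_H1 (scale_qint mA qu))).
- by apply/measurable_EFinP; exact: (measurable_int _ (integrableZ_EFin mA (t ^+ 2) iu)).
- apply: filterS scale_grad => x H Ax; rewrite /density mulrBr mulr_sumr; congr (_ - _).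
    by apply: eq_bigr => i _; rewrite H ?sqmod_scale//; exact: AD.
  by rewrite /cscale sqmod_scale; ring.
Qed.

End scale.

Lemma quadratic_lower (m P : R) : (forall t, m <= t ^+ 2 * P) -> 0 <= P.
Proof.
move=> H; rewrite leNgt; apply/negP => P0.
have a0 := normr_ge0 m; have am := ler_norm (- m); rewrite normrN in am.
(* Chosen so that [t * P = P - |m|], which is below [m]; as [t >= 1], also [t^2 * P <= t * P]. *)
pose t := 1 + `|m| / - P; have nP : 0 < - P by rewrite oppr_gt0.
have t1 : 1 <= t by rewrite lerDl divr_ge0// ltW.
have tP : t * - P = - P + `|m| by rewrite mulrDl mul1r divfK// gt_eqF.
by have := H t; rewrite expr2; nra.
Qed.

Lemma weak_gradient_ae u u' w : (forall b, sqint (mu := leb) D (cpartF b u)) ->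
  (forall b, sqint (mu := leb) D (cpartF b u')) ->
  {ae leb, forall x, D x -> u x = u' x} -> weak_gradient D u w -> weak_gradient D u' w.
Proof.
move=> su su' uu' /weak_gradientP G; apply/weak_gradientP => // i b.
have [sw dw] := G oD i b; split=> // phi tp; rewrite -dw//.
have mp : measurable_fun D (partial i phi).
  by apply: measurable_funTS; exact: test_measurable (test_partial i tp).
apply: ae_Rintegral => //.
- by apply: measurable_funM => //; exact: (su' b).1.
- by apply: measurable_funM => //; exact: (su b).1.
- by apply: filterS uu' => x H Dx; rewrite /cpartF H.
Qed.

Lemma decoupled0 : decoupled (fun=> 0).
Proof.
move=> b i; rewrite /cvg2 (_ : (fun k => _) = fun=> 0); first exact: cvg_cst.
apply/funext => k; rewrite /nrm2 (@eq_Rintegral _ _ _ _ _ (fun=> 0)).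
  by rewrite /Rintegral integral0_eq.
by move=> x _; rewrite /cpartF cpart0 mul0r subrr expr0n.
Qed.

Lemma zero_H1 u : H1 D u -> H1 D (fun=> 0).
Proof. by move=> /(scale_H1 0); rewrite cscale0. Qed.

Lemma zero_qint q A : qint q A (fun=> 0).
Proof.
have := integrable0 leb A; congr (integrable _ _ _); apply/funext => x.
by rewrite /sqmod /= expr0n addr0 mulr0.
Qed.

Lemma zero_part q A : measurable A -> A `<=` D -> H1 D (fun=> 0) -> part q A (fun=> 0) = 0.
Proof.
move=> mA AD H0; have := scale_part 0 H0 mA AD (zero_qint q A).
by rewrite cscale0 expr0n mul0r.
Qed.

(** All that the comparison of minimizers retains of the singularity of [q] along [H]. *)
Definition admissible q := forall u, H1 D u -> qint q D u -> decoupled u.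

Let DOD : D `\` O `<=` D. Proof. by move=> x []. Qed.

(** For 0 outside and [t b] inside, the lower bound reads [m <= t^2 * part q O b]; a quadratic form
    bounded from below is nonnegative. *)
Lemma inner_bounded_below_part q : admissible q -> inner_bounded_below D O q E ->
  forall b, H1 D b -> qint q D b -> 0 <= part q O b.
Proof.
move=> adm [m Hm] b Hb qb; apply: (@quadratic_lower m) => t.
have H0 := zero_H1 Hb; have qO := qint_sub mO OD qb.
have [Ht dt] := (scale_H1 t Hb, scale_decoupled t Hb (adm _ Hb qb)).
have := Hm (mix (fun=> 0) (cscale t b)) (mix_H1 H0 Ht decoupled0 dt) _.
rewrite mix_energy//; [|exact: decoupled0|exact: zero_qint|exact: scale_qint].
rewrite zero_part// add0r scale_part// lee_fin; apply.
by apply: aeW => x [_ Ox]; rewrite mix_out.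
Qed.

(** The bound 0 works. As [v] vanishes off [O] only almost everywhere, it is first replaced by its
    gluing with 0, which has the same gradient almost everywhere by uniqueness. *)
Lemma part_inner_bounded_below q : admissible q ->
  (forall b, H1 D b -> qint q D b -> 0 <= part q O b) -> inner_bounded_below D O q E.
Proof.
move=> adm pos; exists 0 => v Hv v0.
have [qv|nq] := pselect (qint q D v); last by rewrite energy_infinite// leey.
have [dv H0] := (adm _ Hv qv, zero_H1 Hv); have qO := qint_sub mO OD qv.
have Hv' := mix_H1 H0 Hv decoupled0 dv.
have qv' : qint q D (mix (fun=> 0) v) by apply: mix_qint => //; exact: zero_qint.
have vv' : {ae leb, forall x, D x -> v x = mix (fun=> 0) v x}.
  apply: filterS v0 => x vx Dx; have [Ox|nOx] := pselect (O x); first by rewrite mix_in.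
  by rewrite mix_out// vx.
have G := weak_gradient_ae (H1_sqint Hv) (H1_sqint Hv') vv' (grad_weak Hv).
have gg := weak_gradient_unique n_gt0 oD bD G (grad_weak Hv').
have dd : {ae leb, forall x, D x -> density q v x = density q (mix (fun=> 0) v) x}.
  apply: filterS2 vv' gg => x e1 e2 Dx; apply: eq_density => [|i]; first exact: e1.
  exact: e2.
have dA A : A `<=` D -> {ae leb, forall x, A x -> density q v x = density q (mix (fun=> 0) v) x}.
  by move=> AD; apply: filterS dd => x H /AD.
have -> : energy D q E v = energy D q E (mix (fun=> 0) v).
  rewrite energyE// energyE//; congr ((_ + _)%:E).
    by apply: part_ae (dA _ DOD) => //; exact: qint_sub.
  by apply: part_ae (dA _ OD) => //; exact: qint_sub.
rewrite mix_energy//; [|exact: decoupled0|exact: zero_qint].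
by rewrite zero_part// add0r lee_fin; exact: pos.
Qed.

Lemma minimizer_le q f u v : is_minimizer D q E f u -> H1 D v -> is_trace D v f ->
  (energy D q E u <= energy D q E v)%E.
Proof. by case=> _ _ -> Hv tv; apply: ereal_inf_lbound; exists v. Qed.

Lemma le_minimizer q f u : H1 D u -> is_trace D u f ->
  (forall v, H1 D v -> is_trace D v f -> (energy D q E u <= energy D q E v)%E) ->
  is_minimizer D q E f u.
Proof.
move=> Hu tu H; split=> //; apply/eqP; rewrite eq_le; apply/andP; split.
  by apply: le_ereal_inf_tmp => _ [v [Hv tv] <-]; exact: H.
by apply: ereal_inf_lbound; exists u.
Qed.

(** * Transfer of minimizers between potentials that agree off the inner domain *)

Section transfer.
Variables q1 q2 : V -> R.
Hypothesis adm1 : admissible q1.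
Hypothesis adm2 : admissible q2.
Hypothesis q12 : forall x, (D `\` O) x -> q1 x = q2 x.

Lemma finite_minimizer_transfer f u :
  (inner_bounded_below D O q1 E -> inner_bounded_below D O q2 E) ->
  is_minimizer D q1 E f u -> qint q1 D u -> is_minimizer D q2 E f (mix u (fun=> 0)).
Proof.
move=> ibb mu1 qu; have [Hu tu _] := mu1; have du := adm1 Hu qu.
have H0 := zero_H1 Hu; have [qo qi] := (qint_sub mDO DOD qu, qint_sub mO OD qu).
have pos1 b : H1 D b -> qint q1 D b -> 0 <= part q1 O b.
  move=> Hb qb; apply: (@quadratic_lower (part q1 O u)) => t.
  have [Ht dt] := (scale_H1 t Hb, scale_decoupled t Hb (adm1 Hb qb)).
  have qbO := qint_sub mO OD qb.
  have := minimizer_le mu1 (mix_H1 Hu Ht du dt) (mix_trace Hu Ht du dt tu).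
  rewrite energyE// mix_energy//; last exact: scale_qint.
  by rewrite scale_part// lee_fin lerD2l.
have pos2 := inner_bounded_below_part adm2 (ibb (part_inner_bounded_below adm1 pos1)).
have qo2 : qint q2 (D `\` O) u by apply: (eq_qint mDO q12 _ qo).
apply: le_minimizer; [exact: (mix_H1 Hu H0 du decoupled0)|exact: (mix_trace Hu H0 du decoupled0 tu)|].
move=> v Hv tv; have [qv|nq] := pselect (qint q2 D v); last by rewrite [leRHS]energy_infinite// leey.
have [qov qiv] := (qint_sub mDO DOD qv, qint_sub mO OD qv); have dv := adm2 Hv qv.
have qov1 : qint q1 (D `\` O) v by apply: (eq_qint mDO _ _ qov) => // x /q12.
have := minimizer_le mu1 (mix_H1 Hv H0 dv decoupled0) (mix_trace Hv H0 dv decoupled0 tv).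
rewrite energyE// mix_energy//; [|exact: decoupled0|exact: zero_qint].
rewrite mix_energy//; [|exact: decoupled0|exact: zero_qint].
rewrite energyE// !zero_part// !addr0 !lee_fin -!(eq_part _ q12).
by have := pos1 _ Hu qu; have := pos2 _ Hv qv; lra.
Qed.

(** A competitor of finite energy for [q2], set to 0 in [O], would have finite energy for [q1] and
    contradict the infinite minimum. So both functionals are constantly infinite on this trace. *)
Lemma infinite_minimizer_transfer f u v : is_minimizer D q1 E f u -> ~ qint q1 D u ->
  H1 D v -> is_trace D v f -> is_minimizer D q2 E f v.
Proof.
move=> mu1 nqu.
have inf2 w : H1 D w -> is_trace D w f -> ~ qint q2 D w.
  move=> Hw tw qw; have [H0 dw] := (zero_H1 Hw, adm2 Hw qw).
  have qow : qint q1 (D `\` O) w.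
    by apply: (eq_qint mDO _ _ (qint_sub mDO DOD qw)) => // x /q12.
  have := minimizer_le mu1 (mix_H1 Hw H0 dw decoupled0) (mix_trace Hw H0 dw decoupled0 tw).
  rewrite energy_infinite// mix_energy//; [exact: decoupled0|exact: zero_qint].
move=> Hv tv; apply: le_minimizer => // w Hw tw.
by rewrite [leRHS]energy_infinite ?leey//; exact: inf2.
Qed.

End transfer.

(** * Normal derivatives and Cauchy data *)

Lemma Rintegral_sub_off (A B : set V) (g : V -> R) : B `<=` A ->
  (forall x, A x -> ~ B x -> g x = 0) -> \int[leb]_(x in A) g x = \int[leb]_(x in B) g x.
Proof.
move=> BA g0; rewrite Rintegral_mkcond [RHS]Rintegral_mkcond; apply: eq_Rintegral => x _.
rewrite !patchE; case: (boolP (x \in B)) => [/set_mem /BA Ax|/negP Bx].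
  by rewrite mem_set.
case: (boolP (x \in A)) => // /set_mem Ax; apply: g0 => // /mem_set; exact: Bx.
Qed.

Lemma eq_cintegral (A B : set V) (g h : V -> C) :
  (forall b, \int[leb]_(x in A) cpartF b g x = \int[leb]_(x in B) cpartF b h x) ->
  cintegral A g = cintegral B h.
Proof.
move=> gh; rewrite /cintegral.
by rewrite -[X in Complex X _]/(\int[leb]_(x in A) cpartF true g x)
  -[X in Complex _ X]/(\int[leb]_(x in A) cpartF false g x) !gh.
Qed.

(** The neighbourhood [U] may be shrunk by removing the closure of [O], which lies in the open set
    [D] and thus misses its boundary. What remains sees only the gradient off [O], so the same
    functional and the same [F] serve for [u']. *)
Lemma normal_derivative_transfer u u' g : H1 D u -> H1 D u' ->
  {ae leb, forall x, (D `\` O) x -> forall i, grad D u i x = grad D u' i x} ->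
  is_normal_derivative D u g -> is_normal_derivative D u' g.
Proof.
move=> Hu Hu' guu' [gb [U [F [oU bU LF HF HG]]]]; split=> //.
pose U' := U `&` ~` closure O.
have oU' : open U' by apply: openI => //; apply: closed_openC; exact: closed_closure.
have U'O x : O x -> ~ U' x by move=> Ox [_]; apply; exact: subset_closure.
have dir phi : test_function U' phi -> dirichlet_form D u phi = dirichlet_form D u' phi.
  move=> tp; have mp i : measurable_fun D (partial i phi).
    by apply: measurable_funTS; exact: test_measurable (test_partial i tp).
  have part_sum b v : cpartF b (fun x => \sum_i grad D v i x * (partial i phi x)%:C%C) =
      (fun x => \sum_i cpartF b (grad D v i) x * partial i phi x).
    apply/funext => x; rewrite /cpartF (big_morph (cpart b) (cpartD b) (cpart0 b)).
    by apply: eq_bigr => i _; rewrite cpartMr.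
  have msum v b : H1 D v -> measurable_fun D
      (cpartF b (fun x => \sum_i grad D v i x * (partial i phi x)%:C%C)).
    move=> Hv; rewrite part_sum; apply: measurable_sum => i.
    by apply: measurable_funM => //; exact: (grad_sqint Hv b i).1.
  have eqI b : \int[leb]_(x in D) cpartF b (fun x => \sum_i grad D u i x * (partial i phi x)%:C%C) x =
      \int[leb]_(x in D) cpartF b (fun x => \sum_i grad D u' i x * (partial i phi x)%:C%C) x.
    apply: ae_Rintegral => //; [exact: msum..|].
    apply: filterS guu' => x H Dx; rewrite !part_sum; apply: eq_bigr => i _.
    have [Ox|nOx] := pselect (O x); last by rewrite /cpartF H.
    by rewrite (test0 (test_partial i tp) (U'O x Ox)) !mulr0.
  exact: (eq_cintegral eqI).
have cut phi : test_function U' phi ->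
    cintegral (D `&` U) (fun x => F x * (phi x)%:C%C) =
    cintegral (D `&` U') (fun x => F x * (phi x)%:C%C).
  move=> tp; have eqI b : \int[leb]_(x in D `&` U) cpartF b (fun x => F x * (phi x)%:C%C) x =
      \int[leb]_(x in D `&` U') cpartF b (fun x => F x * (phi x)%:C%C) x.
    apply: Rintegral_sub_off; first by move=> x [Dx [Ux _]].
    move=> x [Dx Ux] nU'; rewrite /cpartF cpartMr (test0 tp) ?mulr0// => H.
    by apply: nU'.
  exact: (eq_cintegral eqI).
have DU'U : D `&` U' `<=` D `&` U by move=> x [Dx [Ux _]].
exists U', F; split => //.
- move=> x bx; split; first exact: bU.
  by move=> /cOD; have [_ ] := (boundary_closure x oD).1 bx.
- by case: LF => L1 L2; split; apply: integrableS DU'U _ => //;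
    apply: open_measurable_rV; exact: openI.
- move=> phi tp; have tp' : test_function U' phi by apply: test_sub tp => x [].
  by rewrite -dir// -cut// HF//; exact: test_sub tp.
- by move=> phi tp; rewrite -dir// -cut// HG//; apply: test_sub tp => x [].
Qed.

Lemma cauchy_data_sub q1 q2 : admissible q1 -> admissible q2 ->
  (forall x, (D `\` O) x -> q1 x = q2 x) ->
  (inner_bounded_below D O q1 E -> inner_bounded_below D O q2 E) ->
  cauchy_data D q1 E `<=` cauchy_data D q2 E.
Proof.
move=> adm1 adm2 q12 ibb [f g] /= [u mu1 nu]; have [Hu tu _] := mu1.
have [qu|nqu] := pselect (qint q1 D u); last first.
  exists u => //; exact: (infinite_minimizer_transfer adm2 q12 mu1 nqu).
have [H0 du] := (zero_H1 Hu, adm1 _ Hu qu).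
exists (mix u (fun=> 0)); first exact: (finite_minimizer_transfer adm1 adm2 q12 ibb mu1 qu).
apply: normal_derivative_transfer nu => //; first exact: (mix_H1 Hu H0 du decoupled0).
apply: filterS (mix_grad Hu H0 du decoupled0) => x H [Dx Ox] i.
by rewrite H// mix_out.
Qed.

(** Both components are [zeta m], so that the real and the imaginary case are the same statement. *)
Lemma inner_zeta m : inner O (fun x => Complex (zeta m x) (zeta m x))
  (fun i x => Complex (partial i (zeta m) x) (partial i (zeta m) x)).
Proof.
have tz := zeta_test m; have tT := test_subT tz.
split.
- by case; exact: test_sqint tz.
- by case=> i; exact: test_sqint (test_partial i tz).
- by move=> x Ox; rewrite (test0 tz Ox).
- by move=> i x Ox; rewrite (test0 (test_partial i tz) Ox).
- by case=> i; exact: test_global_wderiv.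
Qed.

Lemma unique_minimizer_vanishes q f u : admissible q -> is_minimizer D q E f u ->
  (forall v, is_minimizer D q E f v -> {ae leb, forall x, D x -> v x = u x}) ->
  {ae leb, forall x, O x -> u x = 0}.
Proof.
move=> adm mu1 uniq; have [Hu tu _] := mu1.
have [qu|nqu] := pselect (qint q D u).
  (* The transfer is applied from [q] to itself: [u] set to 0 in [O] is again a minimizer. *)
  have := finite_minimizer_transfer adm adm (fun _ _ => erefl) id mu1 qu.
  move=> /uniq; apply: filterS => x H Ox.
  by rewrite -H; [rewrite mix_in|exact: OD].
(* When the minimum is infinite, [u] plus the cutoff is a minimizer too, so uniqueness makes every
   [zeta m] vanish almost everywhere. Each point of [O] has [zeta m = 1] for some [m], so almost
   every point of [O] yields a contradiction. *)
have Z m : {ae leb, forall x, D x -> zeta m x = 0}.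
  have Hz := inner_zeta m.
  have := infinite_minimizer_transfer adm (fun _ _ => erefl) mu1 nqu
    (add_inner_H1 oD Hu Hz) (add_inner_trace n_gt0 oD bD oO cOD Hu Hz tu).
  move=> /uniq; apply: filterS => x H /H.
  by rewrite -{2}[u x]addr0 => /addrI[].
apply: filterS (ae_foralln Z) => x H Ox.
have [N _ /(_ N (leqnn N)) e] := zeta1 Ox.
by move: (H N (OD Ox)); rewrite e => /eqP; rewrite oner_eq0.
Qed.

End mixing.

Theorem proposition4p1 (R : realType) (n : nat) (n_gt0 : (0 < n)%N)
  (Omega Omega0 H : set 'rV[R]_n) (mu E : R)
  (Omega_domain : domain Omega)
  (Omega_bounded : bounded_set Omega)
  (Omega_lipschitz : lipschitz_boundary Omega)
  (H_hypersurface : closed_hypersurface H)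
  (H_sub : H `<=` Omega)
  (Omega0_nonempty : Omega0 !=set0)
  (Omega0_open : open Omega0)
  (Omega0_compact : compact (closure Omega0))
  (Omega0_sub : closure Omega0 `<=` Omega)
  (H_boundary : boundary Omega0 = H)
  (mu_lt : mu < - 2) :
  (forall q1 q2 : 'rV[R]_n -> R,
     singular_potential Omega H mu q1 ->
     singular_potential Omega H mu q2 ->
     (forall x, (Omega `\` Omega0) x -> q1 x = q2 x) ->
     (inner_bounded_below Omega Omega0 q1 E <->
      inner_bounded_below Omega Omega0 q2 E) ->
     cauchy_data Omega q1 E = cauchy_data Omega q2 E) /\
  (forall (q : 'rV[R]_n -> R) (f u : 'rV[R]_n -> R[i]),
     singular_potential Omega H mu q ->
     is_minimizer Omega q E f u ->
     (forall v, is_minimizer Omega q E f v ->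
        {ae lebesgue_rV n, forall x, Omega x -> v x = u x}) ->
     {ae lebesgue_rV n, forall x, Omega0 x -> u x = 0}).
Proof.
have oD : open Omega by case: Omega_domain.
have bO : bounded_set Omega0.
  have [k Hk] := bounded_setP Omega_bounded.
  apply: (@norm_bounded_set _ _ _ k%:R) => x Ox.
  exact/Hk/Omega0_sub/subset_closure.
have [c [c0 [zeta [Hz zeta1]]]] := cutoff n_gt0 Omega0_open bO.
have zt m : test_function Omega0 (zeta m) by have [] := Hz m.
have z01 m x : 0 <= zeta m x <= 1 by have [] := Hz m.
have adm q : singular_potential Omega H mu q -> admissible Omega zeta q.
  move=> Hq u Hu qu b i.
  have zle m := let: And4 _ _ H _ := Hz m in H.
  have zstrip m := let: And4 _ _ _ H := Hz m in H.
  exact: (singular_cvg2 oD Omega0_open bO H_hypersurface.1 H_boundary mu_lt c0 zt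
    zle zstrip b i Hq (H1_sqint oD Hu) qu).
have sub q1 q2 := cauchy_data_sub n_gt0 oD Omega_bounded Omega0_open Omega0_sub
  zt z01 zeta1 (E := E) (q1 := q1) (q2 := q2).
split=> [q1 q2 /adm a1 /adm a2 q12 [i12 i21]|q f u /adm a mu1 uniq].
  by apply/seteqP; split; apply: sub => // x /q12.
exact: (unique_minimizer_vanishes n_gt0 oD Omega_bounded Omega0_open Omega0_sub
  zt z01 zeta1 a mu1 uniq).
Qed.
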